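(* Let $\Delta\in\mathbb R$, and let $\tilde F:\mathbb T^2\to\mathbb T^2$ be the map $\tilde F(\tau,I)=(\bar\tau,\bar I)$ with $$\bar\tau=\tau-I \bmod 1,\qquad \bar I=I+\Delta\bigl(\bar\tau-\tfrac12\bigr)\bmod 1,$$ where the representative $\bar\tau\in[0,1)$ is used in the second formula. Let $A$ be the constant matrix $d\tilde F$, so that $\mathrm{Tr}(A)=2-\Delta$. If $|\mathrm{Tr}(A)|>2$, then $\tilde F$ is ergodic, mixing and enjoys exponential decay of correlations for Hölder observables (with respect to Lebesgue measure on $\mathbb T^2$).
   Context: $\mathbb T^2=\mathbb R^2/\mathbb Z^2$. The map $\tilde F$ is piecewise affine and preserves Lebesgue measure $\mathrm{Leb}$. Exponential decay of correlations for Hölder observables means: for Hölder continuous $\phi,\psi:\mathbb T^2\to\mathbb R$ of a given exponent there are constants $C>0$ and $\theta\in(0,1)$ ($\theta$ depending only on the exponent and on $\Delta$) with $\left|\int \phi\cdot(\psi\circ\tilde F^n)\,d\mathrm{Leb}-\int\phi\,d\mathrm{Leb}\int\psi\,d\mathrm{Leb}\right|\le C\theta^n$ for all $n\ge0$. *)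

(* Defs.v *)
From HB Require Import structures.
From mathcomp Require Import all_boot all_order all_algebra ring_quotient.
From mathcomp Require Import all_classical all_reals all_analysis ring.

Set Implicit Arguments.
Unset Strict Implicit.
Unset Printing Implicit Defensive.
Import Order.TTheory GRing.Theory Num.Theory.
Import numFieldNormedType.Exports.

Local Open Scope classical_set_scope.
Local Open Scope ring_scope.
Local Open Scope quotient_scope.

(* The subgroup Z of R: [Num.int_num_subdef] is the predicate underlying
   [Num.int]. *)
Definition integers (R : realType) : zmodClosed R :=
  GRing.ZmodClosed.clone R Num.int_num_subdef _.

(* R/Z as the library quotient of the additive group R by the subgroup of
   integers.  It is used below as an additive group: + and - are those of
   R/Z. *)
Definition circle (R : realType) : Type := {ideal_quot integers R}.

Fact circle_display : measure_display. Proof. exact: default_measure_display. Qed.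

Section circle.
Variable R : realType.

HB.instance Definition _ := GRing.Zmodule.copy (circle R)
  {ideal_quot integers R}.
HB.instance Definition _ := isPointed.Build (circle R) 0.

Definition toCircle (x : R) : circle R := \pi_({ideal_quot integers R}) x.

(* The representative in [0, 1[; [repr] alone is an arbitrary one. *)
Definition rep (t : circle R) : R :=
  let x := repr (t : {ideal_quot integers R}) in x - (Num.floor x)%:~R.

(* The quotient sigma-algebra of the Borel sigma-algebra of R. *)
Definition circle_measurable : set (set (circle R)) :=
  image_set_system setT toCircle measurable.

Let circle_sigma : sigma_algebra setT circle_measurable.
Proof. exact/sigma_algebra_image/sigma_algebra_measurable. Qed.

Let circle_measurable0 : circle_measurable set0.
Proof. by case: circle_sigma. Qed.

Let circle_measurableC A : circle_measurable A -> circle_measurable (~` A).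
Proof. by case: circle_sigma => _ + _ => /[apply]; rewrite setTD. Qed.

Let circle_measurable_bigcup (F : (set (circle R))^nat) :
  (forall i, circle_measurable (F i)) -> circle_measurable (\bigcup_i F i).
Proof. by case: circle_sigma => _ _; apply. Qed.

HB.instance Definition _ := @isMeasurable.Build circle_display (circle R)
  circle_measurable circle_measurable0 circle_measurableC
  circle_measurable_bigcup.

Let measurable_toCircle : measurable_fun [set: R] toCircle.
Proof. by move=> _ B. Qed.

(* Lebesgue measure of R/Z: Lebesgue measure of the lift to [0, 1[. *)
Definition leb_circle : set (circle R) -> \bar R :=
  pushforward (mrestr lebesgue_measure (measurable_itv `[(0 : R), 1[)) toCircle.

Let leb_circle0 : leb_circle set0 = 0%E.
Proof. by rewrite /leb_circle /pushforward preimage_set0 measure0. Qed.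

Let leb_circle_ge0 A : (0 <= leb_circle A)%E.
Proof. exact: measure_ge0. Qed.

Let leb_circle_sigma_additive : semi_sigma_additive leb_circle.
Proof.
move=> F mF tF mUF; rewrite /leb_circle /pushforward preimage_bigcup.
apply: measure_semi_sigma_additive.
- by move=> n; rewrite -[X in measurable X]setTI; exact: measurable_toCircle.
- apply/trivIsetP => /= i j _ _ ij; rewrite -preimage_setI.
  by move/trivIsetP : tF => /(_ _ _ _ _ ij) ->//; rewrite preimage_set0.
- by rewrite -preimage_bigcup -[X in measurable X]setTI; exact: measurable_toCircle.
Qed.

HB.instance Definition _ := isMeasure.Build _ _ _
  leb_circle leb_circle0 leb_circle_ge0 leb_circle_sigma_additive.

Let leb_circle_setT : leb_circle setT = 1%E.
Proof.
rewrite /leb_circle /pushforward /mrestr preimage_setT setTI.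
by rewrite lebesgue_measure_itv /= lte_fin ltr01 oppr0 adde0.
Qed.

HB.instance Definition _ := Measure_isProbability.Build _ _ _
  leb_circle leb_circle_setT.

End circle.

(* T^2 = R^2/Z^2 = (R/Z) x (R/Z), with the product sigma-algebra. *)
Definition torus (R : realType) : Type := (circle R * circle R)%type.

Definition toTorus (R : realType) (x : R * R) : torus R :=
  (toCircle x.1, toCircle x.2).

HB.instance Definition _ (R : realType) :=
  Measurable.copy (torus R) (circle R * circle R)%type.

Definition leb_torus (R : realType) : probability (torus R) R :=
  (@leb_circle R \x @leb_circle R)%E.

(* [tau] is computed in the group R/Z, so that [rep tau] does not depend on
   representatives; reduction of the second coordinate modulo 1 is [toCircle]. *)
Definition Ftilde (R : realType) (Delta : R) (p : torus R) : torus R :=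
  let tau := p.1 - p.2 in
  (tau, p.2 + toCircle (Delta * (rep tau - 2^-1))).

Definition mxact (R : realType) (A : 'M[R]_2) (v : R * R) : R * R :=
  (A 0 0 * v.1 + A 0 1 * v.2, A 1 0 * v.1 + A 1 1 * v.2).

(* The matrix of the differential at p of a self-map of the torus, read in the
   charts of R^2/Z^2 given by the local inverses of [toTorus]: G is a local
   lift of the map near a lift x of p. *)
Definition has_differential (R : realType) (f : torus R -> torus R)
    (p : torus R) (A : 'M[R]_2) : Prop :=
  forall x : R * R, toTorus x = p ->
  exists G : R * R -> R * R,
    (\forall y \near x, toTorus (G y) = f (toTorus y)) /\
    is_diff x G (mxact A).

(* [Ftilde Delta] can only be discontinuous where the first coordinate of the
   image is 0; A is its differential at all other points. *)
Definition is_dFtilde (R : realType) (Delta : R) (A : 'M[R]_2) : Prop :=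
  forall p : torus R, p.1 - p.2 != 0 -> has_differential (Ftilde Delta) p A.

Definition circle_dist (R : realType) (s t : circle R) : R :=
  Num.min (rep (s - t)) (1 - rep (s - t)).

(* The quotient metric of the sup norm of R^2, equivalent to the flat one. *)
Definition torus_dist (R : realType) (p q : torus R) : R :=
  Num.max (circle_dist p.1 q.1) (circle_dist p.2 q.2).

Definition holder (R : realType) (alpha : R) (phi : torus R -> R) : Prop :=
  exists L : R, forall p q : torus R,
    `|phi p - phi q| <= L * torus_dist p q `^ alpha.

Section dynamics.
Context d (T : measurableType d) (R : realType).
Implicit Types (mu : probability T R) (f : T -> T).

Definition measure_preserving mu f : Prop :=
  measurable_fun setT f /\
  forall B, measurable B -> mu (f @^-1` B) = mu B.

Definition ergodic mu f : Prop :=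
  measure_preserving mu f /\
  forall B, measurable B -> f @^-1` B = B -> mu B = 0%E \/ mu B = 1%E.

Definition mixing mu f : Prop :=
  measure_preserving mu f /\
  forall B C, measurable B -> measurable C ->
    mu (B `&` iter n f @^-1` C) @[n --> \oo] --> (mu B * mu C)%E.

End dynamics.

(* theta is uniform over the observables of a given exponent; C is not. *)
Definition exp_decay_of_correlations (R : realType) (f : torus R -> torus R) :
    Prop :=
  forall alpha : R, 0 < alpha <= 1 ->
  exists theta : R, 0 < theta < 1 /\
  forall phi psi : torus R -> R, holder alpha phi -> holder alpha psi ->
  exists C : R, 0 < C /\ forall n : nat,
    `| \int[leb_torus R]_p (phi p * psi (iter n f p))
       - (\int[leb_torus R]_p phi p) * (\int[leb_torus R]_p psi p) |
    <= C * theta ^+ n.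

Lemma toCircleD (R : realType) : {morph @toCircle R : x y / x + y}.
Proof. by move=> x y; rewrite /toCircle piE. Qed.

Lemma toCircleB (R : realType) : {morph @toCircle R : x y / x - y}.
Proof. by move=> x y; rewrite /toCircle piE. Qed.

Lemma toCircle_eq (R : realType) (x y : R) :
  toCircle x = toCircle y <-> x - y \is a Num.int.
Proof.
have -> : (x - y \is a Num.int) = (x - y \in integers R) by [].
by rewrite Quotient.idealrBE; split=> [h|/eqP]; [apply/eqP|].
Qed.

Lemma rep_toCircle (R : realType) (x : R) :
  rep (toCircle x) = x - (Num.floor x)%:~R.
Proof.
rewrite /rep; set y := repr _.
have : toCircle y = toCircle x by exact: reprK.
move=> /toCircle_eq/intrP[m ym].
have -> : y = x + m%:~R by rewrite -ym addrC subrK.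
rewrite floorDrz ?intr_int// intrKfloor intrD; ring.
Qed.


Section mxact.
Variables (R : realType) (A : 'M[R]_2).
Lemma mxact_is_linear : linear (mxact A).
Proof.
move=> k u v; rewrite /mxact; congr pair; rewrite /= -/(GRing.scale _ _) ;
  rewrite /GRing.scale /=; ring.
Qed.

HB.instance Definition _ := GRing.isLinear.Build R (R * R)%type (R * R)%type _
  (mxact A) mxact_is_linear.
Lemma mxact_continuous : continuous (mxact A).
Proof.
move=> x; rewrite /mxact; apply: (@cvg_pair _ _ _ _ (nbhs _) (nbhs _));
  by apply: cvgD; apply: cvgMr; first [exact: cvg_fst | exact: cvg_snd].
Qed.

Lemma is_diff_mxact (c x : R * R) : is_diff x (mxact A \+ cst c) (mxact A).
Proof.
have Hm : is_diff x (mxact A : R * R -> R * R) (mxact A).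
  apply: DiffDef; first exact/linear_differentiable/mxact_continuous.
  by rewrite diff_lin //; exact: mxact_continuous.
have -> : mxact A \+ cst c = (mxact A : R * R -> R * R) + cst c by [].
apply: is_diff_eq; exact: addr0.
Qed.

End mxact.
(* The differential required by [is_dFtilde] exists and is unique, with
   trace 2 - Delta. *)
Definition dFtilde (R : realType) (Delta : R) : 'M[R]_2 :=
  \matrix_(i, j) (if i == 0 then if j == 0 then 1 else -1
                  else if j == 0 then Delta else 1 - Delta).

Lemma is_dFtilde_dFtilde (R : realType) (Delta : R) :
  is_dFtilde Delta (dFtilde Delta).
Proof.
move=> p p12 x xp.
have xnz : x.1 - x.2 \isn't a Num.int.
  apply: contra p12 => h; rewrite -xp /= -toCircleB.
  have -> : 0 = toCircle 0 :> circle R by rewrite /toCircle piE.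
  by apply/eqP/toCircle_eq; rewrite subr0.
pose c := (Num.floor (x.1 - x.2))%:~R : R.
exists (mxact (dFtilde Delta) \+ cst (0, - Delta * (c + 2^-1))); split; last first.
  exact: is_diff_mxact.
have c1 : c < x.1 - x.2.
  rewrite lt_neqAle floor_le andbT; apply: contra xnz => /eqP <-.
  exact: intr_int.
have c2 : x.1 - x.2 < c + 1 by have := floorD1_gt (x.1 - x.2); rewrite intrD.
have cvgx : (fun y : R * R => y.1 - y.2) y @[y --> x] --> x.1 - x.2.
  by apply: cvgB; [exact: cvg_fst|exact: cvg_snd].
near=> y.
have y1 : c < y.1 - y.2.
  by near: y; exact: (cvgr_gt _ cvgx).
have y2 : y.1 - y.2 < c + 1.
  by near: y; exact: (cvgr_lt _ cvgx).
have fy : Num.floor (y.1 - y.2) = Num.floor (x.1 - x.2).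
  by apply/floor_def; rewrite ltW//= intrD.
rewrite /Ftilde /toTorus /= !mxE /=; congr pair.
  by rewrite -toCircleB; congr toCircle; ring.
rewrite -toCircleB rep_toCircle fy -/c -toCircleD; congr toCircle; ring.
Unshelve. all: by end_near.
Qed.

Lemma is_dFtilde_unique (R : realType) (Delta : R) (A : 'M[R]_2) :
  is_dFtilde Delta A -> A = dFtilde Delta.
Proof.
move=> hA.
pose x : R * R := (2^-1, 0).
have hx : (toTorus x).1 - (toTorus x).2 != 0.
  rewrite /= -toCircleB subr0; apply/eqP.
  have -> : 0 = toCircle 0 :> circle R by rewrite /toCircle piE.
  move=> /toCircle_eq; rewrite subr0 => /norm_intr_ge1.
  rewrite gtr0_norm ?invr_gt0// invr_eq0 pnatr_eq0 => /(_ isT).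
  by rewrite invf_ge1 ?ltr0n// (ler_nat _ 2 1).
have [G [GF dG]] := hA _ hx _ erefl.
have [H [HF dH]] := @is_dFtilde_dFtilde R Delta _ hx x erefl.
have dK : is_diff x (G - H) (mxact A - mxact (dFtilde Delta)) by exact: is_diffB.
have Kc : \forall y \near x, (G - H) y = cst ((G - H) x) y.
  have Kx : {for x, continuous (G - H)} by apply: differentiable_continuous; case: dK.
  have toT u v : toTorus u = toTorus v ->
      u.1 - v.1 \is a Num.int /\ u.2 - v.2 \is a Num.int.
    by case=> /toCircle_eq ? /toCircle_eq.
  have Kint : \forall y \near x, ((G - H) y).1 \is a Num.int /\
                                ((G - H) y).2 \is a Num.int.
    near=> y; apply: toT; transitivity (Ftilde Delta (toTorus y)).
      by near: y.
    by apply: esym; near: y.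
  have [Kx1 Kx2] := nbhs_singleton Kint.
  have near1 := @cvgr_dist_lt R (R * R)%type _ (nbhs x) _ (G - H) _ Kx 1 ltr01.
  near=> y.
  have Kd : `|(G - H) x - (G - H) y| < 1 by near: y; exact: near1.
  have [Ky1 Ky2] : ((G - H) y).1 \is a Num.int /\ ((G - H) y).2 \is a Num.int.
    by near: y.
  have Z (a b : R) : a \is a Num.int -> b \is a Num.int -> `|a - b| < 1 -> b = a.
    move=> ai bi; apply: contraTeq => ab; rewrite -leNgt.
    by apply: norm_intr_ge1; rewrite ?rpredB// subr_eq0 eq_sym.
  move: Kd; rewrite prod_normE gt_max => /andP[/Z -/(_ Kx1 Ky1) K1].
  move=> /Z -/(_ Kx2 Ky2) K2.
  by rewrite /cst; apply: injective_projections.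
have D0 v : mxact A v = mxact (dFtilde Delta) v.
  apply/eqP; rewrite -subr_eq0.
  have -> : mxact A v - mxact (dFtilde Delta) v = 'd (G - H) x v by rewrite diff_val.
  rewrite -deriveE; last by case: dK.
  by apply/eqP; apply: etrans (near_eq_derive _ Kc) _; exact: derive_cst.
have := D0 (1, 0); have := D0 (0, 1).
rewrite /mxact /= !(mulr0, mulr1, addr0, add0r) => -[e1 e2] [e3 e4].
apply/matrixP => i j.
have I2 (k : 'I_2) : k = 0 \/ k = 1.
  by case: k => [[|[|//]]] ?; [left|right]; apply/val_inj.
by case: (I2 i) => ->; case: (I2 j) => ->.
Unshelve. all: by end_near.
Qed.

Lemma mxtrace_dFtilde (R : realType) (Delta : R) : \tr (dFtilde Delta) = 2 - Delta.
Proof. rewrite /mxtrace big_ord_recl big_ord1 !mxE /=; ring. Qed.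

(* Main.v *)
(* Let l be the unstable eigenvalue of A = dF, with eigenvector (1, 1 - l); the
   map F is affine except for a cut along the circle where the first coordinate
   of the image vanishes.

   Mixing is a Hopf argument that copes with the cut.  Let g be a weak limit of
   f o F^n and k a weak limit of g o F^(-m) along an ultrafilter.  A point and
   its translate by eps along a stable (resp. unstable) vector have the same
   future (resp. past) itinerary unless their orbit comes within
   eps |l|^(-|i|) of the cut.  Going from x to its translate along either side
   of a stable-unstable rectangle, at least one of the two ways avoids the cut
   outside a set of measure o(eps), because two distinct times in a bounded
   window occur near the cut only with probability O(eps^2).  Hence k is
   translation invariant, so constant, and the integral of g^2, being the
   limit of the integrals of f o F^n g, that is the integral of f k, equals the
   square of the integral of f.

   For the rate, observables are tested against segments in the unstable
   direction.  The strong norm measures the Hoelder dependence of the segment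
   integrals on the length of the segment and on its stable displacement, the
   weak norm only their size.  F^j cuts a short segment at most j times, so for
   a large fixed j composition with F^j contracts the strong norm up to the
   weak one (a Lasota-Yorke inequality).  The strong unit ball is precompact
   for the weak norm, so mixing makes the weak norm of f o F^n tend to 0
   uniformly on its mean-zero part, and composition with some power of F halves
   the strong norm there. *)
Require Import Defs.
From HB Require Import structures.
From mathcomp Require Import all_boot all_order all_algebra.
From mathcomp Require Import all_classical all_reals all_analysis.
From mathcomp Require Import measurable_realfun ring lra zify.
Import Order.TTheory GRing.Theory Num.Theory.
Import numFieldNormedType.Exports.

Set Implicit Arguments.
Unset Strict Implicit.
Unset Printing Implicit Defensive.

Local Open Scope classical_set_scope.
Local Open Scope ring_scope.

(** * Lebesgue measure on the circle *)

(** The detour is forced by a count of measure. Oscillation is subadditive along an eigendirection,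
    so a displacement of fixed length consists of about [1 / eps] displacements of length [eps], and
    only an error [o(eps)] for each of them disappears in the limit. A single approach to the cut
    already costs measure of order [eps]: it has to be bypassed, it cannot be discarded. Bypassing
    works because the two eigenvalues are inverse to each other: at every time the stable and
    unstable displacements have first coordinates of the same sign, so both lead across the cut in
    the same direction. Two weak limits are taken because a forward limit is invariant along stable
    vectors only. The backward limit of a forward limit gains unstable invariance and keeps the
    stable one. In the second half no spectrum of an operator appears. Hoelder exponents are lowered
    to at most [1 / 2], so that a stretching factor [L] pays at once for the growth [L ^ g] of a
    segment and for a contraction [L ^ (- g)], which beats the number of cuts, linear in time. *)

Section circle.
Variable R : realType.
Implicit Types (x y : R) (s t : circle R).

Lemma toCircle_rep t : toCircle (rep t) = t.
Proof.
have [x ->] : exists x, t = toCircle x.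
  by exists (repr (t : {ideal_quot integers R})); rewrite /toCircle reprK.
rewrite rep_toCircle; apply/toCircle_eq.
by rewrite addrAC subrr add0r rpredN intr_int.
Qed.

Lemma rep_ge0 t : 0 <= rep t.
Proof. by rewrite /rep subr_ge0 floor_le. Qed.

Lemma rep_lt1 t : rep t < 1.
Proof. by rewrite /rep ltrBlDr addrC -[1]/(1%:~R) -intrD floorD1_gt. Qed.

Lemma rep_toCircle_id x : 0 <= x < 1 -> rep (toCircle x) = x.
Proof.
by move=> x01; rewrite rep_toCircle (@floor_def _ _ 0) ?subr0// add0r.
Qed.

Lemma toCircle0 : toCircle (0 : R) = 0.
Proof. by rewrite /toCircle piE. Qed.

Lemma measurable_toCircle : measurable_fun [set: R] (@toCircle R).
Proof. by move=> _ B. Qed.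

Lemma measurable_rep : measurable_fun [set: circle R] (@rep R).
Proof.
move=> _ B mB; rewrite setTI.
have : measurable_fun [set: R] (fun x : R => x - (Num.floor x)%:~R).
  apply: measurable_funB => //.
  by apply: nondecreasing_measurable => // x y xy; rewrite ler_int le_floor.
move=> /(_ measurableT _ mB); rewrite setTI => h.
rewrite /measurable/= /circle_measurable /image_set_system /= setTI.
rewrite (_ : _ @^-1` _ = (fun x : R => x - (Num.floor x)%:~R) @^-1` B)//.
by apply/seteqP; split => x; rewrite /preimage/= rep_toCircle.
Qed.

Lemma measurable_circleD d (T : measurableType d) (f g : T -> circle R) :
  measurable_fun setT f -> measurable_fun setT g ->
  measurable_fun setT (fun p => f p + g p).
Proof.
move=> mf mg.
have -> : (fun p => f p + g p) = (@toCircle R \o (fun p => rep (f p) + rep (g p))).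
  by apply/funext => p /=; rewrite toCircleD !toCircle_rep.
apply: (measurableT_comp measurable_toCircle).
by apply: measurable_funD; exact: (measurableT_comp measurable_rep).
Qed.

Lemma measurable_circleB d (T : measurableType d) (f g : T -> circle R) :
  measurable_fun setT f -> measurable_fun setT g ->
  measurable_fun setT (fun p => f p - g p).
Proof.
move=> mf mg.
have -> : (fun p => f p - g p) = (@toCircle R \o (fun p => rep (f p) - rep (g p))).
  by apply/funext => p /=; rewrite toCircleB !toCircle_rep.
apply: (measurableT_comp measurable_toCircle).
by apply: measurable_funB; exact: (measurableT_comp measurable_rep).
Qed.

End circle.

Section affine.
Variable R : realType.
Notation mu := (@lebesgue_measure R).

Lemma measurable_affine (m c : R) : measurable_fun [set: R] (fun x : R => m * x + c).
Proof. by apply: measurable_funD => //; exact: measurable_funM. Qed.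

(** The right-hand side is a scaled pushforward measure in [A], so uniqueness of Lebesgue measure
    reduces the identity to half-open intervals; for [m < 0] their preimages are closed at the other
    end. *)
Lemma lebesgue_measure_affine (m c : R) (A : set R) : m != 0 -> measurable A ->
  mu A = (`|m|%:E * mu ((fun x => m * x + c)%R @^-1` A))%E.
Proof.
move=> m0 mA.
have mf : measurable_fun [set: measurableTypeR R]
  ((fun x => m * x + c) : measurableTypeR R -> measurableTypeR R).
  exact: measurable_affine.
pose nu : {measure set (measurableTypeR R) -> \bar R} := mscale
  (NngNum (normr_ge0 m))
  (measure_function_pushforward__canonical__measure_function_Measure mu mf).
transitivity (nu A); last by [].
apply: lebesgue_measure_unique mA => //= _ [[a b]] _ <-.
rewrite /nu /mscale /= /pushforward lebesgue_measure_itv/= lte_fin.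
have [m_gt0|m_lt0|/eqP] := ltgtP 0 m; last by rewrite eq_sym (negbTE m0).
- have -> : (fun x : R => m * x + c) @^-1` `]a, b] = `](a - c) / m, (b - c) / m]%classic.
    apply/seteqP; split => x; rewrite /= !in_itv/= ltr_pdivrMr// ler_pdivlMr//;
      by rewrite ltrBlDr lerBrDr mulrC.
  rewrite lebesgue_measure_itv/= lte_fin ltr_pM2r ?invr_gt0// ltrD2r.
  case: ifPn => ab; last by rewrite mule0.
  by rewrite -!EFinD -EFinM gtr0_norm//; congr EFin; field.
- have -> : (fun x : R => m * x + c) @^-1` `]a, b] = `[(b - c) / m, (a - c) / m[%classic.
    apply/seteqP; split => x; rewrite /= !in_itv/= ltr_ndivlMr// ler_ndivrMr//;
      by rewrite ltrBlDr lerBrDr mulrC andbC.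
  rewrite lebesgue_measure_itv/= lte_fin ltr_nM2r ?invr_lt0// ltrD2r.
  case: ifPn => ab; last by rewrite mule0.
  by rewrite -!EFinD -EFinM ltr0_norm//; congr EFin; field.
Qed.

End affine.

Section leb_circle.
Variable R : realType.
Notation mu := (@lebesgue_measure R).

Lemma leb_circleE (B : set (circle R)) :
  leb_circle B = mu (@toCircle R @^-1` B `&` `[0, 1[).
Proof. by []. Qed.

Lemma measurable_preimage_toCircle (B : set (circle R)) : measurable B ->
  measurable (@toCircle R @^-1` B).
Proof. by move=> mB; rewrite -[X in measurable X]setTI; exact: measurable_toCircle. Qed.

Lemma lebesgue_measure_translate (c : R) (A : set R) : measurable A ->
  mu ((fun x => x + c) @^-1` A) = mu A.
Proof.
move=> mA; rewrite [RHS](lebesgue_measure_affine c (oner_neq0 _))// normr1 mul1e.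
by congr (mu _); apply/seteqP; split => x /=; rewrite mul1r.
Qed.

Lemma toCircleD1 (x : R) : toCircle (x + 1) = toCircle x.
Proof. by apply/toCircle_eq; rewrite addrAC subrr add0r rpred1. Qed.

(** For the representative [s] of [c] the translation moves the window [[0, 1[] to [[s, 1 + s[]; the
    part beyond 1 returns to [[0, s[] by periodicity. *)
Lemma leb_circle_translate (c : circle R) (B : set (circle R)) : measurable B ->
  leb_circle ((fun t => t + c) @^-1` B) = leb_circle B.
Proof.
move=> mB; rewrite -[c]toCircle_rep; move: (rep c) (rep_ge0 c) (rep_lt1 c) => s s0 s1.
rewrite !leb_circleE.
have mP := measurable_preimage_toCircle mB.
set P := _ @^-1` B in mP *.
have -> : @toCircle R @^-1` ((fun t => t + toCircle s) @^-1` B) =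
    (fun x => x + s) @^-1` P.
  by apply/seteqP; split => x; rewrite /P /preimage/= toCircleD.
have -> : (fun x => x + s) @^-1` P `&` `[0, 1[ =
    (fun x => x + s) @^-1` (P `&` `[s, 1 + s[).
  apply/seteqP; split => x [Px]; rewrite /= !in_itv/= => h; split => //=.
    by rewrite lerDr ltrD2r.
  by move: h; rewrite lerDr ltrD2r.
rewrite lebesgue_measure_translate; last exact: measurableI.
have -> : P `&` `[s, 1 + s[ = (P `&` `[s, 1[) `|` (P `&` `[1, 1 + s[).
  rewrite -setIUr; congr setI.
  apply/seteqP; split => x; rewrite /= !in_itv/=.
    by case: (ltP x 1) => x1 /andP[sx xs]; [left|right]; rewrite ?sx ?xs ?x1//=.
  move=> [/andP[sx x1]|/andP[x1 xs]].
    by rewrite sx/= (lt_le_trans x1)// lerDl.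
  by rewrite xs (le_trans (ltW s1)).
have -> : P `&` `[0, 1[ = (P `&` `[s, 1[) `|` (P `&` `[0, s[).
  rewrite -setIUr; congr setI.
  apply/seteqP; split => x; rewrite /= !in_itv/=.
    by case: (ltP x s) => xs /andP[x0 x1]; [right|left]; rewrite ?x0 ?x1 ?xs.
  move=> [/andP[sx x1]|/andP[x0 xs]].
    by rewrite x1 (le_trans s0).
  by rewrite x0 (lt_trans xs).
rewrite !measureU//; try exact: measurableI.
- congr (_ + _)%E.
  transitivity (mu ((fun x => x + 1) @^-1` (P `&` `[1, 1 + s[))).
    by rewrite lebesgue_measure_translate//; exact: measurableI.
  congr (mu _); apply/seteqP; split => x; rewrite /= /P /= !in_itv/= toCircleD1.
    by move=> [Bx]; rewrite lerDr addrC ltrD2l.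
  by move=> [Bx]; rewrite lerDr addrC ltrD2l.
- apply/seteqP; split => // x /= [[_]] /[swap] -[_]; rewrite !in_itv/=.
  by move=> /andP[_ xs] /andP[sx _]; move: (lt_le_trans xs sx); rewrite ltxx.
- apply/seteqP; split => // x /= [[_]] /[swap] -[_]; rewrite !in_itv/=.
  by move=> /andP[x1 _] /andP[_]; rewrite ltNge x1.
Qed.

End leb_circle.

(** * Bounded measurable functions *)

Section bounded_measurable.
Context d (T : measurableType d) (R : realType).
Implicit Types (f g : T -> R).

(** Boundedness gives integrability on every set of finite measure and survives products,
    compositions and partial integrals, so this one predicate carries the side conditions of the
    integrals below. *)
Definition bmf f := measurable_fun setT f /\ exists M : R, forall x, `|f x| <= M.

Lemma bmf_cst (c : R) : bmf (fun=> c).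
Proof. by split; [exact: measurable_cst|exists `|c|]. Qed.

Lemma bmf_bound f : bmf f -> exists2 M : R, 0 < M & forall x, `|f x| <= M.
Proof.
move=> [_ [M fM]]; exists (`|M| + 1) => [|x]; first by rewrite ltr_wpDl.
by rewrite (le_trans (fM x))// ler_wpDr// ler_norm.
Qed.

Lemma bmfD f g : bmf f -> bmf g -> bmf (fun x => f x + g x).
Proof.
move=> [mf [M fM]] [mg [N gN]]; split; first exact: measurable_funD.
by exists (M + N) => x; rewrite (le_trans (ler_normD _ _))// lerD.
Qed.

Lemma bmfN f : bmf f -> bmf (fun x => - f x).
Proof.
move=> [mf [M fM]]; split; last by exists M => x; rewrite normrN.
exact: measurable_funN.
Qed.

Lemma bmfB f g : bmf f -> bmf g -> bmf (fun x => f x - g x).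
Proof. by move=> bf /bmfN; exact: bmfD. Qed.

Lemma bmfM f g : bmf f -> bmf g -> bmf (fun x => f x * g x).
Proof.
move=> [mf [M fM]] [mg [N gN]]; split; first exact: measurable_funM.
by exists (M * N) => x; rewrite normrM ler_pM.
Qed.

Lemma bmfZ c f : bmf f -> bmf (fun x => c * f x).
Proof. by move=> bf; apply: bmfM => //; exact: bmf_cst. Qed.

Lemma bmf_norm f : bmf f -> bmf (fun x => `|f x|).
Proof.
move=> [mf [M fM]]; split; last by exists M => x; rewrite normr_id.
exact: (measurableT_comp (@normr_measurable _ setT) mf).
Qed.

Lemma bmf_indic (A : set T) : measurable A -> bmf (\1_A : T -> R).
Proof.
move=> mA; split; first exact: measurable_indic.
by exists 1 => x; rewrite indicE; case: (x \in A); rewrite ?normr1 ?normr0.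
Qed.

Lemma bmf_sum (I : Type) (r : seq I) (F : I -> T -> R) :
  (forall i, bmf (F i)) -> bmf (fun x => \sum_(i <- r) F i x).
Proof.
move=> bF; elim: r => [|i r IH].
  by under [fun x => _]eq_fun do rewrite big_nil; exact: bmf_cst.
by under [fun x => _]eq_fun do rewrite big_cons; exact: bmfD.
Qed.

Section integral.
Variables (mu : {measure set T -> \bar R}) (D : set T).
Hypotheses (mD : measurable D) (Dfin : (mu D < +oo)%E).

Lemma bmf_integrable f : bmf f -> mu.-integrable D (EFin \o f).
Proof.
move=> [mf [M fM]]; apply: measurable_bounded_integrable => //.
  exact: measurable_funTS.
by exists M; split; [exact: num_real|move=> x Mx y _]; exact: le_trans (fM y) (ltW Mx).
Qed.

Lemma bRintegralD f g : bmf f -> bmf g ->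
  \int[mu]_(x in D) (f x + g x) = \int[mu]_(x in D) f x + \int[mu]_(x in D) g x.
Proof. by move=> bf bg; rewrite RintegralD//; exact: bmf_integrable. Qed.

Lemma bRintegralB f g : bmf f -> bmf g ->
  \int[mu]_(x in D) (f x - g x) = \int[mu]_(x in D) f x - \int[mu]_(x in D) g x.
Proof. by move=> bf bg; rewrite RintegralB//; exact: bmf_integrable. Qed.

Lemma bRintegralZ c f : bmf f ->
  \int[mu]_(x in D) (c * f x) = c * \int[mu]_(x in D) f x.
Proof. by move=> bf; rewrite RintegralZl//; exact: bmf_integrable. Qed.

Lemma bRintegral_sum (I : Type) (r : seq I) (F : I -> T -> R) :
  (forall i, bmf (F i)) -> \int[mu]_(x in D) (\sum_(i <- r) F i x) =
  \sum_(i <- r) \int[mu]_(x in D) F i x.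
Proof.
move=> bF; elim: r => [|i r IH].
  rewrite big_nil; under eq_Rintegral do rewrite big_nil.
  by rewrite Rintegral_cst// mul0r.
rewrite big_cons; under eq_Rintegral do rewrite big_cons.
by rewrite bRintegralD ?IH//; exact: bmf_sum.
Qed.

Lemma le_bRintegral f g : bmf f -> bmf g -> (forall x, D x -> f x <= g x) ->
  \int[mu]_(x in D) f x <= \int[mu]_(x in D) g x.
Proof. by move=> bf bg fg; apply: le_Rintegral => //; exact: bmf_integrable. Qed.

Lemma le_norm_bRintegral f (c : R) : bmf f -> (forall x, D x -> `|f x| <= c) ->
  `|\int[mu]_(x in D) f x| <= c * fine (mu D).
Proof.
move=> bf fc; apply: le_trans (le_normr_Rintegral mD (bmf_integrable bf)) _.
rewrite -Rintegral_cst//; apply: le_bRintegral => //; last exact: bmf_cst.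
exact: bmf_norm.
Qed.

Lemma le_normr_bRintegral f : bmf f ->
  `|\int[mu]_(x in D) f x| <= \int[mu]_(x in D) `|f x|.
Proof. by move=> bf; apply: le_normr_Rintegral => //; exact: bmf_integrable. Qed.

End integral.

Lemma Rintegral_indic (mu : {measure set T -> \bar R}) (A : set T) :
  measurable A -> \int[mu]_x (\1_A x : R) = fine (mu A).
Proof. by move=> mA; rewrite /Rintegral integral_indic// setIT. Qed.

End bounded_measurable.

Lemma bmf_comp d d' (T : measurableType d) (T' : measurableType d') (R : realType)
    (f : T' -> R) (g : T -> T') :
  bmf f -> measurable_fun setT g -> bmf (fun x => f (g x)).
Proof.
move=> [mf [M fM]] mg; split; last by exists M.
exact: (measurableT_comp mf mg).
Qed.

Section measure_preserving.
Context d (T : measurableType d) (R : realType) (P : probability T R).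

Lemma probability_setT_lty : (P setT < +oo)%E.
Proof. by rewrite (_ : P setT = 1%E) ?ltry//; exact: probability_setT. Qed.

Lemma measure_preserving_comp (f g : T -> T) :
  measure_preserving P f -> measure_preserving P g ->
  measure_preserving P (f \o g).
Proof.
move=> [mf Pf] [mg Pg]; split; first exact: measurableT_comp.
move=> B mB; rewrite comp_preimage Pg ?Pf//.
by rewrite -[X in measurable X]setTI; exact: mf.
Qed.

Lemma measure_preserving_iter (f : T -> T) n :
  measure_preserving P f -> measure_preserving P (iter n f).
Proof.
move=> Pf; elim: n => [|n IH].
  by split; [exact: measurable_id|move=> B].
exact: (measure_preserving_comp Pf IH).
Qed.

Lemma Rintegral_measure_preserving (S : T -> T) (f : T -> R) :
  measure_preserving P S -> bmf f -> \int[P]_x f (S x) = \int[P]_x f x.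
Proof.
move=> [mS PS] bf; rewrite /Rintegral; congr fine.
transitivity (\int[pushforward P S]_y (f y)%:E)%E.
  rewrite (integral_pushforward mS)//.
  - by apply/measurable_EFinP; case: bf.
  - rewrite preimage_setT.
    apply: (@bmf_integrable _ _ _ P setT _ _ (f \o S)) => //.
      exact: probability_setT_lty.
    exact: bmf_comp.
by apply: eq_measure_integral => A mA _; rewrite -[RHS]PS.
Qed.

End measure_preserving.

(** * Partial integrals and Fubini's theorem *)

Section section_integral.
Context d1 d2 (T1 : measurableType d1) (T2 : measurableType d2) (R : realType).
Variables (m2 : {sigma_finite_measure set T2 -> \bar R}) (D : set T2).
Hypotheses (mD : measurable D) (Dfin : (m2 D < +oo)%E).
Implicit Type f : T1 * T2 -> R.

Definition cutoff f := fun z => (f z * \1_D z.2)%:E.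

Lemma bmf_pair1 f x : bmf f -> bmf (fun y => f (x, y)).
Proof. by move=> bf; apply: (bmf_comp bf); exact: pair1_measurable. Qed.

Lemma bmf_pair2 f y : bmf f -> bmf (fun x => f (x, y)).
Proof. by move=> bf; apply: (bmf_comp bf); exact: pair2_measurable. Qed.

(** Adding a constant makes a bounded function nonnegative, so that Tonelli's theorem applies; the
    constant then cancels from both iterated integrals. *)
Lemma bmf_shift f : bmf f ->
  exists M, (forall z, 0 <= f z + M) /\ bmf (fun z => f z + M).
Proof.
move=> bf; case: (bf) => _ [M fM]; exists M; split.
  by move=> z; have := fM z; rewrite ler_norml => /andP[h _]; rewrite -lerBlDr sub0r.
by apply: bmfD => //; exact: bmf_cst.
Qed.

Lemma measurable_cutoff f : bmf f -> measurable_fun setT (cutoff f).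
Proof.
move=> bf; apply/measurable_EFinP.
suff : bmf (fun z : T1 * T2 => f z * \1_D z.2) by case.
apply: bmfM => //; apply: (bmf_comp (f := \1_D)); last exact: measurable_snd.
exact: bmf_indic.
Qed.

Lemma integral_cutoff f x :
  (\int[m2]_y cutoff f (x, y) = \int[m2]_(y in D) (f (x, y))%:E)%E.
Proof.
rewrite [RHS]integral_mkcond; apply: eq_integral => y _.
rewrite /cutoff patchE indicE /=; case: ifP => _; first by rewrite mulr1.
by rewrite mulr0.
Qed.

Lemma EFin_section_integral f x : bmf f ->
  ((\int[m2]_(y in D) f (x, y))%R%:E = \int[m2]_(y in D) (f (x, y))%:E)%E.
Proof.
move=> bf; rewrite /Rintegral fineK//; apply: integrable_fin_num => //.
by apply: bmf_integrable => //; exact: bmf_pair1.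
Qed.

Lemma cutoff_ge0 f : (forall z, 0 <= f z) -> forall z, (0 <= cutoff f z)%E.
Proof. by move=> f0 z; rewrite lee_fin mulr_ge0. Qed.

Let bmf_section_integral_ge0 f : bmf f -> (forall z, 0 <= f z) ->
  bmf (fun x => \int[m2]_(y in D) f (x, y)).
Proof.
move=> bf f0; split.
  apply/measurable_EFinP => /=.
  rewrite (_ : _ \o _ = fubini_F m2 (cutoff f)).
    apply: measurable_fun_fubini_tonelli_F; last exact: cutoff_ge0.
    exact: measurable_cutoff.
  by apply/funext => x /=; rewrite EFin_section_integral// /fubini_F integral_cutoff.
case: (bf) => _ [M fM]; exists (M * fine (m2 D)) => x.
by apply: le_norm_bRintegral => //; exact: bmf_pair1.
Qed.

Lemma bmf_section_integral f : bmf f -> bmf (fun x => \int[m2]_(y in D) f (x, y)).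
Proof.
move=> bf; have [M [fM0 bfM]] := bmf_shift bf.
have b := bmf_section_integral_ge0 bfM fM0.
rewrite (_ : (fun x => _) = fun x =>
  \int[m2]_(y in D) (f (x, y) + M) - M * fine (m2 D)).
  by apply: bmfB => //; exact: bmf_cst.
apply/funext => x; rewrite bRintegralD//; [|exact: bmf_pair1|exact: bmf_cst].
by rewrite Rintegral_cst// addrK.
Qed.

End section_integral.

Section fubini.
Context d1 d2 (T1 : measurableType d1) (T2 : measurableType d2) (R : realType).
Variables (m1 : {sigma_finite_measure set T1 -> \bar R}).
Variables (m2 : {sigma_finite_measure set T2 -> \bar R}) (D : set T2).
Hypotheses (m1fin : (m1 setT < +oo)%E) (mD : measurable D) (Dfin : (m2 D < +oo)%E).
Implicit Type f : T1 * T2 -> R.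

Lemma bmf_section_integral1 f : bmf f -> bmf (fun y => \int[m1]_x f (x, y)).
Proof.
move=> bf; apply: (@bmf_section_integral _ _ _ _ _ _ setT measurableT m1fin
  (f \o (fun z => (z.2, z.1)))).
apply: (bmf_comp bf); apply: measurable_fun_pair; last exact: measurable_fst.
exact: measurable_snd.
Qed.

Let fubini_ge0 f : bmf f -> (forall z, 0 <= f z) ->
  \int[m1]_x \int[m2]_(y in D) f (x, y) =
  \int[m2]_(y in D) \int[m1]_x f (x, y).
Proof.
move=> bf f0; rewrite [LHS]/Rintegral [RHS]/Rintegral; congr fine.
under eq_integral do rewrite (EFin_section_integral mD Dfin)// -(integral_cutoff m2 D f).
rewrite (fubini_tonelli (m1 := m1) (m2 := m2)); last exact: cutoff_ge0.
  rewrite [RHS]integral_mkcond.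
  apply: eq_integral => y _; rewrite patchE; case: ifP => yD; last first.
    by apply: integral0_eq => x _; rewrite /cutoff indicE yD mulr0.
  under eq_integral do rewrite /cutoff indicE yD mulr1.
  rewrite /Rintegral fineK//; apply: integrable_fin_num => //.
  by apply: bmf_integrable => //; exact: bmf_pair2.
exact: measurable_cutoff.
Qed.

Lemma bmf_Fubini f : bmf f -> \int[m1]_x \int[m2]_(y in D) f (x, y) =
  \int[m2]_(y in D) \int[m1]_x f (x, y).
Proof.
move=> bf; have [M [fM0 bfM]] := bmf_shift bf.
have e := fubini_ge0 bfM fM0.
have L : \int[m1]_x \int[m2]_(y in D) (f (x, y) + M) =
    \int[m1]_x \int[m2]_(y in D) f (x, y) + M * fine (m2 D) * fine (m1 setT).
  under eq_Rintegral.
    move=> x _; rewrite bRintegralD//; [|exact: bmf_pair1|exact: bmf_cst].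
    by rewrite Rintegral_cst//; over.
  rewrite bRintegralD//; [|exact: bmf_section_integral|exact: bmf_cst].
  by rewrite Rintegral_cst.
have Rr : \int[m2]_(y in D) \int[m1]_x (f (x, y) + M) =
    \int[m2]_(y in D) \int[m1]_x f (x, y) + M * fine (m1 setT) * fine (m2 D).
  under eq_Rintegral.
    move=> y _; rewrite bRintegralD//; [|exact: bmf_pair2|exact: bmf_cst].
    by rewrite Rintegral_cst//; over.
  rewrite bRintegralD//; [|exact: bmf_section_integral1|exact: bmf_cst].
  by rewrite Rintegral_cst.
by move: e; rewrite L Rr mulrAC => /addIr.
Qed.

End fubini.

Section probability_integral.
Context d (T : measurableType d) (R : realType) (P : probability T R).
Implicit Types (f g : T -> R).
Let fin := probability_setT_lty P.

Lemma PintegralD f g : bmf f -> bmf g ->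
  \int[P]_x (f x + g x) = \int[P]_x f x + \int[P]_x g x.
Proof. exact: bRintegralD. Qed.

Lemma PintegralB f g : bmf f -> bmf g ->
  \int[P]_x (f x - g x) = \int[P]_x f x - \int[P]_x g x.
Proof. exact: bRintegralB. Qed.

Lemma PintegralZ c f : bmf f -> \int[P]_x (c * f x) = c * \int[P]_x f x.
Proof. exact: bRintegralZ. Qed.

Lemma Pintegral_cst c : \int[P]_x c = c.
Proof.
rewrite Rintegral_cst// -[RHS]mulr1; congr (_ * _).
exact: (congr1 fine (probability_setT P)).
Qed.

Lemma le_Pintegral f g : bmf f -> bmf g -> (forall x, f x <= g x) ->
  \int[P]_x f x <= \int[P]_x g x.
Proof. by move=> bf bg fg; apply: le_bRintegral. Qed.

Lemma le_norm_Pintegral f : bmf f -> `|\int[P]_x f x| <= \int[P]_x `|f x|.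
Proof. exact: le_normr_bRintegral. Qed.

Lemma norm_Pintegral_le f c : bmf f -> (forall x, `|f x| <= c) ->
  `|\int[P]_x f x| <= c.
Proof.
move=> bf fc; apply: le_trans (le_norm_Pintegral bf) _.
rewrite -[leRHS]Pintegral_cst; apply: le_Pintegral => //; first exact: bmf_norm.
exact: bmf_cst.
Qed.

Lemma fine_le_measure (A B : set T) : measurable A -> measurable B -> A `<=` B ->
  fine (P A) <= fine (P B).
Proof.
move=> mA mB AB; apply: fine_le; rewrite ?fin_num_measure//.
by apply: le_measure; rewrite ?inE.
Qed.

Lemma fine_measureU_le (A B : set T) : measurable A -> measurable B ->
  fine (P (A `|` B)) <= fine (P A) + fine (P B).
Proof.
move=> mA mB; rewrite -fineD ?fin_num_measure//; apply: fine_le.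
- by rewrite fin_num_measure//; exact: measurableU.
- by rewrite fin_numD !fin_num_measure.
- exact: measureU2.
Qed.

End probability_integral.

(** * The torus and its translations *)

Section torus.
Variable R : realType.
Notation T := (torus R).
Notation P := (leb_torus R).
Implicit Types (p : T) (v w : R * R).

Lemma leb_torusE1 (B : set T) : P B = (\int[@leb_circle R]_x @leb_circle R (xsection B x))%E.
Proof. by []. Qed.

Lemma leb_torusE2 (B : set T) : measurable B ->
  P B = (\int[@leb_circle R]_y @leb_circle R (ysection B y))%E.
Proof.
move=> mB; transitivity ((@leb_circle R \x^ @leb_circle R)%E B); last by [].
by apply: product_measure_unique => // A C mA mC; exact: product_measure2E.
Qed.

(** On each circle of constant second coordinate the shear is a rotation, so the sections of a set
    and of its preimage have equal measure. *)
Lemma measure_preserving_shear1 (a : circle R -> circle R) : measurable_fun setT a ->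
  measure_preserving P (fun p => (p.1 + a p.2, p.2) : T).
Proof.
move=> ma.
have mS : measurable_fun setT (fun p : T => (p.1 + a p.2, p.2) : T).
  apply: measurable_fun_pair; last exact: measurable_snd.
  apply: measurable_circleD; first exact: measurable_fst.
  exact: (measurableT_comp ma measurable_snd).
split; first exact: mS.
move=> B mB.
have mSB : measurable ((fun p => (p.1 + a p.2, p.2) : T) @^-1` B).
  by rewrite -[X in measurable X]setTI; exact: mS.
rewrite (leb_torusE2 mSB) (leb_torusE2 mB).
apply: eq_integral => y _.
transitivity (leb_circle ((fun t => t + a y) @^-1` ysection B y)); last first.
  by apply: leb_circle_translate; exact: measurable_ysection.
congr leb_circle; apply/seteqP; split => x;
  rewrite /preimage/= /ysection/= !inE.
Qed.

Lemma measure_preserving_shear2 (a : circle R -> circle R) : measurable_fun setT a ->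
  measure_preserving P (fun p => (p.1, p.2 + a p.1) : T).
Proof.
move=> ma.
have mS : measurable_fun setT (fun p : T => (p.1, p.2 + a p.1) : T).
  apply: measurable_fun_pair; first exact: measurable_fst.
  apply: measurable_circleD; first exact: measurable_snd.
  exact: (measurableT_comp ma measurable_fst).
split; first exact: mS.
move=> B mB; rewrite !leb_torusE1.
apply: eq_integral => x _.
transitivity (leb_circle ((fun t => t + a x) @^-1` xsection B x)); last first.
  by apply: leb_circle_translate; exact: measurable_xsection.
congr leb_circle; apply/seteqP; split => y;
  rewrite /preimage/= /xsection/= !inE.
Qed.

Definition translate v p : T := (p.1 + toCircle v.1, p.2 + toCircle v.2).

Lemma measurable_translate2 : measurable_fun setT
  (fun z : T * (R * R) => translate z.2 z.1).
Proof.
apply: measurable_fun_pair; apply: measurable_circleD.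
- exact: (measurableT_comp measurable_fst measurable_fst).
- apply: (measurableT_comp (@measurable_toCircle R)).
  exact: (measurableT_comp measurable_fst measurable_snd).
- exact: (measurableT_comp measurable_snd measurable_fst).
- apply: (measurableT_comp (@measurable_toCircle R)).
  exact: (measurableT_comp measurable_snd measurable_snd).
Qed.

Lemma translateD v w p : translate v (translate w p) = translate (v + w) p.
Proof.
by rewrite /translate/= !toCircleD; congr pair; rewrite -addrA; congr (_ + _); rewrite addrC.
Qed.

Lemma translate0 p : translate 0 p = p.
Proof. by case: p => a b; rewrite /translate/= toCircle0 !addr0. Qed.

Lemma translateK v : cancel (translate v) (translate (- v)).
Proof. by move=> p; rewrite translateD addNr translate0. Qed.

Lemma translateC v w p : translate v (translate w p) = translate w (translate v p).
Proof. by rewrite !translateD addrC. Qed.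

Lemma measure_preserving_translate v : measure_preserving P (translate v).
Proof.
have := measure_preserving_comp
  (measure_preserving_shear1 (measurable_cst (toCircle v.1)))
  (measure_preserving_shear2 (measurable_cst (toCircle v.2))).
by [].
Qed.

Lemma measurable_translate v : measurable_fun setT (translate v).
Proof. by have [] := measure_preserving_translate v. Qed.

End torus.

(** * The sawtooth map as a composition of two shears *)

Section sawtooth.
Variables (R : realType) (Delta : R).
Notation T := (torus R).
Notation P := (leb_torus R).
Implicit Types (p : T) (v w : R * R).
Notation F := (Ftilde Delta).

Definition kick (t : circle R) : circle R := toCircle (Delta * (rep t - 2^-1)).

Lemma measurable_kick : measurable_fun setT kick.
Proof.
apply: (measurableT_comp (@measurable_toCircle R)).
apply: measurable_funM => //; apply: measurable_funB => //.
exact: measurable_rep.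
Qed.

Definition Finv p : T := (p.1 + (p.2 - kick p.1), p.2 - kick p.1).

Lemma FtildeK : cancel F Finv.
Proof. by move=> [a b]; rewrite /Finv/= /Ftilde/= addrK subrK. Qed.

Lemma FinvK : cancel Finv F.
Proof. by move=> [a b]; rewrite /Finv/= /Ftilde/= addrK subrK. Qed.

Lemma measurable_oppc : measurable_fun setT (fun t : circle R => - t).
Proof.
rewrite (_ : (fun t => _) = (fun t : circle R => 0 - t)).
  by apply: measurable_circleB => //; exact: measurable_cst.
by apply/funext => t; rewrite sub0r.
Qed.

Lemma measure_preserving_F : measure_preserving P F.
Proof.
have := measure_preserving_comp (measure_preserving_shear2 measurable_kick)
  (measure_preserving_shear1 measurable_oppc).
by [].
Qed.

Lemma measure_preserving_Finv : measure_preserving P Finv.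
Proof.
have mk : measurable_fun setT (fun t => - kick t).
  exact: (measurableT_comp measurable_oppc measurable_kick).
have := measure_preserving_comp (measure_preserving_shear1 (@measurable_id _ _ setT))
  (measure_preserving_shear2 mk).
by [].
Qed.

End sawtooth.

(** * Continuity of translations in the mean *)

Section strips.
Variable R : realType.
Notation T := (torus R).
Notation P := (leb_torus R).
Notation mu := (@lebesgue_measure R).

Lemma leb_circle_rep (B : set R) : leb_circle (@rep R @^-1` B) = mu (B `&` `[0%R, 1%R[).
Proof.
rewrite leb_circleE; congr (mu _); apply/seteqP; split => x /= [] + x01;
  by rewrite (rep_toCircle_id x01).
Qed.

Lemma measurable_preimage_rep (B : set R) : measurable B ->
  measurable (@rep R @^-1` B).
Proof. by move=> mB; rewrite -[X in measurable X]setTI; exact: measurable_rep. Qed.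

Lemma leb_torus_rect (B C : set R) : measurable B -> measurable C ->
  P ((@rep R @^-1` B) `*` (@rep R @^-1` C)) =
  (mu (B `&` `[0%R, 1%R[) * mu (C `&` `[0%R, 1%R[))%E.
Proof.
move=> mB mC; rewrite -!leb_circle_rep; apply: product_measure1E;
  exact: measurable_preimage_rep.
Qed.

Lemma mu01 : mu (setT `&` `[0%R, 1%R[) = 1%E.
Proof. by rewrite setTI lebesgue_measure_itv/= lte_fin ltr01 oppr0 adde0. Qed.

Lemma leb_torus_strip1 (B : set R) : measurable B ->
  P ((fun p => rep p.1) @^-1` B) = mu (B `&` `[0%R, 1%R[).
Proof.
move=> mB; rewrite -[RHS]mule1 -mu01 -leb_torus_rect//; congr (P _).
by apply/seteqP; split => // x [].
Qed.

Lemma leb_torus_strip2 (B : set R) : measurable B ->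
  P ((fun p => rep p.2) @^-1` B) = mu (B `&` `[0%R, 1%R[).
Proof.
move=> mB; rewrite -[RHS]mul1e -mu01 -leb_torus_rect//; congr (P _).
by apply/seteqP; split => // x [].
Qed.

End strips.

Section translation_continuity.
Variable R : realType.
Notation T := (torus R).
Notation P := (leb_torus R).
Notation mu := (@lebesgue_measure R).
Implicit Types (f g : T -> R) (v : R * R).

(** The [L^1] distance from [f] to its translate: it measures invariance of functions that are
    merely measurable, and it is subadditive in [v]. *)
Definition osc f v := \int[P]_x `|f (translate v x) - f x|.

Definition translation_continuous f := forall e : R, 0 < e ->
  exists2 d : R, 0 < d & forall v, `|v.1| <= d -> `|v.2| <= d -> osc f v <= e.

Lemma bmf_translate f v : bmf f -> bmf (fun x => f (translate v x)).
Proof. by move=> bf; apply: (bmf_comp bf); exact: measurable_translate. Qed.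

Lemma bmf_osc f v : bmf f -> bmf (fun x => `|f (translate v x) - f x|).
Proof. by move=> bf; apply/bmf_norm/bmfB => //; exact: bmf_translate. Qed.

Lemma Pintegral_translate f v : bmf f ->
  \int[P]_x f (translate v x) = \int[P]_x f x.
Proof.
by move=> bf; apply: Rintegral_measure_preserving => //; exact: measure_preserving_translate.
Qed.

Lemma osc_ge0 f v : 0 <= osc f v.
Proof. exact: Rintegral_ge0. Qed.

Lemma translation_continuous_cst c : translation_continuous (fun=> c).
Proof.
move=> e e0; exists 1 => // v _ _; rewrite /osc.
by under eq_Rintegral do rewrite subrr normr0; rewrite Pintegral_cst ltW.
Qed.

Lemma translation_continuousM f g : bmf f -> bmf g ->
  translation_continuous f -> translation_continuous g ->
  translation_continuous (fun x => f x * g x).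
Proof.
move=> bf bg cf cg e e0.
have [M M0 fM] := bmf_bound bf.
have [N N0 gN] := bmf_bound bg.
have [|d d0 fd] := cf (e / (2 * N)); first by rewrite divr_gt0// mulr_gt0.
have [|d' d'0 gd] := cg (e / (2 * M)); first by rewrite divr_gt0// mulr_gt0.
exists (Num.min d d') => [|v]; first by rewrite lt_min d0.
rewrite !le_min => /andP[v1 v1'] /andP[v2 v2'].
apply: (@le_trans _ _ (N * osc f v + M * osc g v)).
  rewrite /osc -!PintegralZ; [|exact: bmf_osc..].
  rewrite -PintegralD; [|exact/bmfZ/bmf_osc..].
  apply: le_Pintegral.
  - by apply: (@bmf_osc (fun x => f x * g x)); exact: bmfM.
  - by apply: bmfD; apply/bmfZ/bmf_osc.
  - move=> x; set y := translate v x.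
    have -> : f y * g y - f x * g x = (f y - f x) * g y + f x * (g y - g x) by ring.
    apply: le_trans (ler_normD _ _) _; rewrite !normrM; apply: lerD.
      by rewrite mulrC ler_wpM2r.
    by rewrite ler_wpM2r.
have := fd v v1 v2; have := gd v v1' v2'.
rewrite ler_pdivlMr ?mulr_gt0// ler_pdivlMr ?mulr_gt0// => h1 h2.
by lra.
Qed.

Lemma translation_continuousN f : bmf f ->
  translation_continuous f -> translation_continuous (fun x => 1 - f x).
Proof.
move=> bf cf e e0; have [d d0 fd] := cf e e0; exists d => // v v1 v2.
rewrite (_ : osc _ v = osc f v) ?fd//.
by apply: eq_Rintegral => x _; rewrite -normrN; congr Num.norm; ring.
Qed.

Lemma translation_continuous_lim f : bmf f ->
  (forall e : R, 0 < e -> exists g, [/\ bmf g, translation_continuous g &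
     \int[P]_x `|f x - g x| <= e]) -> translation_continuous f.
Proof.
move=> bf h e e0.
have [|g [bg cg fg]] := h (e / 4); first by rewrite divr_gt0.
have [|d d0 gd] := cg (e / 4); first by rewrite divr_gt0.
exists d => // v v1 v2.
have bfg : bmf (fun x => `|f x - g x|) by apply/bmf_norm/bmfB.
apply: (@le_trans _ _ (\int[P]_x `|f (translate v x) - g (translate v x)| +
    (osc g v + \int[P]_x `|f x - g x|))).
  rewrite -!PintegralD//; last 3 first.
  - exact: (bmf_translate v bfg).
  - by apply: bmfD => //; exact: bmf_osc.
  - exact: bmf_osc.
  apply: le_Pintegral; first exact: bmf_osc.
    apply: bmfD; first exact: (bmf_translate v bfg).
    by apply: bmfD => //; exact: bmf_osc.
  move=> x; set y := translate v x.
  have -> : f y - f x = (f y - g y) + ((g y - g x) - (f x - g x)) by ring.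
  rewrite (le_trans (ler_normD _ _))// lerD2l.
  by rewrite (le_trans (ler_normB _ _)).
rewrite (Pintegral_translate v bfg).
have := gd v v1 v2; lra.
Qed.

(** The sets whose preimage has a translation-continuous indicator form a lambda-system: proper
    differences come from [1_A * (1 - 1_C)], increasing unions from [L^1] limits. A generating
    pi-system therefore suffices. *)
Lemma translation_continuous_generated (X : Type) (G : set (set X)) (q : T -> X) :
  setI_closed G ->
  (forall B, <<s G >> B -> measurable (q @^-1` B)) ->
  (forall B, G B -> translation_continuous \1_(q @^-1` B)) ->
  forall B, <<s G >> B -> translation_continuous \1_(q @^-1` B).
Proof.
move=> GI mG cG B sB.
suff : ([set B | measurable (q @^-1` B) /\ translation_continuous \1_(q @^-1` B)])%classic B.
  by case.
apply: (lambda_system_subset GI (D := setT)) sB => //; last first.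
  move=> A GA; split; [apply: mG; exact: sub_sigma_algebra|exact: cG].
split => //.
- split; rewrite preimage_setT ?indicT//; exact: translation_continuous_cst.
- move=> A C CA [mA cA] [mC cC]; split.
    exact: (measurableD mA mC).
  rewrite (_ : \1_ _ = fun x => (\1_(q @^-1` A) x : R) * (1 - \1_(q @^-1` C) x)).
    apply: translation_continuousM => //; first exact: bmf_indic.
      by apply: bmfB; [exact: bmf_cst|exact: bmf_indic].
    by apply: translation_continuousN => //; exact: bmf_indic.
  apply/funext => x; rewrite !indicE (_ : q @^-1` (A `\` C) = q @^-1` A `\` q @^-1` C)// in_setD.
  by case: (x \in _) => /=; case: (x \in _); rewrite /= ?mul1r ?mul0r ?subrr ?subr0.
- move=> A ndA hA.
  have mA i : measurable (q @^-1` A i) by case: (hA i).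
  have mU : measurable (q @^-1` \bigcup_i A i).
    by rewrite preimage_bigcup; exact: bigcupT_measurable.
  split => //; apply: translation_continuous_lim; first exact: bmf_indic.
  move=> e e0.
  have cvA : fine (P (q @^-1` A n)) @[n --> \oo] --> fine (P (q @^-1` \bigcup_i A i)).
    apply: fine_cvg; rewrite fineK ?fin_num_measure// preimage_bigcup.
    apply: nondecreasing_cvg_mu => //.
    by move=> m n mn; apply/subsetPset => x /=; apply/subsetPset/ndA.
  move/cvgrPdist_le : cvA => /(_ _ e0)[n _ /(_ n (leqnn n)) dn].
  exists \1_(q @^-1` A n); split; [exact: bmf_indic|by case: (hA n)|].
  have sub : q @^-1` A n `<=` q @^-1` \bigcup_i A i by move=> x Ax; exists n.
  rewrite (_ : \int[P]_x _ = \int[P]_x (\1_(q @^-1` \bigcup_i A i) x - \1_(q @^-1` A n) x : R)).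
    rewrite PintegralB; [|exact: bmf_indic..].
    by rewrite !Rintegral_indic//; exact: le_trans (ler_norm _) dn.
  apply: eq_Rintegral => x _; rewrite ger0_norm// subr_ge0 !indicE ler_nat.
  by case: (boolP (x \in q @^-1` A n)) => //; rewrite !inE => /sub; rewrite -inE => ->.
Qed.

End translation_continuity.

Lemma rep_add (R : realType) (t : circle R) (s : R) : 0 <= rep t + s < 1 ->
  rep (t + toCircle s) = rep t + s.
Proof. by move=> h; rewrite -{1}[t]toCircle_rep -toCircleD rep_toCircle_id. Qed.

Lemma indic_dist_le1 (T : Type) (R : realType) (A B : set T) (x y : T) :
  `|\1_A x - \1_B y : R| <= 1.
Proof.
rewrite !indicE; case: (x \in A); case: (y \in B) => /=;
  by rewrite ?subrr ?subr0 ?sub0r ?normrN ?normr0 ?normr1.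
Qed.

Section coordinate.
Variable R : realType.
Notation T := (torus R).
Notation P := (leb_torus R).
Notation mu := (@lebesgue_measure R).
Implicit Types (f g : T -> R) (v : R * R).

Lemma strip_le (c : T -> circle R) (B : set R) (lo hi : R) : measurable B ->
  (P ((fun p => rep (c p)) @^-1` B) = mu (B `&` `[0%R, 1%R[)) ->
  lo <= hi -> B `<=` `[lo, hi] ->
  fine (P ((fun p => rep (c p)) @^-1` B)) <= hi - lo.
Proof.
move=> mB -> lohi Bsub.
have : (mu (B `&` `[0%R, 1%R[) <= (hi - lo)%:E)%E.
  apply: (@le_trans _ _ (mu `[lo, hi])).
    apply: le_measure; rewrite ?inE//; first exact: measurableI.
    by move=> x [] /Bsub.
  rewrite lebesgue_measure_itv/= lte_fin; case: ifPn => // _.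
  by rewrite lee_fin subr_ge0.
move=> h; rewrite -lee_fin fineK// ge0_fin_numE ?measure_ge0//.
exact: le_lt_trans h (ltry _).
Qed.

Section one_coordinate.
Variables (c : T -> circle R) (cv : R * R -> R).
Hypothesis mc : measurable_fun setT c.
Hypothesis cE : forall v x, c (translate v x) = c x + toCircle (cv v).
Hypothesis cvE : forall v (d : R), `|v.1| <= d -> `|v.2| <= d -> `|cv v| <= d.
Hypothesis cP : forall B, measurable B ->
  P ((fun p => rep (c p)) @^-1` B) = mu (B `&` `[0%R, 1%R[).

Let q (p : T) := rep (c p).

Let mq : measurable_fun setT q.
Proof. exact: (measurableT_comp (@measurable_rep R) mc). Qed.

Let mqB (B : set R) : measurable B -> measurable (q @^-1` B).
Proof. by move=> mB; rewrite -[X in measurable X]setTI; exact: mq. Qed.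

Let translation_continuous_ray a : translation_continuous \1_(q @^-1` `]-oo, a]).
Proof.
move=> e e0.
have [d d0 [de d4]] : exists2 d : R, 0 < d & 6 * d <= e /\ d <= 4^-1.
  exists (Num.min (e / 6) 4^-1); first by rewrite lt_min divr_gt0//= invr_gt0.
  by split; [rewrite mulrC -ler_pdivlMr// ge_min lexx|rewrite ge_min lexx orbT].
exists d => // v v1 v2; have := cvE v1 v2.
set s := cv v => sd.
(* A shift by at most [d] changes membership in the ray only if the coordinate wraps around 0 or
   crosses [a]. The three strips cover these cases and have total measure at most [4 * d]. *)
pose S1 := q @^-1` `[0, d]; pose S2 := q @^-1` `[1 - d, 1]; pose S3 := q @^-1` `[a - d, a + d].
have mS1 : measurable S1 by exact: mqB.
have mS2 : measurable S2 by exact: mqB.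
have mS3 : measurable S3 by exact: mqB.
apply: (@le_trans _ _ (\int[P]_x ((\1_S1 x + \1_S2 x) + \1_S3 x))).
  apply: le_Pintegral.
  - by apply: bmf_osc; apply: bmf_indic; exact: mqB.
  - by apply: bmfD; [apply: bmfD|]; exact: bmf_indic.
  move=> x; rewrite -/(q _).
  have i0 (A : set T) y : 0 <= \1_A y :> R by rewrite indicE.
  have [S1x|S1x] := pselect (S1 x).
    have -> : \1_S1 x = 1 :> R by rewrite indicE mem_set.
    by rewrite (le_trans (indic_dist_le1 _ _ _ _ _))// -addrA lerDl addr_ge0.
  have [S2x|S2x] := pselect (S2 x).
    have -> : \1_S2 x = 1 :> R by rewrite indicE mem_set.
    by rewrite (le_trans (indic_dist_le1 _ _ _ _ _))// addrAC lerDr addr_ge0.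
  have [S3x|S3x] := pselect (S3 x).
    have -> : \1_S3 x = 1 :> R by rewrite indicE mem_set.
    by rewrite (le_trans (indic_dist_le1 _ _ _ _ _))// lerDr addr_ge0.
  suff -> : \1_(q @^-1` `]-oo, a]) (translate v x) = \1_(q @^-1` `]-oo, a]) x :> R.
    by rewrite subrr normr0 !addr_ge0.
  move: sd; rewrite ler_norml => /andP[sd1 sd2].
  move: S1x S2x S3x; rewrite /S1 /S2 /S3 /= !in_itv/= => S1x S2x S3x.
  have q0 : 0 <= q x by exact: rep_ge0.
  have q1 : q x < 1 by exact: rep_lt1.
  have qd : d < q x by rewrite ltNge; apply/negP => h; apply: S1x; rewrite q0.
  have qd1 : q x < 1 - d by rewrite ltNge; apply/negP => h; apply: S2x; rewrite h ltW.
  have -> : \1_(q @^-1` `]-oo, a]) (translate v x) = ((q x + s <= a)%R : nat)%:R :> R.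
    rewrite indicE; congr (_%:R); congr nat_of_bool.
    have -> : q x + s = q (translate v x).
      by rewrite /q cE rep_add//; rewrite -/(q x) -/s; apply/andP; split; lra.
    by apply/idP/idP; rewrite inE /= in_itv.
  rewrite indicE; congr (_%:R); congr nat_of_bool.
  apply/idP/idP; rewrite inE /= in_itv/= => h; rewrite leNgt; apply/negP => h';
    by apply: S3x; apply/andP; split; lra.
rewrite PintegralD; [|by apply: bmfD; exact: bmf_indic|exact: bmf_indic].
rewrite PintegralD; [|exact: bmf_indic..].
rewrite !Rintegral_indic//.
have h1 : fine (P S1) <= d - 0 by apply: strip_le (cP _) _ _ => //; exact: ltW.
have h2 : fine (P S2) <= 1 - (1 - d).
  by apply: strip_le (cP _) _ _ => //; rewrite gerBl ltW.
have h3 : fine (P S3) <= a + d - (a - d).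
  by apply: strip_le (cP _) _ _ => //; rewrite lerD2l ge0_cp ?ltW.
apply: le_trans (lerD (lerD h1 h2) h3) _; clear h1 h2 h3; lra.
Qed.

Lemma translation_continuous_coord (B : set R) : measurable B ->
  translation_continuous \1_((fun p => rep (c p)) @^-1` B).
Proof.
move=> mB; apply: (@translation_continuous_generated _ _ (@ocitv R) q) => //.
- exact: ocitvI.
- move=> _ [[a b] _ <-] /=.
  rewrite (_ : \1_ _ = fun x => (\1_(q @^-1` `]-oo, b]) x : R) *
      (1 - \1_(q @^-1` `]-oo, a]) x)).
    have mr y : measurable (q @^-1` `]-oo, y]) by exact: mqB.
    apply: translation_continuousM => //; first exact: bmf_indic.
      by apply: bmfB; [exact: bmf_cst|exact: bmf_indic].
    by apply: translation_continuousN => //; exact: bmf_indic.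
  apply/funext => x; rewrite !indicE.
  have -> : (x \in q @^-1` `]a, b]) = (a < q x <= b).
    by apply/idP/idP; rewrite inE /= in_itv.
  have -> : (x \in q @^-1` `]-oo, b]) = (q x <= b).
    by apply/idP/idP; rewrite inE /= in_itv.
  have -> : (x \in q @^-1` `]-oo, a]) = (q x <= a).
    by apply/idP/idP; rewrite inE /= in_itv.
  rewrite ltNge; case: (q x <= a) => /=; rewrite ?subrr ?mulr0// subr0 mulr1//.
Qed.

End one_coordinate.

Lemma translation_continuous_indic (B : set T) : measurable B ->
  translation_continuous \1_B.
Proof.
move=> mB; pose G := [set A `*` C | A in @measurable _ (circle R) & C in @measurable _ (circle R)].
apply: (@translation_continuous_generated _ _ G id) => //.
- move=> _ _ [A mA [C mC <-]] [A' mA' [C' mC' <-]]; rewrite -setXI.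
  by exists (A `&` A'); [exact: measurableI|exists (C `&` C') => //; exact: measurableI].
- by move=> C; rewrite /G -measurable_prod_measurableType.
- move=> _ [A mA [C mC <-]]; rewrite preimage_id.
  pose A' := @toCircle R @^-1` A; pose C' := @toCircle R @^-1` C.
  have mA' : measurable A' by exact: measurable_preimage_toCircle.
  have mC' : measurable C' by exact: measurable_preimage_toCircle.
  rewrite (_ : \1_ _ = fun x : T => (\1_((fun p : T => rep p.1) @^-1` A') x : R) *
      \1_((fun p : T => rep p.2) @^-1` C') x).
    apply: translation_continuousM.
    - by apply: bmf_indic; rewrite -[X in measurable X]setTI;
        exact: (measurableT_comp (@measurable_rep R) measurable_fst).
    - by apply: bmf_indic; rewrite -[X in measurable X]setTI;
        exact: (measurableT_comp (@measurable_rep R) measurable_snd).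
    - apply: (@translation_continuous_coord fst fst) => //.
      exact: leb_torus_strip1.
    - apply: (@translation_continuous_coord snd snd) => //.
      exact: leb_torus_strip2.
  apply/funext => x; rewrite !indicE -natrM mulnb; congr (_%:R); congr nat_of_bool.
  apply/idP/andP.
    by rewrite inE => -[Ax Cx]; split; rewrite inE /= /A' /C' /preimage/= toCircle_rep.
  by rewrite !inE /= /A' /C' /preimage/= !toCircle_rep.
- by move: mB; rewrite measurable_prod_measurableType.
Qed.

End coordinate.

(** * Weak limits along an ultrafilter *)

Section unit_fun.
Context d (T : measurableType d) (R : realType).
Implicit Types f : T -> R.

Definition unit_fun f := measurable_fun setT f /\ forall x, 0 <= f x <= 1.

Lemma unit_fun_bmf f : unit_fun f -> bmf f.
Proof.
move=> [mf f01]; split=> //; exists 1 => x.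
by have /andP[f0 f1] := f01 x; rewrite ger0_norm.
Qed.

Lemma unit_fun_comp (S : T -> T) f : measurable_fun setT S -> unit_fun f ->
  unit_fun (fun x => f (S x)).
Proof. by move=> mS [mf f01]; split=> //; exact: (measurableT_comp mf mS). Qed.

Lemma unit_fun_indic (E : set T) : measurable E -> unit_fun \1_E.
Proof.
move=> mE; split; first exact: measurable_indic.
by move=> x; rewrite indicE ler0n /= lern1 leq_b1.
Qed.

Definition layer n f (j : nat) : set T := [set x | (j.+1)%:R / n.+1%:R <= f x].

Lemma measurable_layer n f j : measurable_fun setT f -> measurable (layer n f j).
Proof.
move=> mf; rewrite (_ : layer n f j = f @^-1` `[j.+1%:R / n.+1%:R, +oo[).
  by rewrite -[X in measurable X]setTI; exact: mf.
by apply/seteqP; split => x; rewrite /layer /= in_itv/= andbT.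
Qed.

(** [s] counts the positive integers up to [n] that do not exceed [y]: it is the integer part of
    [y], unless capped at [n]. *)
Let count_le (y : R) n : 0 <= y ->
  let s := \sum_(j < n) ((j.+1%:R <= y)%R : nat)%:R : R in
  s <= y /\ (y - 1 <= s \/ n%:R <= s).
Proof.
move=> y0 /=; elim: n => [|n [IH1 IH2]].
  by rewrite big_ord0; split => //; right.
have sn : \sum_(j < n) ((j.+1%:R <= y)%R : nat)%:R <= n%:R :> R.
  rewrite -natr_sum ler_nat -[leqRHS]card_ord -sum1_card.
  by apply: leq_sum => i _; rewrite leq_b1.
rewrite big_ord_recr /=; case: (leP n.+1%:R y) => ny /=; last first.
  rewrite addr0; split => //; left; case: IH2 => // ns.
  by rewrite lerBlDr (le_trans (ltW ny))// -natr1 lerD2r.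
rewrite -natr1 in ny *; split; first by lra.
by case: IH2 => ?; [left|right]; lra.
Qed.

(** With [N = n + 1], the number of layers containing [x] is the integer part of [N * f x], so
    averaging the indicators rounds [f x] down to a multiple of [1 / N]. *)
Lemma layer_cake f n x : unit_fun f ->
  `|f x - n.+1%:R^-1 * \sum_(j < n.+1) \1_(layer n f j) x| <= n.+1%:R^-1.
Proof.
move=> [_ /(_ x)/andP[f0 f1]].
have n0 : 0 < n.+1%:R :> R by rewrite ltr0n.
have := @count_le (n.+1%:R * f x) n.+1 (mulr_ge0 (ltW n0) f0) => /=.
have -> : \sum_(j < n.+1) ((j.+1%:R <= n.+1%:R * f x)%R : nat)%:R =
    \sum_(j < n.+1) \1_(layer n f j) x :> R.
  apply: eq_bigr => j _; rewrite indicE; congr (_%:R); congr nat_of_bool.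
  by apply/idP/idP; rewrite /layer inE /= ler_pdivrMr// mulrC.
set s := \sum_(j < _) _ => -[s1 s2].
have {}s2 : n.+1%:R * f x - 1 <= s.
  case: s2 => // h; rewrite lerBlDr (le_trans (ler_wpM2l (ltW n0) f1))//.
  by rewrite mulr1 (le_trans h)// lerDl.
have -> : f x - n.+1%:R^-1 * s = n.+1%:R^-1 * (n.+1%:R * f x - s).
  by rewrite mulrBr mulKf// gt_eqF.
have ni0 : 0 <= n.+1%:R^-1 :> R by rewrite invr_ge0 ltW.
rewrite normrM (ger0_norm ni0) -[X in _ <= X]mulr1 ler_wpM2l//.
by rewrite ger0_norm ?subr_ge0// lerBlDr -lerBlDl.
Qed.

End unit_fun.

Lemma fmap_ultra (T U : Type) (f : T -> U) (F : set_system T) :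
  UltraFilter F -> UltraFilter (fmap f F).
Proof.
move=> FU; split; first exact: fmap_proper_filter.
move=> G GF FG; rewrite predeqE => A; split; last exact: FG.
move=> GA; have [//|FnA] := in_ultra_setVsetC (f @^-1` A) FU.
have GnA : G (~` A) by exact: FG.
by have /filter_ex [? []] : G (A `&` (~` A)) by exact: filterI.
Qed.

Section weak_limit.
Context d (T : measurableType d) (R : realType) (P : probability T R).
Variable F : set_system nat.
Hypothesis UF : UltraFilter F.
Implicit Types (f : T -> R).

Lemma ultra_bounded_cvg (u : nat -> R) (M : R) : (forall n, `|u n| <= M) ->
  cvg (u n @[n --> F]).
Proof.
move=> uM.
have := @segment_compact R (- M) M; rewrite compact_ultra.
move=> /(_ (fmap u F)) [].
- exact: fmap_ultra.
- rewrite /fmap /=; apply: (@filterE _ F) => n.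
  by rewrite /= in_itv/= -ler_norml.
- by move=> l [_ ul]; apply/cvg_ex; exists l.
Qed.

Variable h : nat -> T -> R.
Hypothesis h01 : forall n, unit_fun (h n).

Definition ulim f : R := lim ((\int[P]_x (f x * h n x)) @[n --> F]).

Let bh n : bmf (h n).
Proof. exact: unit_fun_bmf. Qed.

Lemma ulim_cvg f : bmf f -> (\int[P]_x (f x * h n x)) @[n --> F] --> ulim f.
Proof.
move=> bf; have [M M0 fM] := bmf_bound bf.
apply: (@ultra_bounded_cvg _ M) => n.
apply: norm_Pintegral_le; first exact: bmfM.
move=> x; rewrite normrM -[leRHS]mulr1 ler_pM//.
by have /andP[h0 h1] := (h01 n).2 x; rewrite ger0_norm.
Qed.

Lemma ulimD f g : bmf f -> bmf g -> ulim (fun x => f x + g x) = ulim f + ulim g.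
Proof.
move=> bf bg; apply/cvg_lim => //.
have -> : (fun n => \int[P]_x ((f x + g x) * h n x)) =
    (fun n => \int[P]_x (f x * h n x) + \int[P]_x (g x * h n x)).
  apply/funext => n; rewrite -PintegralD; [|exact: bmfM..].
  by apply: eq_Rintegral => x _; rewrite mulrDl.
by apply: cvgD; exact: ulim_cvg.
Qed.

Lemma ulimZ c f : bmf f -> ulim (fun x => c * f x) = c * ulim f.
Proof.
move=> bf; apply/cvg_lim => //.
have -> : (fun n => \int[P]_x (c * f x * h n x)) =
    (fun n => c * \int[P]_x (f x * h n x)).
  apply/funext => n; rewrite -PintegralZ; last exact: bmfM.
  by apply: eq_Rintegral => x _; rewrite mulrA.
by apply: cvgMl_tmp; exact: ulim_cvg.
Qed.

Lemma ulim_ge0 f : bmf f -> (forall x, 0 <= f x) -> 0 <= ulim f.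
Proof.
move=> bf f0; apply: (limr_ge (ulim_cvg bf)).
apply: (@filterE _ F) => n; apply: Rintegral_ge0 => x _; rewrite mulr_ge0//.
by have /andP[] := (h01 n).2 x.
Qed.

Lemma ulim_le f : bmf f -> (forall x, 0 <= f x) -> ulim f <= \int[P]_x f x.
Proof.
move=> bf f0; apply: (limr_le (ulim_cvg bf)).
apply: (@filterE _ F) => n; apply: le_Pintegral => //; first exact: bmfM.
move=> x; rewrite -[leRHS]mulr1 ler_wpM2l//.
by have /andP[] := (h01 n).2 x.
Qed.

Lemma ulimB f g : bmf f -> bmf g -> ulim (fun x => f x - g x) = ulim f - ulim g.
Proof.
move=> bf bg; have := ulimD bf (bmfZ (-1) bg); rewrite ulimZ// mulN1r => <-.
by congr ulim; apply/funext => x; rewrite mulN1r.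
Qed.

Lemma ulim0 : ulim (fun=> 0) = 0.
Proof.
transitivity (0 * ulim (fun=> 0)); last by rewrite mul0r.
rewrite -ulimZ; last exact: bmf_cst.
by congr ulim; apply/funext => x; rewrite mul0r.
Qed.

Lemma ulim_sum (I : Type) (r : seq I) (f : I -> T -> R) : (forall i, bmf (f i)) ->
  ulim (fun x => \sum_(i <- r) f i x) = \sum_(i <- r) ulim (f i).
Proof.
move=> bf; elim: r => [|i r IH].
  by rewrite big_nil -[RHS]ulim0; congr ulim; apply/funext => x; rewrite big_nil.
rewrite big_cons -IH -ulimD//; last exact: bmf_sum.
by congr ulim; apply/funext => x; rewrite big_cons.
Qed.

(* The maximum with 0 only matters for nonmeasurable E. *)
Definition ulim_measure (E : set T) : \bar R := (Num.max 0 (ulim \1_E))%:E.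

Lemma ulim_measureE E : measurable E -> ulim_measure E = (ulim \1_E)%:E.
Proof.
move=> mE; by rewrite /ulim_measure max_r// ulim_ge0//; exact: bmf_indic.
Qed.

Let ulim_measure0 : ulim_measure set0 = 0%E.
Proof. by rewrite ulim_measureE// indic0 ulim0. Qed.

Let ulim_measure_ge0 E : (0 <= ulim_measure E)%E.
Proof. by rewrite lee_fin le_max lexx. Qed.

Let ulim_measure_semi_sigma_additive : semi_sigma_additive ulim_measure.
Proof.
move=> E mE tE mU; rewrite ulim_measureE//.
have -> : (fun n => (\sum_(0 <= i < n) ulim_measure (E i))%E) =
    (fun n => (\sum_(0 <= i < n) ulim \1_(E i))%:E).
  apply/funext => n; rewrite -sumEFin; apply: eq_bigr => i _.
  by rewrite ulim_measureE.
apply: cvg_EFin; first by near=> n.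
rewrite /comp /=.
(* Countable additivity is inherited from [P]: on the rest of the union the functional lies between
   0 and the [P]-measure of that rest, which tends to 0. *)
have cvP : (\sum_(0 <= i < n) fine (P (E i))) @[n --> \oo] --> fine (P (\bigcup_i E i)).
  have hP : (\sum_(0 <= i < n) P (E i))%E @[n --> \oo] -->
      (fine (P (\bigcup_i E i)))%:E.
    by rewrite fineK ?fin_num_measure//; exact: measure_semi_sigma_additive.
  rewrite (_ : (fun n => _) = fine \o (fun n => \sum_(0 <= i < n) P (E i))%E).
    exact: fine_cvg.
  apply/funext => n /=; rewrite -[LHS]/(fine (_%:E)) -sumEFin; congr fine.
  by apply: eq_bigr => i _; rewrite fineK// fin_num_measure.
apply/cvgrPdist_le => e e0; move/cvgrPdist_le : cvP => /(_ e e0).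
apply: filterS => n; apply: le_trans.
pose S x : R := \sum_(0 <= i < n) \1_(E i) x.
have bS : bmf S by apply: bmf_sum => i; exact: bmf_indic.
have bU : bmf (\1_(\bigcup_i E i) : T -> R) by exact: bmf_indic.
have SU x : 0 <= (\1_(\bigcup_i E i) x : R) - S x.
  rewrite subr_ge0 /S; have [[i _ Eix]|nEx] := pselect ((\bigcup_i E i) x).
    rewrite (_ : \1_(_) x = 1 :> R); last by rewrite indicE mem_set//; exists i.
    have [ni|ni] := leqP n i.
      rewrite big_nat big1 ?ler01// => j /andP[_ jn]; rewrite indicE memNset// => Ejx.
      have /trivIsetP/(_ i j I I) : trivIset setT E by [].
      have -> : i != j by rewrite gtn_eqF// (leq_trans jn).
      by move=> /(_ isT)/seteqP[/(_ x) /= + _]; apply.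
    rewrite (bigD1_seq i)//= ?mem_index_iota ?iota_uniq// big1 ?addr0.
      by rewrite indicE mem_set.
    move=> j ji; rewrite indicE memNset// => Ejx.
    have /trivIsetP/(_ i j I I) : trivIset setT E by [].
    by rewrite eq_sym => /(_ ji)/seteqP[/(_ x) /= + _]; apply.
  rewrite big1 ?indicE// => i _; rewrite indicE memNset// => Eix; apply: nEx.
  by exists i.
have -> : \sum_(0 <= i < n) ulim \1_(E i) = ulim S.
  by rewrite ulim_sum// => i; exact: bmf_indic.
have -> : \sum_(0 <= i < n) fine (P (E i)) = \int[P]_x S x.
  rewrite bRintegral_sum//; last by move=> i; exact: bmf_indic.
    by apply: eq_bigr => i _; rewrite Rintegral_indic.
  exact: probability_setT_lty.
rewrite -(Rintegral_indic P mU) -ulimB// -PintegralB//.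
rewrite ger0_norm; last by apply: ulim_ge0 => //; exact: bmfB.
rewrite ger0_norm; last by apply: Rintegral_ge0 => x _.
by apply: ulim_le => //; exact: bmfB.
Unshelve. all: by end_near.
Qed.

HB.instance Definition _ := isMeasure.Build _ _ _ ulim_measure
  ulim_measure0 ulim_measure_ge0 ulim_measure_semi_sigma_additive.

Let ulim_measure_fin : fin_num_fun ulim_measure.
Proof. by []. Qed.

HB.instance Definition _ := Measure_isFinite.Build _ _ _ ulim_measure
  ulim_measure_fin.

Lemma ulim_measure_le E : measurable E -> (ulim_measure E <= P E)%E.
Proof.
move=> mE; rewrite ulim_measureE//.
rewrite -[leRHS]fineK ?fin_num_measure// lee_fin -(Rintegral_indic P mE).
by apply: ulim_le => //; exact: bmf_indic.
Qed.

(** The limit functional on indicators is a measure dominated by [P], and [k] is its Radon-Nikodym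
    density. *)
Lemma ulim_density : exists k : T -> R, unit_fun k /\
  forall E, measurable E -> ulim \1_E = \int[P]_x (\1_E x * k x).
Proof.
have numu : ulim_measure `<< P.
  move=> N N0 A mA AN; apply/eqP; rewrite eq_le measure_ge0 andbT.
  by rewrite -(N0 A)// ulim_measure_le.
have [f [f0 ffin fint fE]] := radon_nikodym_sigma_finite numu.
have {}fE A : measurable A -> ulim_measure A = (\int[P]_(x in A) f x)%E by exact: fE.
have mf : measurable_fun setT f by exact: measurable_int fint.
have mff : measurable_fun setT (fine \o f).
  by apply: measurableT_comp => //; exact: fine_measurable.
(* The density is at most 1 only almost everywhere. Truncation gives the bound at every point; it
   remains to see that no mass is lost where the density exceeds 1. *)
pose k x := Num.min (fine (f x)) 1.
have k01 : unit_fun k.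
  split; first exact: measurable_minr.
  by move=> x; rewrite le_min ler01 andbT ge_min lexx orbT fine_ge0.
exists k; split => // E mE.
have bk := unit_fun_bmf k01.
have kint A : measurable A -> (\int[P]_(x in A) (k x)%:E)%E \is a fin_num.
  move=> mA; apply: integrable_fin_num => //; apply: bmf_integrable => //.
  by rewrite ltey_eq fin_num_measure.
apply: EFin_inj; rewrite -ulim_measureE//.
have -> : \int[P]_x (\1_E x * k x) = \int[P]_(x in E) k x.
  rewrite [RHS]Rintegral_mkcond; apply: eq_Rintegral => x _.
  by rewrite patchE indicE; case: ifP => _; rewrite ?mul1r ?mul0r.
rewrite /Rintegral fineK ?kint//.
pose B := [set x | 1 < fine (f x)].
have mB : measurable B.
  rewrite (_ : B = (fine \o f) @^-1` `]1, +oo[).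
    by rewrite -[X in measurable X]setTI; exact: mff.
  by apply/seteqP; split => x; rewrite /B /= in_itv/= andbT.
have mEB : measurable (E `&` B) by exact: measurableI.
have mEnB : measurable (E `\` B) by exact: measurableD.
have k0 x : (0 <= (k x)%:E)%E by rewrite lee_fin; have /andP[] := k01.2 x.
have mk A : measurable_fun A (EFin \o k).
  by apply/measurable_EFinP/measurable_funTS; case: k01.
have -> : E = (E `\` B) `|` (E `&` B).
  by rewrite setUC setUIDK.
have dis : [disjoint E `\` B & E `&` B].
  by apply/disj_setPS => x [[_ nB] [_ /nB]].
rewrite ge0_integral_setU//.
have -> : (ulim_measure (E `\` B `|` E `&` B) =
    ulim_measure (E `\` B) + ulim_measure (E `&` B))%E.
  by rewrite measureU//; apply/seteqP; split => // x [[_ nB] [_ /nB]].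
congr (_ + _)%E.
  rewrite fE//; apply: eq_integral => x; rewrite inE => -[_ /negP].
  by rewrite -leNgt => fx; rewrite /k min_l// fineK.
have -> : (\int[P]_(x in E `&` B) (k x)%:E = P (E `&` B))%E.
  rewrite (eq_integral (fun=> 1%E)) ?integral_cst ?mul1e// => x.
  by rewrite inE => -[_ Bx]; rewrite /k min_r// ltW.
(* Inside [B] the density exceeds 1 although the measure is at most [P], so the two measures
   coincide there. *)
apply/eqP; rewrite eq_le ulim_measure_le//=.
rewrite fE// -[leLHS]mul1e -integral_cst//; apply: ge0_le_integral => //.
  exact: measurable_funTS.
by move=> x [_ /ltW Bx]; rewrite -(fineK (ffin x)) lee_fin.
Qed.

(** Weak compactness of the functions with values in [[0, 1]]. One ultrafilter serves all test
    functions, and later a second limit as well, so no subsequence is extracted. Indicators come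
    from [ulim_density], other functions from [layer_cake]. *)
Lemma weak_limit : exists k : T -> R, unit_fun k /\
  forall f, unit_fun f -> (\int[P]_x (f x * h n x)) @[n --> F] --> \int[P]_x (f x * k x).
Proof.
have [k [k01 kE]] := ulim_density; exists k; split => // f f01.
have bk := unit_fun_bmf k01; have bf := unit_fun_bmf f01.
suff <- : ulim f = \int[P]_x (f x * k x) by exact: ulim_cvg.
have lay n : measurable_fun setT f -> measurable (layer n f 0).
  exact: measurable_layer.
apply/eqP; rewrite -subr_eq0 -normr_le0; apply/ler_addgt0Pl => e e0.
rewrite addr0.
have [n ne] : exists n, 2 * n.+1%:R^-1 <= e.
  exists (Num.truncn (2 / e)); rewrite ler_pdivrMr// mulrC -ler_pdivrMr//.
  by rewrite ltW// truncnS_gt.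
apply: le_trans ne.
pose g x : R := n.+1%:R^-1 * \sum_(j < n.+1) \1_(layer n f j) x.
have bl (j : 'I_n.+1) : bmf (\1_(layer n f j) : T -> R).
  by apply: bmf_indic; apply: measurable_layer; case: f01.
have bg : bmf g by apply: bmfZ; exact: bmf_sum.
have -> : ulim f - \int[P]_x (f x * k x) =
    ulim (fun x => f x - g x) - \int[P]_x ((f x - g x) * k x).
  rewrite ulimB//.
  have -> : \int[P]_x ((f x - g x) * k x) =
      \int[P]_x (f x * k x) - \int[P]_x (g x * k x).
    rewrite -PintegralB; [|exact: bmfM..].
    by apply: eq_Rintegral => x _; rewrite mulrBl.
  suff -> : ulim g = \int[P]_x (g x * k x) by ring.
  rewrite ulimZ; last exact: bmf_sum.
  have -> : \int[P]_x (g x * k x) =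
      n.+1%:R^-1 * \int[P]_x (\sum_(j < n.+1) \1_(layer n f j) x * k x).
    rewrite -PintegralZ; last by apply: bmf_sum => j; exact: bmfM.
    by apply: eq_Rintegral => x _; rewrite /g -mulrA mulr_suml.
  rewrite ulim_sum// bRintegral_sum//; last 2 first.
  - exact: probability_setT_lty.
  - by move=> j; exact: bmfM.
  congr (_ * _); apply: eq_bigr => j _; apply: kE.
  by apply: measurable_layer; case: f01.
have bfg : bmf (fun x => f x - g x) by exact: bmfB.
have fg x : `|f x - g x| <= n.+1%:R^-1 by exact: layer_cake.
rewrite (le_trans (ler_normB _ _))// mulrDl mul1r lerD//.
  rewrite ler_norml; apply/andP; split.
    apply: (limr_ge (ulim_cvg bfg)); apply: (@filterE _ F) => m.
    have : `|\int[P]_x ((f x - g x) * h m x)| <= n.+1%:R^-1.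
      apply: norm_Pintegral_le; first exact: bmfM.
      move=> x; rewrite normrM -[leRHS]mulr1 ler_pM//.
      by have /andP[h0 h1] := (h01 m).2 x; rewrite ger0_norm.
    by rewrite ler_norml => /andP[].
  apply: (limr_le (ulim_cvg bfg)); apply: (@filterE _ F) => m.
  have : `|\int[P]_x ((f x - g x) * h m x)| <= n.+1%:R^-1.
    apply: norm_Pintegral_le; first exact: bmfM.
    move=> x; rewrite normrM -[leRHS]mulr1 ler_pM//.
    by have /andP[h0 h1] := (h01 m).2 x; rewrite ger0_norm.
  by rewrite ler_norml => /andP[].
apply: norm_Pintegral_le; first exact: bmfM.
move=> x; rewrite normrM -[leRHS]mulr1 ler_pM//.
by have /andP[h0 h1] := k01.2 x; rewrite ger0_norm.
Qed.

End weak_limit.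

(** * Orbits along eigenvectors *)

Section translation_continuity_unit.
Variable R : realType.
Notation T := (torus R).
Notation P := (leb_torus R).

Lemma translation_continuousD (f g : T -> R) : bmf f -> bmf g ->
  translation_continuous f -> translation_continuous g ->
  translation_continuous (fun x => f x + g x).
Proof.
move=> bf bg cf cg e e0.
have [|d d0 fd] := cf (e / 2); first by rewrite divr_gt0.
have [|d' d'0 gd] := cg (e / 2); first by rewrite divr_gt0.
exists (Num.min d d') => [|v]; first by rewrite lt_min d0.
rewrite !le_min => /andP[v1 v1'] /andP[v2 v2'].
rewrite [leRHS](splitr e); apply: le_trans (lerD (fd v v1 v2) (gd v v1' v2')).
rewrite /osc -PintegralD; [|exact: bmf_osc..].
apply: le_Pintegral; first by apply: (bmf_osc v); exact: bmfD.
  by apply: bmfD; exact: bmf_osc.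
move=> x; apply: le_trans (ler_normD _ _).
by rewrite le_eqVlt; apply/orP; left; apply/eqP; congr Num.norm; ring.
Qed.

Lemma translation_continuous_sum (I : Type) (r : seq I) (f : I -> T -> R) :
  (forall i, bmf (f i)) -> (forall i, translation_continuous (f i)) ->
  translation_continuous (fun x => \sum_(i <- r) f i x).
Proof.
move=> bf cf; elim: r => [|i r IH].
  under [fun x => _]eq_fun do rewrite big_nil.
  exact: translation_continuous_cst.
under [fun x => _]eq_fun do rewrite big_cons.
by apply: translation_continuousD => //; exact: bmf_sum.
Qed.

Lemma translation_continuous_unit (f : T -> R) : unit_fun f ->
  translation_continuous f.
Proof.
move=> f01; apply: translation_continuous_lim; first exact: unit_fun_bmf.
move=> e e0.
have [n ne] : exists n, n.+1%:R^-1 <= e.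
  exists (Num.truncn (e^-1)); rewrite invf_ple ?posrE ?invr_gt0//.
  by rewrite ltW// truncnS_gt.
have ml j : measurable (layer n f j) by apply: measurable_layer; case: f01.
exists (fun x => n.+1%:R^-1 * \sum_(j < n.+1) \1_(layer n f j) x); split.
- by apply: bmfZ; apply: bmf_sum => j; exact: bmf_indic.
- apply: translation_continuousM.
  + exact: bmf_cst.
  + by apply: bmf_sum => j; exact: bmf_indic.
  + exact: translation_continuous_cst.
  + apply: translation_continuous_sum => j; first exact: bmf_indic.
    exact: translation_continuous_indic.
- apply: le_trans ne; rewrite -[leRHS](Pintegral_cst P).
  apply: le_Pintegral => [||x]; [|exact: bmf_cst|exact: layer_cake].
  apply/bmf_norm/bmfB; first exact: unit_fun_bmf.
  by apply: bmfZ; apply: bmf_sum => j; exact: bmf_indic.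
Qed.

End translation_continuity_unit.

Section orbits.
Variables (R : realType) (Delta : R).
Notation T := (torus R).
Notation P := (leb_torus R).
Notation F := (Ftilde Delta).
Notation G := (Finv Delta).
Implicit Types (x y : T) (a r : R) (k : int).

Definition iterz k : T -> T :=
  match k with Posz n => iter n F | Negz n => iter n.+1 G end.

Lemma iterzS k x : iterz (k + 1) x = F (iterz k x).
Proof.
case: k => [n|[|n]]; first by rewrite -PoszD addn1.
  by rewrite /= FinvK.
rewrite (_ : (Negz n.+1 + 1)%R = Negz n); last by rewrite !NegzE -addn1 PoszD; ring.
by rewrite [in RHS]/iterz iterS FinvK.
Qed.

Lemma iterzB1 k x : iterz (k - 1) x = G (iterz k x).
Proof. by rewrite -[in RHS](subrK 1 k) iterzS FtildeK. Qed.

Lemma iterz_add i j x : iterz (i + j) x = iterz i (iterz j x).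
Proof.
elim/int_rec: i => [|n IH|n IH]; first by rewrite add0r.
  by rewrite -addn1 PoszD -addrA [1 + j]addrC addrA !iterzS IH.
rewrite -addn1 PoszD opprD -addrA [-1 + j]addrC addrA !iterzB1.
by rewrite IH.
Qed.

Lemma measure_preserving_iterz k : measure_preserving P (iterz k).
Proof.
case: k => n; apply: measure_preserving_iter.
  exact: measure_preserving_F.
exact: measure_preserving_Finv.
Qed.

Lemma measurable_iterz k : measurable_fun setT (iterz k).
Proof. by have [] := measure_preserving_iterz k. Qed.

Definition evec a r : R * R := (r, (1 - a) * r).

(** The characteristic equation of the differential, which has trace [2 - Delta] and determinant 1;
    hence the other root is [a^-1]. *)
Definition eigenvalue a := a ^+ 2 - (2 - Delta) * a + 1 = 0.

Lemma eigenvalue_neq0 a : eigenvalue a -> a != 0.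
Proof.
rewrite /eigenvalue; apply: contra_eq_neq => ->.
by rewrite expr0n/= mulr0 subr0 add0r oner_neq0.
Qed.

Lemma eigenvalueV a : eigenvalue a -> eigenvalue a^-1.
Proof.
move=> ea; have a0 := eigenvalue_neq0 ea; rewrite /eigenvalue.
have : (a ^+ 2 - (2 - Delta) * a + 1) / a ^+ 2 = 0 by rewrite ea mul0r.
by move=> <-; field.
Qed.

(** The first coordinate of the image is continuous on the whole torus. This allows an orbit to be
    followed up to and including a time at which it is cut. *)
Lemma Ftilde_evec1 a r x :
  (F (translate (evec a r) x)).1 = (F x).1 + toCircle (a * r).
Proof.
case: x => t s; rewrite /Ftilde /translate /evec /=.
rewrite opprD addrACA -toCircleB; congr (_ + toCircle _); ring.
Qed.

Lemma Ftilde_evec a r x : eigenvalue a -> 0 <= rep (F x).1 + a * r < 1 ->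
  F (translate (evec a r) x) = translate (evec a (a * r)) (F x).
Proof.
move=> ea C; apply: injective_projections; first exact: Ftilde_evec1.
have e1 := Ftilde_evec1 a r x.
transitivity ((translate (evec a r) x).2 + kick Delta (F (translate (evec a r) x)).1).
  by [].
rewrite e1 /kick rep_add//; case: x C {e1} => t s C.
rewrite /=; rewrite -[LHS]addrA -[RHS]addrA; congr (_ + _).
rewrite -!toCircleD; congr toCircle.
have e2 : (1 - a) * a = 1 - a + Delta * a.
  by apply/eqP; rewrite -subr_eq0 -oppr_eq0 -[X in _ == X]ea; apply/eqP; ring.
by rewrite mulrA e2; ring.
Qed.

Lemma Finv_evec a r x : eigenvalue a -> 0 <= rep x.1 + r < 1 ->
  G (translate (evec a r) x) = translate (evec a (a^-1 * r)) (G x).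
Proof.
move=> ea C; have a0 := eigenvalue_neq0 ea.
have ar : a * (a^-1 * r) = r by rewrite mulVKf.
apply: (can_inj (@FtildeK _ Delta)); rewrite FinvK Ftilde_evec//; last first.
  by rewrite FinvK ar.
by rewrite FinvK ar.
Qed.

Definition tau k x : R := rep (iterz k x).1.

(** [tau k] is the first coordinate of the image in the step from time [k - 1] to [k], where the
    sawtooth jumps. The condition thus governs the forward step into [k] and the backward step out
    of [k]: following an orbit into the future needs it for [0 < k], into the past for [k <= 0]. *)
Definition uncut a r k x := 0 <= tau k x + r * a ^ k < 1.

Definition shadow a r k x y := iterz k y = translate (evec a (r * a ^ k)) (iterz k x).

Lemma shadow0 a r x : shadow a r 0 x (translate (evec a r) x).
Proof. by rewrite /shadow /= expr0z mulr1. Qed.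

Lemma shadowS a r k x y : eigenvalue a -> uncut a r (k + 1) x ->
  shadow a r k x y -> shadow a r (k + 1) x y.
Proof.
move=> ea; have a0 := eigenvalue_neq0 ea.
have e : a * (r * a ^ k) = r * a ^ (k + 1) by rewrite mulrCA expfzDr// expr1z [a * _]mulrC.
rewrite /uncut /shadow /tau !iterzS => C ->.
by rewrite Ftilde_evec// e.
Qed.

Lemma shadowB1 a r k x y : eigenvalue a -> uncut a r k x ->
  shadow a r k x y -> shadow a r (k - 1) x y.
Proof.
move=> ea; have a0 := eigenvalue_neq0 ea.
have e : a^-1 * (r * a ^ k) = r * a ^ (k - 1) by rewrite mulrCA expfzDr// exprN1 [a^-1 * _]mulrC.
rewrite /uncut /shadow /tau !iterzB1 => C ->.
by rewrite Finv_evec// e.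
Qed.

Lemma shadow_fwd a r x n : eigenvalue a ->
  (forall k : nat, (0 < k <= n)%N -> uncut a r k x) ->
  shadow a r n x (translate (evec a r) x).
Proof.
move=> ea; elim: n => [|n IH] C; first exact: shadow0.
rewrite -addn1 PoszD; apply: shadowS => //.
  by rewrite -PoszD addn1; apply: C; rewrite leqnn.
by apply: IH => k /andP[k0 kn]; apply: C; rewrite k0 (leq_trans kn).
Qed.

Lemma shadow_bwd a r x n : eigenvalue a ->
  (forall k : nat, (k < n)%N -> uncut a r (- k%:Z) x) ->
  shadow a r (- n%:Z) x (translate (evec a r) x).
Proof.
move=> ea; elim: n => [|n IH] C; first by rewrite oppr0; exact: shadow0.
rewrite -addn1 PoszD opprD; apply: shadowB1 => //; first exact: C.
by apply: IH => k kn; apply: C; rewrite (leq_trans kn).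
Qed.

(** Time [j] itself is exempt: crossing the cut at time [j] does not disturb the first coordinate at
    that time, only what lies beyond it. *)
Lemma shadow_coord a r j x : eigenvalue a ->
  (forall k, (0 < k < j) || (j < k <= 0) -> uncut a r k x) ->
  (iterz j (translate (evec a r) x)).1 = (iterz j x).1 + toCircle (r * a ^ j).
Proof.
move=> ea C; have a0 := eigenvalue_neq0 ea; case: (ltP 0 j) => j0.
  have [n jn] : exists n : nat, j = n%:Z + 1.
    by case: j j0 {C} => [[|n]|]// _; exists n; rewrite -PoszD addn1.
  rewrite jn !iterzS.
  have -> : iterz n (translate (evec a r) x) =
      translate (evec a (r * a ^ n)) (iterz n x).
    apply: shadow_fwd => // k /andP[k0 kn]; apply: C.
    by rewrite jn ltz_nat k0 -PoszD addn1 ltz_nat ltnS kn.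
  by rewrite Ftilde_evec1; congr (_ + toCircle _); rewrite expfzDr// expr1z mulrCA [a * _]mulrC.
have [n jn] : exists n : nat, j = - n%:Z.
  by exists `|j|%N; rewrite -[LHS]opprK; congr (- _); rewrite lez0_abs.
rewrite jn.
have -> // : iterz (- n%:Z) (translate (evec a r) x) =
    translate (evec a (r * a ^ (- n%:Z))) (iterz (- n%:Z) x).
apply: shadow_bwd => // k kn; apply: C.
by apply/orP; right; rewrite jn ltrN2 ltz_nat kn /= oppr_le0.
Qed.

End orbits.

(** * Detours around the discontinuities *)

Section detour.
Variables (R : realType) (Delta : R).
Notation T := (torus R).
Notation iterz := (iterz Delta).
Notation tau := (tau Delta).
Notation uncut := (uncut Delta).
Notation eigenvalue := (eigenvalue Delta).
Implicit Types (x y : T) (a b r : R) (k : int).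

Definition near_cut (eta : R) k x := tau k x < eta \/ 1 - eta < tau k x.

Lemma uncut_far a r k x eta : `|r * a ^ k| < eta -> ~ near_cut eta k x ->
  uncut a r k x.
Proof.
rewrite ltr_norml /near_cut /uncut => /andP[h1 h2] /not_orP[/negP + /negP].
by rewrite -!leNgt => h3 h4; apply/andP; split; lra.
Qed.

(** If [u] pushes [t] across the cut, then [v], in the same direction and at least as long, carries
    it across too. From the new position [t'], just beyond the cut, [u] leads further away from
    it. *)
Lemma rep_wrap (t u v eta : R) : 0 <= t < 1 -> ~ (0 <= t + u < 1) -> 0 < u * v ->
  `|u| <= `|v| -> `|v| < eta -> eta <= 4^-1 ->
  let t' := rep (toCircle (t + v)) in
  0 <= t' + u < 1 /\ (t' < eta \/ 1 - eta < t').
Proof.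
move=> /andP[t0 t1] tu uv uv_le v_eta eta4 /=.
have [u0|u0|u0] := ltgtP u 0; last by move: uv; rewrite u0 mul0r ltxx.
- have v0 : v < 0 by move: uv; rewrite nmulr_rgt0.
  rewrite !ltr0_norm// in uv_le v_eta.
  have tu0 : t + u < 0.
    by rewrite ltNge; apply/negP => h; apply: tu; rewrite h/=; lra.
  rewrite -toCircleD1 rep_toCircle_id; last by apply/andP; split; lra.
  by split; [apply/andP; split|right]; lra.
- have v0 : 0 < v by move: uv; rewrite pmulr_rgt0.
  rewrite !gtr0_norm// in uv_le v_eta.
  have tu1 : 1 <= t + u.
    by rewrite leNgt; apply/negP => h; apply: tu; rewrite h andbT; lra.
  rewrite -[t + v](subrK 1) toCircleD1 rep_toCircle_id; last by apply/andP; split; lra.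
  by split; [apply/andP; split|left]; lra.
Qed.

Variables (q eps eta : R) (K : nat).
Hypotheses (q0 : 0 < q) (q1 : q < 1) (eps0 : 0 < eps) (eta4 : eta <= 4^-1).

(** The boolean selects half of the times: the future for the contracting eigenvalue [l^-1], the
    past with time 0 for the expanding eigenvalue [l]. Both directions are then handled by the same
    lemmas. *)
Definition stable a (pos : bool) := forall k, (0 < k) = pos -> `|a ^ k| = q ^+ `|k|.

(** Within the window of times below [K] one approach to the cut is tolerated. Outside it there is
    none, but only at the radius to which the displacement has shrunk by then, with a factor 2 to
    spare. *)
Definition good x :=
  (forall i j, i != j -> (`|i| < K)%N -> (`|j| < K)%N ->
     near_cut eta i x -> ~ near_cut eta j x) /\
  (forall k, (K <= `|k|)%N -> ~ near_cut (2 * eps * q ^+ `|k|) k x).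

Lemma stable_tail c pos k : stable c pos -> (0 < k) = pos ->
  `|eps * c ^ k| < 2 * eps * q ^+ `|k|.
Proof.
move=> sc kpos; rewrite normrM (gtr0_norm eps0) (sc _ kpos).
by rewrite ltr_pM2r ?exprn_gt0// ltr_pMl// ltr1n.
Qed.

Lemma good_uncut c pos x (j k : int) : stable c pos ->
  (forall k, (`|k| < K)%N -> `|eps * c ^ k| < eta) -> good x ->
  near_cut eta j x -> (`|j| < K)%N -> k != j -> (0 < k) = pos ->
  uncut c eps k x.
Proof.
move=> sc amp [g1 g2] nj jK kj kpos; have [kK|kK] := ltnP `|k| K.
  by apply: (uncut_far (amp _ kK)) => nk; exact: (g1 k j) nj.
exact: uncut_far (stable_tail sc kpos) (g2 _ kK).
Qed.

(** The [a]-side of a parallelogram is cut at time [j]; the other three sides are then uncut. All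
    three base points are near the cut at time [j], so, being [good], they avoid it at every other
    time. At time [j] the [b]-displacement carries [x] over the cut first, after which the
    [a]-displacement no longer meets it. *)
Lemma detour a b pos x (j : int) : eigenvalue a -> eigenvalue b -> b = a^-1 ->
  stable a pos -> stable b (~~ pos) ->
  (forall k, (`|k| < K)%N -> `|eps * a ^ k| < eta) ->
  (forall k, (`|k| < K)%N -> `|eps * b ^ k| < eta) ->
  good x -> good (translate (evec a eps) x) -> good (translate (evec b eps) x) ->
  (0 < j) = pos -> ~ uncut a eps j x ->
  [/\ forall k, (0 < k) = ~~ pos -> uncut b eps k x,
      forall k, (0 < k) = pos -> uncut a eps k (translate (evec b eps) x) &
      forall k, (0 < k) = ~~ pos -> uncut b eps k (translate (evec a eps) x)].
Proof.
move=> ea eb ba sa sb ampa ampb gx gxa gxb jpos cut.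
have a0 := eigenvalue_neq0 ea.
have jK : (`|j| < K)%N.
  rewrite ltnNge; apply/negP => Kj; apply: cut.
  exact: uncut_far (stable_tail sa jpos) (gx.2 _ Kj).
have nj : near_cut eta j x.
  by apply: contrapT => nj; apply: cut; exact: uncut_far (ampa _ jK) nj.
have btw k : (0 < k < j) || (j < k <= 0) -> (`|k| < K)%N /\ k != j.
  move=> h; split; last by apply/eqP; move: h; lia.
  by apply: leq_ltn_trans jK; move: h; lia.
have coord c : eigenvalue c -> (forall k, (`|k| < K)%N -> `|eps * c ^ k| < eta) ->
    tau j (translate (evec c eps) x) = rep (toCircle (tau j x + eps * c ^ j)).
  move=> ec ampc; rewrite /tau shadow_coord//.
    by rewrite toCircleD toCircle_rep.
  move=> k /btw[kK kj]; apply: (uncut_far (ampc _ kK)) => nk.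
  exact: (gx.1 k j) nk nj.
have t01 : 0 <= tau j x < 1 by rewrite rep_ge0 rep_lt1.
have aj0 : a ^ j != 0 by rewrite expfz_neq0.
have ab1 : a ^ j * b ^ j = 1 by rewrite ba exprz_inv -expfzDr// subrr expr0z.
have aj1 : `|a ^ j| <= 1 by rewrite sa// exprn_ile1// ltW.
have bj1 : 1 <= `|b ^ j|.
  by rewrite -(@ler_pM2l _ `|a ^ j|) ?normr_gt0// -normrM ab1 normr1 mulr1.
(* Since [a ^ j * b ^ j = 1], the two displacements at time [j] have the same sign, and the
   [b]-displacement is at least as long. *)
have uab : 0 < eps * a ^ j * (eps * b ^ j).
  by rewrite mulrACA ab1 mulr1 mulr_gt0.
have ule : `|eps * a ^ j| <= `|eps * b ^ j|.
  by rewrite !normrM ler_pM2l ?normr_gt0 ?gt_eqF// (le_trans aj1).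
have [wb1 wb2] := rep_wrap t01 cut uab ule (ampb _ jK) eta4.
have uaa : 0 < eps * a ^ j * (eps * a ^ j).
  by rewrite -expr2 exprn_even_gt0//= mulf_neq0// gt_eqF.
have [_ wa2] := rep_wrap t01 cut uaa (lexx _) (ampa _ jK) eta4.
have negpos k : (0 < k) = ~~ pos -> k != j.
  by move=> h; apply/eqP => kj; move: h; rewrite kj jpos; case: (pos).
split => k kpos.
- exact: (good_uncut sb ampb gx nj jK (negpos _ kpos)).
- have [->|kj] := eqVneq k j; first by rewrite /uncut coord.
  by apply: (good_uncut sa ampa gxb _ jK kj kpos); rewrite /near_cut coord.
- apply: (good_uncut sb ampb gxa _ jK (negpos _ kpos) kpos).
  by rewrite /near_cut coord.
Qed.

End detour.

Lemma seq_nat_bound (R : realType) (I : eqType) (f : I -> R) (s : seq I) :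
  exists N : nat, forall i, i \in s -> f i <= N%:R.
Proof.
elim: s => [|i s [N hN]]; first by exists 0%N.
exists (maxn N (Num.truncn (f i)).+1) => j.
rewrite inE => /orP[/eqP ->|/hN h]; last by rewrite (le_trans h)// ler_nat leq_maxl.
by rewrite (le_trans (ltW (truncnS_gt _)))// ler_nat leq_maxr.
Qed.

(** * Lifts of the iterates to the plane *)

Section lifts.
Variables (R : realType) (Delta : R).
Notation T := (torus R).
Notation F := (Ftilde Delta).
Implicit Types (v w z : R * R).

Definition linF v : R * R := (v.1 - v.2, Delta * v.1 + (1 - Delta) * v.2).

Lemma linFD v w : linF (v + w) = linF v + linF w.
Proof. by rewrite /linF; congr pair => /=; ring. Qed.

Lemma iter_linFD n v w : iter n linF (v + w) = iter n linF v + iter n linF w.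
Proof. by elim: n => //= n ->; rewrite linFD. Qed.

Lemma linF_evec a r : eigenvalue Delta a -> linF (evec a r) = evec a (a * r).
Proof.
move=> ea; rewrite /linF /evec /=; congr pair; first by ring.
have e2 : (1 - a) * a = 1 - a + Delta * a.
  by apply/eqP; rewrite -subr_eq0 -oppr_eq0 -[X in _ == X]ea; apply/eqP; ring.
by rewrite [RHS]mulrA e2; ring.
Qed.

Lemma iter_linF_evec n a r : eigenvalue Delta a ->
  iter n linF (evec a r) = evec a (a ^+ n * r).
Proof.
by move=> ea; elim: n => [|n IH] /=; rewrite ?mul1r// IH linF_evec// mulrA -exprS.
Qed.

Lemma Ftilde_lift z : F (toTorus z) =
  toTorus (linF z - (0, Delta * ((Num.floor (linF z).1)%:~R + 2^-1))).
Proof.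
rewrite /Ftilde /toTorus /linF /=; congr pair; first by rewrite subr0 toCircleB.
rewrite -toCircleB rep_toCircle -toCircleD; congr toCircle; ring.
Qed.

Definition box z := (`|z.1| <= 2) /\ (`|z.2| <= 2).

Lemma box_linF n : exists2 M : R, 0 <= M & forall z, box z ->
  `|(iter n linF z).1| <= M /\ `|(iter n linF z).2| <= M.
Proof.
elim: n => [|n [M M0 IH]]; first by exists 2.
exists ((2 + `|Delta| + `|1 - Delta|) * M) => [|z /IH[h1 h2]].
  by rewrite mulr_ge0// !addr_ge0.
have d1 := mulr_ge0 (normr_ge0 Delta) M0.
have d2 := mulr_ge0 (normr_ge0 (1 - Delta)) M0.
rewrite /=; split.
  by apply: le_trans (ler_normB _ _) _; apply: le_trans (lerD h1 h2) _; lra.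
apply: le_trans (ler_normD _ _) _; rewrite !normrM.
have := ler_wpM2l (normr_ge0 Delta) h1.
have := ler_wpM2l (normr_ge0 (1 - Delta)) h2.
lra.
Qed.

(* The translation part of an affine branch of the n-th iterate of F takes
   finitely many values on a bounded region; so do the positions V of the
   lines that separate two branches. *)
Lemma lift_const n : exists B : seq (R * R), exists V : seq R,
  forall S : set (R * R), S !=set0 -> S `<=` box ->
  (forall j, (j < n)%N -> forall c, c \in V -> forall z z', S z -> S z' ->
    ((iter j.+1 linF z).1 < c) = ((iter j.+1 linF z').1 < c)) ->
  exists2 b, b \in B & forall z, S z ->
    iter n F (toTorus z) = toTorus (iter n linF z + b).
Proof.
elim: n => [|n [B [V IH]]].
  exists [:: 0], [::] => S [z Sz] Sbox _; exists 0; first by rewrite inE.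
  by move=> {Sz}z Sz /=; rewrite addr0.
have [M M0 hM] := box_linF n.+1.
have [N hN] := seq_nat_bound (fun b : R * R => `|(linF b).1| + M + 1) B.
(* The integers from [- N] to [N + 1]. The upper end exceeds the bound [N] on the floor by one
   because the floor [k] is pinned down by comparison with both [k] and [k + 1]. *)
pose ks := [seq (i%:Z - N%:Z) | i <- iota 0 (2 * N).+2].
exists [seq linF b - (0, Delta * (k%:~R + 2^-1)) | b <- B, k <- ks].
exists (V ++ [seq k%:~R - (linF b).1 | b <- B, k <- ks]).
move=> S S0 Sbox hS.
have [|b bB hb] := IH S S0 Sbox.
  by move=> j jn v vV; apply: hS; rewrite ?mem_cat ?vV// (leq_trans jn).
have [z0 Sz0] := S0.
pose k := Num.floor (iter n.+1 linF z0 + linF b).1.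
have kbound z : S z -> `|(iter n.+1 linF z + linF b).1| + 1 <= N%:R.
  move=> Sz; apply: le_trans (hN b bB); rewrite lerD2r addrC.
  by apply: le_trans (ler_normD _ _) _; rewrite lerD2l; have [] := hM z (Sbox _ Sz).
have ksP (i : int) : `|i%:~R| <= N%:R + 1 :> R -> - N%:Z <= i -> i \in ks.
  move=> iN Ni; apply/mapP; exists (absz (i + N%:Z)).
    rewrite mem_iota add0n /=.
    have : i <= N%:Z + 1.
      rewrite -(ler_int R) intrD; apply: le_trans iN; exact: ler_norm.
    lia.
  lia.
have kN : `|k%:~R| <= N%:R :> R /\ - N%:Z <= k.
  have := kbound _ Sz0; rewrite -lerBrDr ler_norml => /andP[h1 h2].
  have k1 : k%:~R <= (iter n.+1 linF z0 + linF b).1 by exact: floor_le.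
  have k2 : (iter n.+1 linF z0 + linF b).1 < k%:~R + 1.
    by rewrite -[1]/(1%:~R) -intrD floorD1_gt.
  split; first by rewrite ler_norml; apply/andP; split; lra.
  by rewrite -(ler_int R) rmorphN /=; lra.
have floor_const z : S z -> Num.floor (iter n.+1 linF z + linF b).1 = k.
  move=> Sz.
  have side (i : int) : i \in ks ->
      ((iter n.+1 linF z + linF b).1 < i%:~R) = ((iter n.+1 linF z0 + linF b).1 < i%:~R).
    have e (w : R * R) : ((w + linF b).1 < i%:~R) = (w.1 < i%:~R - (linF b).1).
      by rewrite ltrBrDr.
    move=> iks; rewrite !e; apply: (hS n) => //.
    rewrite mem_cat; apply/orP; right; apply/allpairsP.
    by exists (b, i); split.
  apply: floor_def; apply/andP; split.
    rewrite leNgt side; first by rewrite -leNgt floor_le.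
    apply: ksP; last by case: kN.
    by rewrite (le_trans kN.1)// lerDl.
  rewrite side; first exact: floorD1_gt.
  apply: ksP; last by apply: le_trans kN.2 _; rewrite lerDl.
  by rewrite intrD (le_trans (ler_normD _ _))// normr1 lerD2r kN.1.
exists (linF b - (0, Delta * (k%:~R + 2^-1))).
  apply/allpairsP; exists (b, k); split=> //; apply: ksP; last by case: kN.
  by rewrite (le_trans kN.1)// lerDl.
move=> z Sz; rewrite iterS hb// Ftilde_lift linFD -iterS floor_const//.
by rewrite addrA.
Qed.

End lifts.

(** * Exceptional sets *)

Lemma fine_measure_seq_le d (T : measurableType d) (R : realType)
    (P : probability T R) (I : eqType) (s : seq I) (A : I -> set T) (M : R) :
  (forall i, i \in s -> measurable (A i)) -> (forall i, i \in s -> fine (P (A i)) <= M) ->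
  measurable [set x | exists2 i, i \in s & A i x] /\
  fine (P [set x | exists2 i, i \in s & A i x]) <= (size s)%:R * M.
Proof.
elim: s => [|i s IH] mA AM.
  rewrite (_ : [set x | _] = set0); last by apply/seteqP; split => x // [].
  by rewrite measure0 mul0r; split.
rewrite (_ : [set x | _] = A i `|` [set x | exists2 i, i \in s & A i x]); last first.
  apply/seteqP; split => x /=.
    by move=> [j]; rewrite inE => /orP[/eqP ->|js] Ax; [left|right; exists j].
  by move=> [Ax|[j js Ax]]; [exists i|exists j]; rewrite ?inE ?eqxx ?js ?orbT.
have [||m1 m2] := IH.
- by move=> j js; apply: mA; rewrite inE js orbT.
- by move=> j js; apply: AM; rewrite inE js orbT.
have mAi : measurable (A i) by apply: mA; rewrite inE eqxx.
split; first exact: measurableU.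
apply: le_trans (fine_measureU_le _ mAi m1) _.
by rewrite /= -natr1 mulrDl mul1r addrC lerD// AM// inE eqxx.
Qed.

Lemma fine_measure_bigcup_le d (T : measurableType d) (R : realType)
    (P : probability T R) (A : nat -> set T) (M : R) : (forall n, measurable (A n)) ->
  (forall n, \sum_(i < n) fine (P (A i)) <= M) -> fine (P (\bigcup_i A i)) <= M.
Proof.
move=> mA AM; have mU : measurable (\bigcup_i A i) by exact: bigcupT_measurable.
rewrite -lee_fin fineK ?fin_num_measure//.
apply: (@le_trans _ _ (\sum_(i <oo) P (A i))%E).
  exact: measure_sigma_subadditive.
apply: lime_le; first by apply: is_cvg_nneseries => n _ _; exact: measure_ge0.
near=> n; rewrite big_mkord.
rewrite (eq_bigr (fun i : 'I_n => (fine (P (A i)))%:E)); last first.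
  by move=> i _; rewrite fineK ?fin_num_measure.
by rewrite sumEFin lee_fin AM.
Unshelve. all: by end_near.
Qed.

Lemma geometric_sum_le (R : realType) (q : R) n : 0 <= q < 1 ->
  \sum_(i < n) q ^+ i <= (1 - q)^-1.
Proof.
move=> /andP[q0 q1]; have q1' : 0 < 1 - q by rewrite subr_gt0.
rewrite -(ler_pM2l q1') mulfV ?gt_eqF// -opprB mulNr -subrX1 opprB.
by rewrite gerBl exprn_ge0.
Qed.

Lemma int_iota_absz (K : nat) (k : int) : (absz k < K)%N ->
  exists2 m : nat, m \in iota 0 (2 * K).+2 & k = m%:Z - K%:Z.
Proof. by move=> kK; exists (absz (k + K%:Z)); [rewrite mem_iota|]; lia. Qed.

Lemma int_iota (R : realType) (N : nat) (i : int) : `|i%:~R : R| <= N%:R ->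
  exists2 j : nat, j \in iota 0 (2 * N).+2 & i = j%:Z - N%:Z.
Proof.
move=> h; have : `|i| <= N%:Z by rewrite -(ler_int R) intr_norm.
move=> iN; exists (absz (i + N%:Z)); last by lia.
by rewrite mem_iota add0n; lia.
Qed.

Section near_measure.
Variables (R : realType) (Delta l : R).
Hypotheses (el : eigenvalue Delta l) (l1 : 1 < `|l|).
Notation T := (torus R).
Notation P := (leb_torus R).
Notation iterz := (iterz Delta).
Notation tau := (tau Delta).
Notation linF := (linF Delta).
Notation near_cut := (near_cut Delta).
Implicit Types (x y : T) (a b r eta : R) (k : int).

Lemma measurable_tau k : measurable_fun setT (tau k).
Proof.
apply: (measurableT_comp (@measurable_rep R)).
exact: (measurableT_comp measurable_fst (measurable_iterz Delta k)).
Qed.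

Lemma tau_add i k x : tau k (iterz i x) = tau (k + i) x.
Proof. by rewrite /tau iterz_add. Qed.

Let near_set eta k := [set x | near_cut eta k x].

Let near_setE eta k : near_set eta k = iterz k @^-1`
  ((fun p : T => rep p.1) @^-1` [set` `]-oo, eta[] `|`
   (fun p : T => rep p.1) @^-1` [set` `]1 - eta, +oo[]).
Proof.
by apply/seteqP; split => x [h|h]; [left|right|left|right];
  move: h; rewrite /= in_itv/= ?andbT.
Qed.

Let mrep1 (B : set R) : measurable B -> measurable ((fun p : T => rep p.1) @^-1` B).
Proof.
move=> mB; rewrite -[X in measurable X]setTI.
exact: (measurableT_comp (@measurable_rep R) measurable_fst).
Qed.

Let mrep2 (B : set R) : measurable B -> measurable ((fun p : T => rep p.2) @^-1` B).
Proof.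
move=> mB; rewrite -[X in measurable X]setTI.
exact: (measurableT_comp (@measurable_rep R) measurable_snd).
Qed.

Lemma measurable_near_cut eta k : measurable [set x | near_cut eta k x].
Proof.
rewrite -/(near_set eta k) near_setE -[X in measurable X]setTI.
apply: measurable_iterz => //; apply: measurableU; exact: mrep1.
Qed.

Lemma near_cut_le eta k : 0 <= eta -> fine (P [set x | near_cut eta k x]) <= 2 * eta.
Proof.
move=> eta0; rewrite -/(near_set eta k) near_setE.
have [_ ->] := measure_preserving_iterz Delta k; last first.
  by apply: measurableU; exact: mrep1.
pose S1 := (fun p : T => rep p.1) @^-1` [set` `[0, eta]].
pose S2 := (fun p : T => rep p.1) @^-1` [set` `[1 - eta, 1]].
have m1 : measurable S1 by exact: mrep1.
have m2 : measurable S2 by exact: mrep1.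
apply: (@le_trans _ _ (fine (P (S1 `|` S2)))).
  apply: fine_le_measure; [|exact: measurableU|].
    by apply: measurableU; exact: mrep1.
  move=> x [] /=; rewrite in_itv/= ?andbT => h.
    by left; rewrite /S1/= in_itv/= rep_ge0 ltW.
  by right; rewrite /S2/= in_itv/= ltW//= ltW// rep_lt1.
apply: le_trans (fine_measureU_le _ m1 m2) _.
have h1 : fine (P S1) <= eta - 0.
  by apply: (strip_le (c := fst)) => //; exact: leb_torus_strip1.
have h2 : fine (P S2) <= 1 - (1 - eta).
  apply: (strip_le (c := fst)) => //; first exact: leb_torus_strip1.
  by rewrite gerBl.
apply: le_trans (lerD h1 h2) _; clear h1 h2; lra.
Qed.

Lemma iter_linF_coord n (z : R * R) : (iter n linF z).1 =
  (iter n linF (1, 0)).1 * z.1 + (iter n linF (0, 1)).1 * z.2.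
Proof.
elim: n z => [|n IH] z; first by rewrite /= mul1r mul0r addr0.
by rewrite iterSr IH [in RHS]iterSr (IH (linF (1, 0))) [in RHS]iterSr
  (IH (linF (0, 1))) /linF /=; ring.
Qed.

(** [(0, 1)] has opposite coefficients along the two eigenvectors, so the coordinate is a nonzero
    multiple of [l ^+ n - l ^- n]. Geometrically, preimages of the cut under iterates are
    transversal to the cut. *)
Lemma iter_linF01_neq0 n : (0 < n)%N -> (iter n linF (0, 1)).1 != 0.
Proof.
move=> n0; have l0 := eigenvalue_neq0 el.
have ll : l^-1 != l.
  apply/eqP => h; have := l1; rewrite ltNge => /negP; apply.
  have : l ^+ 2 = 1 by rewrite expr2 -{1}h mulVf.
  by move=> /eqP; rewrite sqrf_eq1 => /orP[] /eqP ->; rewrite ?normrN normr1.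
have e : (0, 1) = evec l (l^-1 - l)^-1 + evec l^-1 (- (l^-1 - l)^-1) :> R * R.
  have dn : l^-1 - l != 0 by rewrite subr_eq0.
  rewrite /evec; congr pair; rewrite /= ?addrN//.
  apply: (mulfI dn); rewrite mulr1 !mulrN mulrBr mulrCA mulfV// mulrCA mulfV//; ring.
rewrite e iter_linFD !iter_linF_evec//; last exact: eigenvalueV.
rewrite /= mulrN -mulrBl mulf_neq0 ?invr_eq0 ?subr_eq0// exprVn.
apply/eqP => h.
have : 1 < `|l ^+ n| by rewrite normrX exprn_egt1// -lt0n.
rewrite h normfV invf_gt1 ?normr_gt0 ?expf_neq0// => h1.
have : 1 < `|l ^+ n| by rewrite normrX exprn_egt1// -lt0n.
by move=> /(lt_trans h1); rewrite ltxx.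
Qed.

Lemma near_cut_round eta x k : 0 <= eta -> near_cut eta k x ->
  forall X, (iterz k x).1 = toCircle X -> exists2 i : int, `|X - i%:~R| <= eta & `|i%:~R| <= `|X| + 1.
Proof.
move=> eta0 nk X Xe.
have tE : tau k x = X - (Num.floor X)%:~R by rewrite /tau Xe rep_toCircle.
have f1 := floor_le X; have f2 := floorD1_gt X; rewrite intrD in f2.
move: nk; rewrite /near_cut tE => -[h|h].
  exists (Num.floor X); first by rewrite ger0_norm; lra.
  by rewrite ler_norml; move: (ler_norm X) (ler_norm (- X)); rewrite normrN => ? ?; apply/andP; split; lra.
exists (Num.floor X + 1); rewrite intrD.
  by rewrite ler0_norm; lra.
by rewrite ler_norml; move: (ler_norm X) (ler_norm (- X)); rewrite normrN => ? ?; apply/andP; split; lra.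
Qed.

(** Near the cut at time 0 the first coordinate [x1] is within [eta] of 0 or 1; near it at time [m]
    an affine form [p * x1 + q * x2 + b1] is within [eta] of an integer. As [q] is nonzero, [x2] is
    confined to finitely many intervals of length proportional to [eta], and the two widths
    multiply. *)
Lemma near_cut2_le (m : nat) : (0 < m)%N -> exists2 C : R, 0 <= C & forall eta, 0 <= eta <= 1 ->
  fine (P [set x | near_cut eta 0 x /\ near_cut eta m x]) <= C * eta ^+ 2.
Proof.
move=> m0; have [B [V hB]] := @lift_const R Delta m.
pose p := (iter m linF (1, 0)).1; pose q := (iter m linF (0, 1)).1.
have q0 : q != 0 by exact: iter_linF01_neq0.
have [M M0 hM] := box_linF Delta m.
have [N hN] := seq_nat_bound (fun b : R * R => `|b.1| + M + 1) B.
(* Possible centres of the intervals for [x2]: an integer in range, minus [p] times the value 0 or 1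
   near [x1], minus [b1], all divided by [q]. *)
pose ks := [seq (i%:Z - N%:Z)%:~R - e%:R * p | i <- iota 0 (2 * N).+2, e <- iota 0 2] : seq R.
pose cs := [seq (i - u.1) / q | u <- B, i <- ks].
(* Half-width per unit of [eta], from [|q| * |x2 - c| <= eta + |p| * eta]. *)
pose kap := (1 + `|p|) / `|q|.
have kap0 : 0 <= kap by rewrite divr_ge0 ?addr_ge0.
exists ((size cs)%:R * (4 * kap)) => [|eta /andP[eta0 eta1]]; first by rewrite !mulr_ge0.
pose Str : set R := `[0, eta] `|` `[1 - eta, 1].
pose A (c : R) : set T := (@rep R @^-1` Str) `*` (@rep R @^-1` `[c - eta * kap, c + eta * kap]).
have mStr : measurable Str by exact: measurableU.
have mA c : measurable (A c).
  by apply: measurableX; exact: measurable_preimage_rep.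
have muStr : (lebesgue_measure (Str `&` `[0%R, 1%R[) <= (2 * eta)%:E)%E.
  apply: (@le_trans _ _ (lebesgue_measure Str)).
    by apply: le_measure; rewrite ?inE//; exact: measurableI.
  apply: le_trans (measureU2 _ _ _) _ => //.
  have e1 : (lebesgue_measure (`[0%R, eta] : set R) <= eta%:E)%E.
    rewrite lebesgue_measure_itv/= lte_fin; case: ifPn => _; first by rewrite sube0.
    by rewrite lee_fin.
  have e2 : (lebesgue_measure (`[(1 - eta)%R, 1%R] : set R) <= eta%:E)%E.
    rewrite lebesgue_measure_itv/= lte_fin ltrBlDr ltrDl; case: ifPn => _.
      by rewrite -EFinB lee_fin; lra.
    by rewrite lee_fin.
  apply: le_trans (leeD e1 e2) _.
  by rewrite -EFinD lee_fin; lra.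
have muA c : fine (P (A c)) <= 4 * kap * eta ^+ 2.
  have : (P (A c) <= (2 * eta)%:E * (2 * (eta * kap))%:E)%E.
    rewrite leb_torus_rect//; apply: lee_pmul => //.
    apply: (@le_trans _ _ (lebesgue_measure (`[(c - eta * kap)%R, (c + eta * kap)%R] : set R))).
      by apply: le_measure; rewrite ?inE//; exact: measurableI.
    have ek := mulr_ge0 eta0 kap0.
    rewrite lebesgue_measure_itv/= lte_fin; case: ifPn => [_|_].
      by rewrite -EFinB lee_fin; lra.
    by rewrite lee_fin mulr_ge0.
  rewrite -EFinM => h; rewrite -lee_fin fineK ?fin_num_measure//.
  by apply: le_trans h _; rewrite lee_fin le_eqVlt; apply/orP; left; apply/eqP; ring.
have [mU] := @fine_measure_seq_le _ _ _ P _ cs A (4 * kap * eta ^+ 2)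
  (fun c _ => mA c) (fun c _ => muA c).
move=> h; rewrite -mulrA; apply: le_trans h.
apply: fine_le_measure => //.
  by apply: measurableI; exact: measurable_near_cut.
move=> x [n0 nm].
pose z : R * R := (rep x.1, rep x.2).
have zx : toTorus z = x by case: x {n0 nm} @z => a b; rewrite /toTorus /= !toCircle_rep.
have zbox : box z.
  by split; rewrite /= ger0_norm ?rep_ge0// (le_trans (ltW (rep_lt1 _)))// ler1n.
have [|||b bB hb] := hB [set z].
- by exists z.
- by move=> _ ->.
- by move=> j _ c _ _ _ -> ->.
have e : (iterz m x).1 = toCircle (p * rep x.1 + q * rep x.2 + b.1).
  by rewrite -[in LHS]zx /= hb//= iter_linF_coord.
have [im him imle] := near_cut_round eta0 nm e.
have [e01 [he ht]] : exists e01 : nat, (e01 < 2)%N /\ `|rep x.1 - e01%:R| <= eta.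
  have t0 := rep_ge0 x.1; have t1 := rep_lt1 x.1.
  move: n0; rewrite /near_cut /tau /= => -[h|h]; [exists 0%N|exists 1%N]; split => //.
    by rewrite subr0 ger0_norm// ltW.
  by rewrite ler0_norm; lra.
have imN : `|im%:~R : R| <= N%:R.
  apply: le_trans imle _; apply: le_trans (hN b bB); rewrite lerD2r [leRHS]addrC.
  apply: le_trans (ler_normD _ _) _; rewrite lerD2r.
  by have [+ _] := hM z zbox; rewrite iter_linF_coord.
have [i0 i0N i0E] := int_iota imN.
exists ((im%:~R - e01%:R * p - b.1) / q).
  apply/allpairsP; exists (b, im%:~R - e01%:R * p); split => //.
  apply/allpairsP; exists (i0, e01); split => //=; last by rewrite i0E.
  by rewrite !inE; case: (e01) he => [|[|]].
split.
  move: n0; rewrite /near_cut /tau /= /Str => -[h|h]; [left|right]; rewrite /= in_itv/=.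
    by rewrite rep_ge0 ltW.
  by rewrite !ltW// rep_lt1.
rewrite /= in_itv/= -ler_distl.
have -> : rep x.2 - (im%:~R - e01%:R * p - b.1) / q =
    ((p * rep x.1 + q * rep x.2 + b.1 - im%:~R) - p * (rep x.1 - e01%:R)) / q.
  by field.
rewrite normrM normfV /kap mulrA ler_pM2r ?invr_gt0 ?normr_gt0//.
apply: le_trans (ler_normB _ _) _; rewrite [eta * _]mulrDr mulr1; apply: lerD => //.
by rewrite normrM [leRHS]mulrC ler_wpM2l.
Qed.

Lemma near_cut_pair_le i j : i != j -> exists2 C : R, 0 <= C & forall eta, 0 <= eta <= 1 ->
  fine (P [set x | near_cut eta i x /\ near_cut eta j x]) <= C * eta ^+ 2.
Proof.
wlog ij : i j / (i < j)%R.
  move=> h; rewrite neq_lt => /orP[ij|ji]; first by apply: h => //; rewrite lt_eqF.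
  have [|C C0 hC] := h j i ji; first by rewrite lt_eqF.
  exists C; first exact: C0.
move=> eta eta01.
  have -> : [set x | near_cut eta i x /\ near_cut eta j x] =
      [set x | near_cut eta j x /\ near_cut eta i x].
    by apply/seteqP; split => x [].
  exact: hC.
move=> _; have [m mij m0] : exists2 m : nat, j = m%:Z + i & (0 < m)%N.
  by exists (absz (j - i)); lia.
have [C C0 hC] := near_cut2_le m0.
exists C; first exact: C0.
move=> eta eta01.
have mB : measurable [set x | near_cut eta 0 x /\ near_cut eta m x].
  by apply: measurableI; exact: measurable_near_cut.
have -> : [set x | near_cut eta i x /\ near_cut eta j x] =
    iterz i @^-1` [set x | near_cut eta 0 x /\ near_cut eta m x].
  apply/seteqP; split => x; rewrite /preimage /=;
    by rewrite /near_cut !tau_add add0r -mij.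
have [_ ->//] := measure_preserving_iterz Delta i.
exact: hC.
Qed.

Lemma near_cut_pairs_le (s : seq (int * int)) : (forall p, p \in s -> p.1 != p.2) ->
  exists2 C : R, 0 <= C & forall eta, 0 <= eta <= 1 ->
  let Z := [set x | exists2 p, p \in s & near_cut eta p.1 x /\ near_cut eta p.2 x] in
  measurable Z /\ fine (P Z) <= C * eta ^+ 2.
Proof.
elim: s => [_|p s IH ps].
  exists 0 => // eta _ /=.
  rewrite (_ : [set x | _] = set0); last by apply/seteqP; split => x // [].
  by rewrite measure0 mul0r; split.
have [|C C0 hC] := IH; first by move=> r rs; apply: ps; rewrite inE rs orbT.
have [|C' C'0 hC'] := @near_cut_pair_le p.1 p.2; first by apply: ps; rewrite inE eqxx.
exists (C' + C) => [|eta eta01 /=]; first exact: addr_ge0.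
have [mZ hZ] := hC eta eta01.
rewrite (_ : [set x | _] = [set x | near_cut eta p.1 x /\ near_cut eta p.2 x] `|`
  [set x | exists2 p, p \in s & near_cut eta p.1 x /\ near_cut eta p.2 x]); last first.
  apply/seteqP; split => x /=.
    by move=> [r]; rewrite inE => /orP[/eqP ->|rs] h; [left|right; exists r].
  by move=> [h|[r rs h]]; [exists p|exists r]; rewrite ?inE ?eqxx ?rs ?orbT.
have m1 : measurable [set x | near_cut eta p.1 x /\ near_cut eta p.2 x].
  by apply: measurableI; exact: measurable_near_cut.
split; first exact: measurableU.
apply: le_trans (fine_measureU_le _ m1 mZ) _; rewrite mulrDl lerD//.
exact: hC'.
Qed.

Notation good := (good Delta).
Notation uncut := (uncut Delta).
Let q := `|l|^-1.

Let l0 : 0 < `|l|.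
Proof. exact: lt_trans l1. Qed.

Let q0 : 0 < q.
Proof. by rewrite invr_gt0. Qed.

Let q1 : q < 1.
Proof. by rewrite invf_lt1. Qed.

Lemma stable_contracting : stable q l^-1 true.
Proof.
move=> [k|k] // _; rewrite normrX normfV.
by rewrite /q absz_nat.
Qed.

Lemma stable_expanding : stable q l false.
Proof.
move=> k kpos; have [n ->] : exists n : nat, k = - n%:Z.
  by exists (absz k); move: kpos; lia.
by rewrite abszN absz_nat -exprz_inv normrX normfV.
Qed.

Lemma norm_expz_le k : `|l ^ k| <= `|l| ^+ absz k.
Proof.
case: k => n; first by rewrite normrX.
rewrite NegzE abszN absz_nat -exprz_inv normrX normfV.
apply: (@le_trans _ _ 1); first by rewrite exprn_ile1// ?invf_le1// ltW.
by rewrite exprn_ege1// ltW.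
Qed.

Lemma norm_expVz_le k : `|l^-1 ^ k| <= `|l| ^+ absz k.
Proof. by rewrite exprz_inv -abszN norm_expz_le. Qed.

Let tail (eps : R) K n : set T :=
  [set x | near_cut (2 * eps * q ^+ (K + n)) (K + n)%N x] `|`
  [set x | near_cut (2 * eps * q ^+ (K + n)) (- (K + n)%N%:Z) x].

Lemma tail_le eps K : 0 < eps -> let W := \bigcup_n tail eps K n in
  measurable W /\ fine (P W) <= 8 * eps * q ^+ K / (1 - q).
Proof.
move=> eps0 /=.
have mt n : measurable (tail eps K n).
  by apply: measurableU; exact: measurable_near_cut.
split; first exact: bigcupT_measurable.
apply: fine_measure_bigcup_le => // n.
apply: (@le_trans _ _ (\sum_(i < n) 8 * eps * q ^+ K * q ^+ i)).
  apply: ler_sum => i _.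
  apply: le_trans (fine_measureU_le _ (measurable_near_cut _ _) (measurable_near_cut _ _)) _.
  have e0 : 0 <= 2 * eps * q ^+ (K + i).
    by rewrite !mulr_ge0 ?exprn_ge0// ltW.
  apply: le_trans (lerD (near_cut_le _ e0) (near_cut_le _ e0)) _.
  by rewrite exprD le_eqVlt; apply/orP; left; apply/eqP; ring.
rewrite -mulr_sumr ler_wpM2l ?geometric_sum_le ?q1 ?ltW//.
by rewrite !mulr_gt0 ?exprn_gt0.
Qed.

(** Order of choices: [K] depends on [e] alone and makes late approaches to the cut cost a small
    multiple of [eps]; then [eps] is taken small against the constants of the window, where two
    approaches cost [O(eps ^+ 2)]. *)
Lemma exceptional_set (e : R) : 0 < e -> exists2 eps0 : R, 0 < eps0 &
  forall eps, 0 < eps <= eps0 -> exists X : set T,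
  [/\ measurable X, fine (P X) <= e * eps & forall x, ~ X x ->
   let Gs y := forall k : int, (0 < k) = true -> uncut l^-1 eps k y in
   let Gu y := forall k : int, (0 < k) = false -> uncut l eps k y in
   let s := translate (evec l^-1 eps) in let u := translate (evec l eps) in
   (Gs x \/ [/\ Gu x, Gs (u x) & Gu (s x)]) /\
   (Gu x \/ [/\ Gs x, Gu (s x) & Gs (u x)])].
Proof.
move=> e0.
(* [24 = 3 * 8]: the bound of [tail_le] is paid for [x] and for its two translates, and uses up half
   of [e]. *)
have [K hK] : exists K, 24 * q ^+ K / (1 - q) <= e / 2.
  have q1' : 0 < 1 - q by rewrite subr_gt0.
  have := @cvg_geometric R 24 q; rewrite ger0_norm ?ltW// => /(_ q1).
  move=> /cvgrPdist_le /(_ (e / 2 * (1 - q))).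
  rewrite mulr_gt0 ?divr_gt0// => /(_ isT)[K _ /(_ K (leqnn K))].
  rewrite /geometric /= sub0r normrN => h; exists K.
  by rewrite ler_pdivrMr// (le_trans (ler_norm _)).
pose ks := [seq p <- [seq (i%:Z - K%:Z, j%:Z - K%:Z) | i <- iota 0 (2 * K).+2,
  j <- iota 0 (2 * K).+2] | p.1 != p.2].
have [|C C0 hC] := @near_cut_pairs_le ks.
  by move=> p; rewrite mem_filter => /andP[].
pose L := `|l| ^+ K.
have L1 : 1 <= L by rewrite exprn_ege1// ltW.
have L0 : 0 < L by exact: lt_le_trans L1.
(* From [eps * D <= e], three copies of [C * eta ^+ 2] with [eta = 2 * eps * L] cost at most
   [e * eps / 2], the other half. *)
pose D := 24 * (C + 1) * L ^+ 2.
have D0 : 0 < D by rewrite !mulr_gt0 ?exprn_gt0 ?ltr_wpDl.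
exists (Num.min (e / D) (8 * L)^-1).
  by rewrite lt_min divr_gt0// invr_gt0 mulr_gt0.
move=> eps; rewrite le_min => /andP[eps0 /andP[]].
rewrite ler_pdivlMr// => epsD; rewrite -[X in _ <= X]div1r ler_pdivlMr ?mulr_gt0// => epsL.
pose eta := 2 * eps * L.
have eta0 : 0 < eta by rewrite !mulr_gt0.
have eta4 : eta <= 4^-1 by rewrite /eta; lra.
have [|mZ hZ] := hC eta; first by apply/andP; split; lra.
have [mW hW] := tail_le K eps0.
pose B := [set x | exists2 p, p \in ks & near_cut eta p.1 x /\ near_cut eta p.2 x] `|`
  \bigcup_n tail eps K n.
have mB : measurable B by exact: measurableU.
have hB : fine (P B) <= C * eta ^+ 2 + 8 * eps * q ^+ K / (1 - q).
  by apply: le_trans (fine_measureU_le _ mZ mW) _; exact: lerD.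
have Bgood x : ~ B x -> good q eps eta K x.
  move=> nB; split.
    move=> i j ij iK jK ni nj; apply: nB; left; exists (i, j) => //.
    rewrite mem_filter ij andTb; apply/allpairsP.
    have [i' i'K ->] := int_iota_absz iK; have [j' j'K ->] := int_iota_absz jK.
    by exists (i', j').
  move=> k kK nk; apply: nB; right; exists (absz k - K)%N => //.
  rewrite /tail subnKC//; case: (ltP k 0) => k0; [right|left]; rewrite /=.
    by rewrite ltz0_abs// opprK.
  by rewrite gez0_abs.
have mtr v : measurable (translate v @^-1` B).
  by rewrite -[X in measurable X]setTI; exact: measurable_translate.
have Ptr v : P (translate v @^-1` B) = P B.
  by have [_ ->] := measure_preserving_translate v.
exists (B `|` (translate (evec l^-1 eps) @^-1` B `|` translate (evec l eps) @^-1` B)).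
have mBs := mtr (evec l^-1 eps); have mBu := mtr (evec l eps).
split.
- by apply: measurableU => //; exact: measurableU.
- apply: le_trans (fine_measureU_le _ mB (measurableU _ _ mBs mBu)) _.
  apply: le_trans (lerD (lexx _) (fine_measureU_le _ mBs mBu)) _.
  rewrite !Ptr; apply: le_trans (lerD hB (lerD hB hB)) _.
  have h1 : eps * (24 * q ^+ K / (1 - q)) <= eps * (e / 2) by rewrite ler_pM2l.
  have h2 : eps * (eps * (24 * C * L ^+ 2)) <= eps * e.
    rewrite ler_pM2l//; apply: le_trans epsD; rewrite ler_pM2l// /D.
    by apply: ler_wpM2r; [rewrite exprn_ge0// ltW|rewrite ler_pM2l// lerDl].
  have -> : C * eta ^+ 2 = eps * (eps * (24 * C * L ^+ 2)) / 6.
    by rewrite /eta; field.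
  have -> : 8 * eps * q ^+ K / (1 - q) = eps * (24 * q ^+ K / (1 - q)) / 3.
    by field; rewrite subr_eq0 eq_sym lt_eqF.
  move: h1 h2; set b := eps * (24 * q ^+ K / (1 - q)).
  by set a := eps * (eps * (24 * C * L ^+ 2)); clearbody a b => h1 h2; lra.
- move=> x nX Gs Gu s u.
  have gx : good q eps eta K x by apply: Bgood => h; apply: nX; left.
  have gs : good q eps eta K (s x) by apply: Bgood => h; apply: nX; right; left.
  have gu : good q eps eta K (u x) by apply: Bgood => h; apply: nX; right; right.
  have es := eigenvalueV el.
  have ss := stable_contracting; have su := stable_expanding.
  have amp (a : R) : (forall k : int, `|a ^ k| <= `|l| ^+ absz k) ->
      forall k : int, (absz k < K)%N -> `|eps * a ^ k| < eta.
    move=> ha k kK; rewrite normrM gtr0_norm//.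
    apply: (@le_lt_trans _ _ (eps * L)).
      rewrite ler_pM2l// (le_trans (ha k))// ler_eXn2l// ltnW//.
    by rewrite /eta -mulrA ltr_pMl ?mulr_gt0// ltr1n.
  have ampu := amp l norm_expz_le; have amps := amp l^-1 norm_expVz_le.
  split.
    have [//|/existsNP[j /not_implyP[jpos cut]]] := pselect (Gs x); first by left.
    right; have lV : l = l^-1^-1 by rewrite invrK.
    have [h1 h2 h3] := detour q0 q1 eps0 eta4 es el lV ss su amps ampu gx gs gu jpos cut.
    by split => k kpos; [exact: h1|exact: h2|exact: h3].
  have [//|/existsNP[j /not_implyP[jpos cut]]] := pselect (Gu x); first by left.
  right.
  have [h1 h2 h3] := detour q0 q1 eps0 eta4 el es erefl su ss ampu amps gx gu gs jpos cut.
  by split => k kpos; [exact: h1|exact: h2|exact: h3].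
Qed.

End near_measure.

(** * Mixing *)

(** If convergence fails, the bad indices meet every neighbourhood of infinity, and an ultrafilter
    containing both contradicts the hypothesis. *)
Lemma cvg_ultra (R : realType) (u : nat -> R) (c : R) :
  (forall U : set_system nat, UltraFilter U -> \oo `<=` U -> u n @[n --> U] --> c) ->
  u n @[n --> \oo] --> c.
Proof.
move=> h; apply/cvgrPdist_le => e e0; apply: contrapT => nB.
pose B := [set n | `|c - u n| <= e].
have Gp : ProperFilter (within (~` B) \oo).
  split; last exact: within_filter.
  rewrite /within /=; apply: contra_not nB; apply: filterS => n /=.
  by move=> nBn; apply: contrapT => /nBn.
have [U [UF GU]] := ultraFilterLemma Gp.
have U1 : \oo `<=` U by move=> A A1; apply: GU; rewrite /within /=; apply: filterS A1.
have UnB : U (~` B) by apply: GU; rewrite /within /=; exact: nearW.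
have := h U UF U1; move=> /cvgrPdist_le/(_ e e0) UB.
have [n [/= Bn nBn]] : (B `&` ~` B) !=set0.
  by apply: (@filter_ex _ U); exact: (@filterI _ U).
exact: nBn.
Qed.

Section weak_invariance.
Variable R : realType.
Notation T := (torus R).
Notation P := (leb_torus R).
Variable U : set_system nat.
Hypothesis UF : UltraFilter U.
Variables (h : nat -> T -> R) (k : T -> R) (G : set T) (v : R * R).
Hypotheses (h01 : forall n, unit_fun (h n)) (k01 : unit_fun k).
Hypothesis hk : forall f : T -> R, unit_fun f ->
  (\int[P]_x (f x * h n x)) @[n --> U] --> \int[P]_x (f x * k x).
Hypothesis mG : measurable G.

Lemma Pintegral_translate_mul (f g : T -> R) : bmf f -> bmf g ->
  \int[P]_x (f x * g (translate v x)) = \int[P]_x (f (translate (- v) x) * g x).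
Proof.
move=> bf bg.
rewrite -(Pintegral_translate v (bmfM (bmf_translate (- v) bf) bg)).
by apply: eq_Rintegral => x _; rewrite translateK.
Qed.

(** The absolute value is not weakly continuous, but signed differences over any [E] inside [G] pass
    to the limit; the parts of [G] where the limiting difference is nonnegative and negative then
    recover the absolute value. *)
Lemma weak_invariance :
  (\int[P]_x (\1_G x * `|h n (translate v x) - h n x|)) @[n --> U] --> 0 ->
  \int[P]_x (\1_G x * `|k (translate v x) - k x|) = 0.
Proof.
move=> hG.
have bh n : bmf (h n) by exact: unit_fun_bmf.
have bk : bmf k by exact: unit_fun_bmf.
have main E : measurable E -> E `<=` G ->
    \int[P]_x (\1_E x * (k (translate v x) - k x)) = 0.
  move=> mE EG; have bE : bmf (\1_E : T -> R) by exact: bmf_indic.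
  have expand g : bmf g -> \int[P]_x (\1_E x * (g (translate v x) - g x)) =
      \int[P]_x ((\1_E (translate (- v) x) : R) * g x) - \int[P]_x (\1_E x * g x).
    move=> bg; rewrite -Pintegral_translate_mul// -PintegralB.
    - by apply: eq_Rintegral => x _; rewrite mulrBr.
    - by apply: bmfM => //; exact: bmf_translate.
    - exact: bmfM.
  have c1 : (\int[P]_x (\1_E x * (h n (translate v x) - h n x))) @[n --> U] -->
      \int[P]_x (\1_E x * (k (translate v x) - k x)).
    rewrite (_ : (fun n => _) = fun n =>
      \int[P]_x ((\1_E (translate (- v) x) : R) * h n x) - \int[P]_x (\1_E x * h n x)).
      rewrite expand//; apply: cvgB; apply: hk; last exact: unit_fun_indic.
      by apply: unit_fun_comp; [exact: measurable_translate|exact: unit_fun_indic].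
    by apply/funext => n; exact: expand.
  have c2 : (\int[P]_x (\1_E x * (h n (translate v x) - h n x))) @[n --> U] --> 0.
    apply/cvgr0Pnorm_le => e e0; move/cvgr0Pnorm_le : hG => /(_ e e0).
    apply: filterS => n; apply: le_trans.
    have bd : bmf (fun x => h n (translate v x) - h n x).
      by apply: bmfB => //; exact: bmf_translate.
    apply: le_trans (le_norm_Pintegral P (bmfM bE bd)) _.
    rewrite ger0_norm; last by apply: Rintegral_ge0 => x _; rewrite mulr_ge0.
    apply: le_Pintegral => [||x].
    - exact: bmf_norm (bmfM bE bd).
    - by apply: bmfM; [exact: bmf_indic|exact: bmf_norm].
    - rewrite normrM ler_wpM2r// ger0_norm// !indicE ler_nat.
      by case: (boolP (x \in E)) => //; rewrite !inE => /EG Gx; rewrite mem_set.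
  exact: cvg_unique c1 c2.
pose dk x := k (translate v x) - k x.
have bd : bmf dk by apply: bmfB => //; exact: bmf_translate.
pose E1 := G `&` dk @^-1` `[0, +oo[.
pose E2 := G `&` dk @^-1` `]-oo, 0[.
have mE1 : measurable E1.
  by apply: measurableI => //; rewrite -[X in measurable X]setTI; apply: bd.1.
have mE2 : measurable E2.
  by apply: measurableI => //; rewrite -[X in measurable X]setTI; apply: bd.1.
transitivity (\int[P]_x (\1_E1 x * dk x) - \int[P]_x (\1_E2 x * dk x)).
  rewrite -PintegralB; [|by apply: bmfM => //; exact: bmf_indic..].
  apply: eq_Rintegral => x _; rewrite -/(dk x) !indicE.
  have [Gx|nGx] := boolP (x \in G); last first.
    rewrite !memNset ?mul0r ?subrr//.
    - by move=> [/mem_set]; rewrite (negbTE nGx).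
    - by move=> [/mem_set]; rewrite (negbTE nGx).
  rewrite inE in Gx; rewrite mul1r; have [dx|dx] := leP 0 (dk x).
    rewrite (mem_set (A := E1)); last by split => //=; rewrite in_itv/= andbT.
    rewrite memNset ?mul1r ?mul0r ?subr0 ?ger0_norm//.
    by move=> [_] /=; rewrite in_itv/= ltNge dx.
  rewrite (mem_set (A := E2)); last by split => //=; rewrite in_itv.
  rewrite memNset ?mul1r ?mul0r ?sub0r ?ltr0_norm//.
  by move=> [_] /=; rewrite in_itv/= leNgt dx.
by rewrite !main ?subrr// => x [].
Qed.

End weak_invariance.

Section oscillation.
Variable R : realType.
Notation T := (torus R).
Notation P := (leb_torus R).
Implicit Types (f g : T -> R) (v w : R * R).

Lemma osc0 f : osc f 0 = 0.
Proof.
rewrite /osc; under eq_Rintegral do rewrite translate0 subrr normr0.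
exact: Pintegral_cst.
Qed.

Lemma oscN f v : bmf f -> osc f (- v) = osc f v.
Proof.
move=> bf; rewrite /osc -(Pintegral_translate v (bmf_osc (- v) bf)).
by apply: eq_Rintegral => x _; rewrite translateK distrC.
Qed.

Lemma oscD f v w : bmf f -> osc f (v + w) <= osc f v + osc f w.
Proof.
move=> bf; rewrite /osc -(Pintegral_translate w (bmf_osc v bf)).
rewrite -PintegralD; [|exact: (bmf_translate w (bmf_osc v bf))|exact: bmf_osc].
apply: le_Pintegral; first exact: bmf_osc.
  by apply: bmfD; [exact: (bmf_translate w (bmf_osc v bf))|exact: bmf_osc].
move=> x; rewrite translateD.
by rewrite -[X in `|X| <= _](subrKA (f (translate w x))); exact: ler_normD.
Qed.

(** A displacement [r] is made of [n] displacements [r / n], so by subadditivity its oscillation is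
    at most [n * (e / r) * (r / n) = e]. *)
Lemma osc_evec_eq0 f a : bmf f ->
  (forall e : R, 0 < e -> exists2 eps0 : R, 0 < eps0 &
    forall eps, 0 < eps <= eps0 -> osc f (evec a eps) <= e * eps) ->
  forall r, osc f (evec a r) = 0.
Proof.
move=> bf h.
have evecD r s : evec a (r + s) = evec a r + evec a s.
  by rewrite /evec; congr pair => /=; ring.
have mult n r : osc f (evec a (n%:R * r)) <= n%:R * osc f (evec a r).
  elim: n => [|n IH]; first by rewrite !mul0r /evec mulr0 osc0.
  rewrite -natr1 !mulrDl !mul1r evecD; apply: le_trans (oscD _ _ bf) _.
  by rewrite lerD2r.
have pos r : 0 < r -> osc f (evec a r) = 0.
  move=> r0; apply/eqP; rewrite eq_le osc_ge0 andbT; apply/ler_addgt0Pl => e e0.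
  rewrite addr0; have [|eps0 eps00 he] := h (e / r); first by rewrite divr_gt0.
  pose n := (Num.truncn (r / eps0)).+1.
  have n0 : 0 < n%:R :> R by rewrite ltr0n.
  have -> : r = n%:R * (r / n%:R) by rewrite mulrC divfK// gt_eqF.
  apply: le_trans (mult _ _) _.
  have : osc f (evec a (r / n%:R)) <= e / r * (r / n%:R).
    apply: he; rewrite divr_gt0//= ler_pdivrMr// mulrC -ler_pdivrMr//.
    by rewrite ltW// truncnS_gt.
  rewrite -(ler_pM2l n0) => /le_trans; apply.
  by rewrite le_eqVlt; apply/orP; left; apply/eqP; field; rewrite !gt_eqF.
move=> r; have [r0|r0|->] := ltgtP r 0.
- have -> : evec a r = - evec a (- r) by rewrite /evec; congr pair => /=; ring.
  by rewrite oscN// pos// oppr_gt0.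
- exact: pos.
- by rewrite /evec mulr0 osc0.
Qed.

(** [f x * g (x + y)] is integrated over both variables. Integrating over [y] first gives the
    product of the integrals; integrating over [x] first gives the integral of [f * g] for every
    [y], by invariance of [g]. *)
Lemma osc_eq0_mul f g : unit_fun f -> unit_fun g -> (forall v, osc g v = 0) ->
  \int[P]_x (f x * g x) = \int[P]_x f x * \int[P]_x g x.
Proof.
move=> f01 g01 g0; have bf := unit_fun_bmf f01; have bg := unit_fun_bmf g01.
pose V (x : T) : R * R := (rep x.1, rep x.2).
have VE x y : translate (V y) x = (x.1 + y.1, x.2 + y.2) :> T.
  by rewrite /translate /= !toCircle_rep.
have mS : measurable_fun setT (fun z : T * T => translate (V z.2) z.1).
  rewrite (_ : (fun z => _) = fun z : T * T => (z.1.1 + z.2.1, z.1.2 + z.2.2) : T).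
    apply: measurable_fun_pair; apply: measurable_circleD.
    - exact: (measurableT_comp measurable_fst measurable_fst).
    - exact: (measurableT_comp measurable_fst measurable_snd).
    - exact: (measurableT_comp measurable_snd measurable_fst).
    - exact: (measurableT_comp measurable_snd measurable_snd).
  by apply/funext => z; rewrite VE.
pose H (z : T * T) := f z.1 * g (translate (V z.2) z.1).
have bH : bmf H.
  apply: bmfM; first exact: (bmf_comp bf measurable_fst).
  exact: (bmf_comp bg mS).
have fin := probability_setT_lty P.
have := bmf_Fubini fin measurableT fin bH.
have -> : \int[P]_x \int[P]_y H (x, y) = \int[P]_x f x * \int[P]_x g x.
  transitivity (\int[P]_x (\int[P]_y g y * f x)); last first.
    by rewrite PintegralZ// mulrC.
  apply: eq_Rintegral => x _; rewrite /H /=.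
  rewrite PintegralZ; last first.
    by apply: (bmf_comp bg); exact: (measurableT_comp mS (pair1_measurable x)).
  rewrite mulrC; congr (_ * _).
  rewrite -[RHS](Pintegral_translate (V x) bg); apply: eq_Rintegral => y _.
  by rewrite !VE; congr (g (_, _)); rewrite addrC.
have -> : \int[P]_y \int[P]_x H (x, y) = \int[P]_x (f x * g x).
  rewrite -[RHS](Pintegral_cst P); apply: eq_Rintegral => y _; rewrite /H /=.
  apply/eqP; rewrite -subr_eq0 -normr_le0 -PintegralB; last 2 first.
  - by apply: bmfM => //; exact: bmf_translate.
  - exact: bmfM.
  - rewrite -(g0 (V y)) /osc; apply: le_trans (le_norm_Pintegral _ _) _.
      by apply: bmfB; apply: bmfM => //; exact: bmf_translate.
    apply: le_Pintegral => [||x].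
    + apply: bmf_norm; apply: bmfB; apply: bmfM => //; exact: bmf_translate.
    + exact: bmf_osc.
    + rewrite -mulrBr normrM -[leRHS]mul1r ler_wpM2r//.
      by have /andP[? ?] := f01.2 x; rewrite ger0_norm.
by [].
Qed.

End oscillation.

Section orbit_oscillation.
Variables (R : realType) (Delta : R).
Notation T := (torus R).
Notation P := (leb_torus R).
Notation iterz := (iterz Delta).
Implicit Types (f g : T -> R).

Lemma orbit_osc f a r (k : int) (G : set T) : unit_fun f -> measurable G ->
  (forall x, G x -> shadow Delta a r k x (translate (evec a r) x)) ->
  \int[P]_x (\1_G x * `|f (iterz k (translate (evec a r) x)) - f (iterz k x)|) <=
  osc f (evec a (r * a ^ k)).
Proof.
move=> f01 mG hG; have bf := unit_fun_bmf f01.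
rewrite /osc -(Rintegral_measure_preserving (measure_preserving_iterz Delta k)
  (bmf_osc (evec a (r * a ^ k)) bf)).
have bk : bmf (fun x => f (iterz k x)) by exact: (bmf_comp bf (measurable_iterz Delta k)).
apply: le_Pintegral => [||x].
- apply: bmfM; first exact: bmf_indic.
  exact: (bmf_osc (evec a r) bk).
- exact: (bmf_comp (bmf_osc (evec a (r * a ^ k)) bf) (measurable_iterz Delta k)).
- rewrite indicE; have [xG|_] := boolP (x \in G); last by rewrite mul0r.
  by rewrite mul1r hG// -inE.
Qed.

(** For a merely measurable [f], continuity of translations in [L^1] takes the place of uniform
    continuity in the Hopf argument. *)
Lemma osc_evec_small f b a r : unit_fun f -> `|a| < 1 -> forall e : R, 0 < e ->
  exists N : nat, forall n, (N <= n)%N -> osc f (evec b (r * a ^+ n)) <= e.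
Proof.
move=> f01 a1 e e0; have [d d0 hd] := translation_continuous_unit f01 e0.
have := @cvg_geometric R r a a1.
have [c c0 cE] : exists2 c : R, 0 < c & 1 <= c /\ `|1 - b| <= c.
  by exists (1 + `|1 - b|); rewrite ?ltr_pwDl// lerDl lerDr.
move=> /cvgrPdist_le /(_ (d / c)); rewrite divr_gt0// => /(_ isT)[N _ hN].
exists N => n /hN; rewrite /geometric /= sub0r normrN ler_pdivlMr// => rn.
apply: hd; rewrite /evec /=.
  by apply: le_trans rn; rewrite ler_peMr// cE.1.
by rewrite normrM; apply: le_trans rn; rewrite mulrC ler_wpM2l// cE.2.
Qed.

End orbit_oscillation.

Section mixing.
Variables (R : realType) (Delta l : R).
Hypotheses (el : eigenvalue Delta l) (l1 : 1 < `|l|).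
Notation T := (torus R).
Notation P := (leb_torus R).
Notation F := (Ftilde Delta).
Notation iterz := (iterz Delta).
Notation uncut := (uncut Delta).
Implicit Types (f g : T -> R).

Lemma measurable_uncut a r (k : int) : measurable [set x | uncut a r k x].
Proof.
rewrite (_ : [set x | _] = tau Delta k @^-1` `[- (r * a ^ k), 1 - r * a ^ k[).
  by rewrite -[X in measurable X]setTI; exact: measurable_tau.
apply/seteqP; split => x; rewrite /uncut /= in_itv/= => /andP[h1 h2];
  by apply/andP; split; lra.
Qed.

Let Gs (eps : R) := [set x | forall k : int, (0 < k) = true -> uncut l^-1 eps k x].
Let Gu (eps : R) := [set x | forall k : int, (0 < k) = false -> uncut l eps k x].

Let mGs eps : measurable (Gs eps).
Proof.
rewrite (_ : Gs eps = \bigcap_(n : nat) [set x | uncut l^-1 eps n.+1%:Z x]).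
  by apply: bigcapT_measurable => n; exact: measurable_uncut.
apply/seteqP; split => x h; first by move=> n _; exact: h.
by move=> [[|k]|k] // _; exact: h.
Qed.

Let mGu eps : measurable (Gu eps).
Proof.
rewrite (_ : Gu eps = \bigcap_(n : nat) [set x | uncut l eps (- n%:Z) x]).
  by apply: bigcapT_measurable => n; exact: measurable_uncut.
apply/seteqP; split => x h; first by move=> n _; apply: h; rewrite oppr_gt0 ltNge.
move=> k; have [//|k0 _] := ltP 0 k.
have -> : k = - (absz k)%:Z by rewrite lez0_abs// opprK.
exact: h.
Qed.

Let es := eigenvalueV el.

Let lV1 : `|l^-1| < 1.
Proof. by rewrite normfV invf_lt1// (lt_trans ltr01). Qed.

Let shadow_Gs eps x (n : nat) : Gs eps x ->
  shadow Delta l^-1 eps n x (translate (evec l^-1 eps) x).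
Proof. by move=> h; apply: shadow_fwd => // k /andP[k0 _]; exact: h. Qed.

Let shadow_Gu eps x (n : nat) : Gu eps x ->
  shadow Delta l eps (- n%:Z) x (translate (evec l eps) x).
Proof. by move=> h; apply: shadow_bwd => // k _; apply: h; rewrite oppr_gt0 ltNge. Qed.

(** The hypotheses concern uncut points only; where a side is cut, the difference is rewritten along
    the other three sides, whose integrals vanish as well. *)
Let osc_small g : unit_fun g -> (forall eps, 0 < eps ->
    \int[P]_x (\1_(Gs eps) x * `|g (translate (evec l^-1 eps) x) - g x|) = 0) ->
  (forall eps, 0 < eps ->
    \int[P]_x (\1_(Gu eps) x * `|g (translate (evec l eps) x) - g x|) = 0) ->
  forall v, osc g v = 0.
Proof.
move=> g01 gs gu; have bg := unit_fun_bmf g01.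
pose s (eps : R) := translate (evec l^-1 eps) : T -> T.
pose u (eps : R) := translate (evec l eps) : T -> T.
pose A eps x := \1_(Gs eps) x * `|g (s eps x) - g x|.
pose B eps x := \1_(Gu eps) x * `|g (u eps x) - g x|.
have bA eps : bmf (A eps) by apply: bmfM; [exact: bmf_indic|exact: bmf_osc].
have bB eps : bmf (B eps) by apply: bmfM; [exact: bmf_indic|exact: bmf_osc].
have A0 eps x : 0 <= A eps x by rewrite mulr_ge0.
have B0 eps x : 0 <= B eps x by rewrite mulr_ge0.
have AE eps x : Gs eps x -> A eps x = `|g (s eps x) - g x|.
  by move=> Gx; rewrite /A indicE mem_set// mul1r.
have BE eps x : Gu eps x -> B eps x = `|g (u eps x) - g x|.
  by move=> Gx; rewrite /B indicE mem_set// mul1r.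
have IA eps v : 0 < eps -> \int[P]_x A eps (translate v x) = 0.
  by move=> e0; rewrite Pintegral_translate// gs.
have IB eps v : 0 < eps -> \int[P]_x B eps (translate v x) = 0.
  by move=> e0; rewrite Pintegral_translate// gu.
have g1 x y : `|g x - g y| <= 1.
  have /andP[? ?] := g01.2 x; have /andP[? ?] := g01.2 y.
  by rewrite ler_norml; apply/andP; split; lra.
have small (e : R) : 0 < e -> exists2 eps0 : R, 0 < eps0 &
    forall eps, 0 < eps <= eps0 ->
    osc g (evec l^-1 eps) <= e * eps /\ osc g (evec l eps) <= e * eps.
  move=> e0; have [eps0 eps00 h] := exceptional_set el l1 e0.
  exists eps0 => // eps /[dup] /andP[e_0 _] /h[X [mX PX hX]].
  have bX : bmf (\1_X : T -> R) by exact: bmf_indic.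
  (* One majorant for both directions: the exceptional set, the two sides at [x], and the two sides
     opposite to them. All terms but the first have integral 0. *)
  pose major x := \1_X x + (A eps x + (B eps x +
    ((A eps (u eps x) + B eps (s eps x))))).
  have b4 : bmf (fun x => A eps (u eps x) + B eps (s eps x)).
    by apply: bmfD; exact: bmf_translate.
  have b3 : bmf (fun x => B eps x + (A eps (u eps x) + B eps (s eps x))) by exact: bmfD.
  have b2 : bmf (fun x => A eps x + (B eps x + (A eps (u eps x) + B eps (s eps x)))).
    exact: bmfD.
  have bM : bmf major by exact: bmfD.
  have IM : \int[P]_x major x <= e * eps.
    rewrite PintegralD// PintegralD// PintegralD// PintegralD; try exact: bmf_translate.
    rewrite Rintegral_indic// !IA// !IB// gs// gu//.
    by rewrite !addr0.
  have loop x : g (u eps (s eps x)) = g (s eps (u eps x)) by rewrite /u /s translateC.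
  have majs x : `|g (s eps x) - g x| <= major x.
    have [Xx|/hX /=] := pselect (X x).
      rewrite (le_trans (g1 _ _))// /major indicE mem_set// lerDl.
      by rewrite !addr_ge0.
    move=> [[Gx|[Gux Gsx Gusx]] _].
      rewrite /major -AE// addrCA lerDl !addr_ge0//.
    rewrite /major (BE _ x)// (AE _ (u eps x))// (BE _ (s eps x))//.
    apply: (@le_trans _ _ (`|g (u eps x) - g x| +
        (`|g (s eps (u eps x)) - g (u eps x)| + `|g (u eps (s eps x)) - g (s eps x)|))).
      have -> : g (s eps x) - g x = (g (u eps x) - g x) +
          ((g (s eps (u eps x)) - g (u eps x)) - (g (u eps (s eps x)) - g (s eps x))).
        by rewrite loop; ring.
      by rewrite (le_trans (ler_normD _ _))// lerD2l ler_normB.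
    by rewrite [leRHS]addrA lerDr addr_ge0.
  have maju x : `|g (u eps x) - g x| <= major x.
    have [Xx|/hX /=] := pselect (X x).
      rewrite (le_trans (g1 _ _))// /major indicE mem_set// lerDl.
      by rewrite !addr_ge0.
    move=> [_ [Gx|[Gsx Gusx Gsux]]].
      rewrite /major -BE// addrA addrCA lerDl !addr_ge0//.
    rewrite /major (AE _ x)// (AE _ (u eps x))// (BE _ (s eps x))//.
    apply: (@le_trans _ _ (`|g (s eps x) - g x| +
        (`|g (s eps (u eps x)) - g (u eps x)| + `|g (u eps (s eps x)) - g (s eps x)|))).
      have -> : g (u eps x) - g x = (g (s eps x) - g x) +
          ((g (u eps (s eps x)) - g (s eps x)) - (g (s eps (u eps x)) - g (u eps x))).
        by rewrite loop; ring.
      by rewrite (le_trans (ler_normD _ _))// lerD2l [leRHS]addrC ler_normB.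
    by rewrite [leRHS]addrCA lerD2l [leRHS]addrA lerDr addr_ge0.
  by split; apply: le_trans IM; apply: le_Pintegral => //; exact: bmf_osc.
have s0 : forall r, osc g (evec l^-1 r) = 0.
  apply: osc_evec_eq0 => // e /small[eps0 eps00 h].
  by exists eps0 => // eps /h[].
have u0 : forall r, osc g (evec l r) = 0.
  apply: osc_evec_eq0 => // e /small[eps0 eps00 h].
  by exists eps0 => // eps /h[].
move=> v; apply/eqP; rewrite eq_le osc_ge0 andbT.
have dl : l - l^-1 != 0.
  rewrite subr_eq0; apply/eqP => h.
  by move: (lt_trans lV1 l1); rewrite -h ltxx.
pose r := ((1 - l^-1) * v.1 - v.2) / (l - l^-1).
have -> : v = evec l r + evec l^-1 (v.1 - r).
  case: v @r => v1 v2 /=; rewrite /evec; congr pair => /=; first by ring.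
  have : ((1 - l^-1) * v1 - v2) / (l - l^-1) * (l - l^-1) = (1 - l^-1) * v1 - v2.
    by rewrite divfK.
  set r := _ / _ => e.
  transitivity ((1 - l^-1) * v1 - r * (l - l^-1)); first by rewrite e; ring.
  by ring.
by apply: le_trans (oscD _ _ bg) _; rewrite u0 s0 addr0.
Qed.

Lemma mixing_unit f g : unit_fun f -> unit_fun g ->
  (\int[P]_x (g x * f (iter n F x))) @[n --> \oo] -->
  \int[P]_x g x * \int[P]_x f x.
Proof.
move=> f01 g01; apply: cvg_ultra => U UF Uoo.
have bf := unit_fun_bmf f01.
have it01 (h : T -> R) (k : int) : unit_fun h -> unit_fun (fun x => h (iterz k x)).
  by move=> h01; apply: unit_fun_comp h01; exact: measurable_iterz.
(* [p] is a forward weak limit of [f]; the [k] below is a backward weak limit of [p]. *)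
have [p [p01 pE]] := weak_limit P UF (fun n => it01 f n%:Z f01).
have bp := unit_fun_bmf p01.
have [k [k01 kE]] := weak_limit P UF (fun n => it01 p (- n%:Z) p01).
have bk := unit_fun_bmf k01.
have pmE m h : unit_fun h ->
    (\int[P]_x (h x * f (iterz (n%:Z - m%:Z) x))) @[n --> U] -->
    \int[P]_x (h x * p (iterz (- m%:Z) x)).
  move=> h01; have bh := unit_fun_bmf h01.
  have e (w : T -> R) (j : int) : unit_fun w ->
      \int[P]_x (h x * w (iterz (j - m%:Z) x)) = \int[P]_x (h (iterz m x) * w (iterz j x)).
    move=> w01; have bw := unit_fun_bmf (it01 w (j - m%:Z) w01).
    rewrite -(Rintegral_measure_preserving (measure_preserving_iterz Delta m) (bmfM bh bw)).
    by apply: eq_Rintegral => x _; rewrite -iterz_add subrK.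
  have := pE (fun x => h (iterz m x)) (it01 h m h01).
  have -> : \int[P]_x (h (iterz m x) * p x) = \int[P]_x (h x * p (iterz (- m%:Z) x)).
    by have := e p 0 p01; rewrite sub0r => ->.
  by under [in X in X -> _]eq_cvg => n do rewrite -e//.
(* For fixed [m] the time [n - m] still tends to infinity and contracts stable displacements. Stable
   invariance thus holds exactly for every [m] and passes to [k]. *)
have pm_s m eps : 0 < eps -> \int[P]_x (\1_(Gs eps) x *
    `|p (iterz (- m%:Z) (translate (evec l^-1 eps) x)) - p (iterz (- m%:Z) x)|) = 0.
  move=> eps0; apply: (weak_invariance UF (fun n => it01 f (n%:Z - m%:Z) f01)
    (it01 p (- m%:Z) p01) (pmE m) (mGs eps)).
  apply/cvgr0Pnorm_le => e e0.
  have [N hN] := osc_evec_small l^-1 eps f01 lV1 e0.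
  apply: Uoo; exists (N + m)%N => // n /= Nn.
  have mn : (m <= n)%N by rewrite (leq_trans _ Nn)// leq_addl.
  rewrite ger0_norm; last by apply: Rintegral_ge0 => x _; rewrite mulr_ge0.
  rewrite subzn//; apply: le_trans (orbit_osc f01 (mGs eps) _) _.
    by move=> x Gx; exact: shadow_Gs.
  by apply: hN; rewrite leq_subRL// addnC.
have k_s eps : 0 < eps ->
    \int[P]_x (\1_(Gs eps) x * `|k (translate (evec l^-1 eps) x) - k x|) = 0.
  move=> eps0; apply: (weak_invariance UF (fun n => it01 p (- n%:Z) p01) k01 kE (mGs eps)).
  by under eq_cvg => n do rewrite pm_s//; exact: cvg_cst.
(* In backward time it is the unstable displacement that contracts. *)
have k_u eps : 0 < eps ->
    \int[P]_x (\1_(Gu eps) x * `|k (translate (evec l eps) x) - k x|) = 0.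
  move=> eps0; apply: (weak_invariance UF (fun n => it01 p (- n%:Z) p01) k01 kE (mGu eps)).
  apply/cvgr0Pnorm_le => e e0.
  have [N hN] := osc_evec_small l eps p01 lV1 e0.
  apply: Uoo; exists N => // n /= Nn.
  rewrite ger0_norm; last by apply: Rintegral_ge0 => x _; rewrite mulr_ge0.
  apply: le_trans (orbit_osc p01 (mGu eps) _) _.
    by move=> x Gx; exact: shadow_Gu.
  by rewrite -exprz_inv; exact: hN.
have k_const := osc_small k01 k_s k_u.
have one01 : unit_fun (fun _ : T => 1 : R) by split => // x; rewrite ler01 lexx.
pose c := \int[P]_x f x.
have pc : \int[P]_x p x = c.
  have := pE _ one01; rewrite (_ : (fun n => _) = fun=> c); last first.
    apply/funext => n; under eq_Rintegral do rewrite mul1r.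
    by rewrite (Rintegral_measure_preserving (measure_preserving_iterz Delta n)).
  under [in X in _ -> X]eq_Rintegral do rewrite -[p _]mul1r.
  by move=> h; exact: cvg_unique h (cvg_cst c).
have kc : \int[P]_x k x = c.
  have := kE _ one01; rewrite (_ : (fun n => _) = fun=> c); last first.
    apply/funext => n; under eq_Rintegral do rewrite mul1r.
    by rewrite (Rintegral_measure_preserving (measure_preserving_iterz Delta (- n%:Z))).
  under [in X in _ -> X]eq_Rintegral do rewrite -[k _]mul1r.
  by move=> h; exact: cvg_unique h (cvg_cst c).
(* Testing [p] against itself and moving the dynamics to the other factor leads to the integral of
   [f * k], which factorizes because [k] has no oscillation. Hence [p] has variance 0. *)
have pp : \int[P]_x (p x * p x) = c ^+ 2.
  have h1 := pE p p01.
  have h2 := kE f f01; rewrite osc_eq0_mul// kc -/c in h2.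
  have e : (fun n => \int[P]_x (p x * f (iterz n%:Z x))) =
      (fun n => \int[P]_x (f x * p (iterz (- n%:Z) x))).
    apply/funext => n; have bpn := unit_fun_bmf (it01 p (- n%:Z) p01).
    rewrite -[RHS](Rintegral_measure_preserving (measure_preserving_iterz Delta n)
      (bmfM bf bpn)).
    by apply: eq_Rintegral => x _; rewrite -iterz_add addNr mulrC.
  rewrite e in h1; rewrite expr2; exact: cvg_unique h1 h2.
have var0 : \int[P]_x ((p x - c) ^+ 2) = 0.
  transitivity (\int[P]_x (p x * p x - (2 * c * p x - c ^+ 2))).
    by apply: eq_Rintegral => x _; ring.
  rewrite PintegralB; [|exact: bmfM|by apply: bmfB; [exact: bmfZ|exact: bmf_cst]].
  rewrite PintegralB; [|exact: bmfZ|exact: bmf_cst].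
  by rewrite PintegralZ// Pintegral_cst pp pc; ring.
have bg := unit_fun_bmf g01.
have bpc : bmf (fun x => p x - c) by apply: bmfB => //; exact: bmf_cst.
have -> : \int[P]_x g x * c = \int[P]_x (g x * p x).
  apply/eqP; rewrite eq_sym -subr_eq0 -normr_le0; apply/ler_addgt0Pl => e e0.
  rewrite addr0 mulrC -PintegralZ// -PintegralB; [|exact: bmfM|exact: bmfZ].
  have -> : \int[P]_x (g x * p x - c * g x) = \int[P]_x (g x * (p x - c)).
    by apply: eq_Rintegral => x _; ring.
  apply: le_trans (le_norm_Pintegral _ (bmfM bg bpc)) _.
  have bsq : bmf (fun x => (p x - c) ^+ 2).
    by under [fun x => _]eq_fun do rewrite expr2; exact: bmfM.
  (* The inequality [|y| <= e + e^-1 * y ^+ 2] with [y = p x - c] brings in the vanishing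
     variance. *)
  rewrite -[leRHS]addr0 -[X in _ <= _ + X](mulr0 e^-1) -var0 -[X in X + _](Pintegral_cst P).
  rewrite -PintegralZ// -PintegralD//; [|exact: bmf_cst|exact: bmfZ].
  apply: le_Pintegral => [||x].
  - exact: bmf_norm (bmfM bg bpc).
  - by apply: bmfD; [exact: bmf_cst|exact: bmfZ].
  rewrite normrM (@le_trans _ _ `|p x - c|)//.
    rewrite -[leRHS]mul1r ler_wpM2r//.
    by have /andP[? ?] := g01.2 x; rewrite ger0_norm.
  rewrite -(ler_pM2l e0) mulrDr mulVKf ?gt_eqF// -[(p x - c) ^+ 2]real_normK ?num_real//.
  have := sqr_ge0 (`|p x - c| - e); have := normr_ge0 (p x - c).
  move: `|p x - c| => y y0; rewrite sqrrB => h; have := mulr_ge0 (ltW e0) y0.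
  by nra.
exact: pE.
Qed.

End mixing.

Section mixing_consequences.
Variables (R : realType) (Delta l : R).
Hypotheses (el : eigenvalue Delta l) (l1 : 1 < `|l|).
Notation T := (torus R).
Notation P := (leb_torus R).
Notation F := (Ftilde Delta).
Implicit Types (f g : T -> R).

Lemma bmf_unit_fun f : bmf f -> exists2 M : R, 0 < M & exists2 h : T -> R,
  unit_fun h & f = fun x => 2 * M * h x - M.
Proof.
move=> bf; have [M M0 fM] := bmf_bound bf; exists M => //.
exists (fun x => (2 * M)^-1 * (f x + M)).
  split.
    suff : bmf (fun x => (2 * M)^-1 * (f x + M)) by case.
    by apply: bmfZ; apply: bmfD => //; exact: bmf_cst.
  move=> x; have := fM x; rewrite ler_norml => /andP[h1 h2].
  have M2 : 0 < 2 * M by rewrite mulr_gt0.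
  rewrite mulrC ler_pdivlMr// mul0r ler_pdivrMr// mul1r.
  by apply/andP; split; lra.
apply/funext => x; rewrite mulVKf ?addrK// gt_eqF// mulr_gt0//.
Qed.

Lemma measurable_iterF n : measurable_fun setT (iter n F).
Proof. by have [] := measure_preserving_iter n (measure_preserving_F Delta). Qed.

Lemma bmf_iterF f n : bmf f -> bmf (fun x => f (iter n F x)).
Proof. by move=> bf; exact: (bmf_comp bf (measurable_iterF n)). Qed.

Lemma Pintegral_iterF f n : bmf f -> \int[P]_x f (iter n F x) = \int[P]_x f x.
Proof.
move=> bf; apply: Rintegral_measure_preserving => //.
exact: measure_preserving_iter (measure_preserving_F Delta).
Qed.

Lemma mixing_bmf f g : bmf f -> bmf g ->
  (\int[P]_x (g x * f (iter n F x))) @[n --> \oo] -->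
  \int[P]_x g x * \int[P]_x f x.
Proof.
move=> /bmf_unit_fun[M M0 [f' f01 fE]] /bmf_unit_fun[N N0 [g' g01 gE]].
have bf' := unit_fun_bmf f01; have bg' := unit_fun_bmf g01.
have e (w : T -> R) : bmf w -> \int[P]_x ((2 * N * g' x - N) * (2 * M * w x - M)) =
   4 * M * N * \int[P]_x (g' x * w x) -
   (2 * M * N * \int[P]_x g' x + 2 * M * N * \int[P]_x w x - M * N).
  move=> bw; have bgw : bmf (fun x => g' x * w x) by exact: bmfM.
  rewrite -[X in _ - (_ - X)](Pintegral_cst P) -!PintegralZ//.
  rewrite -PintegralD; [|exact: bmfZ..].
  rewrite -PintegralB; [|by apply: bmfD; exact: bmfZ|exact: bmf_cst].
  rewrite -PintegralB; [|exact: bmfZ|].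
    by apply: eq_Rintegral => x _; ring.
  by apply: bmfB; [apply: bmfD; exact: bmfZ|exact: bmf_cst].
have -> : (fun n => \int[P]_x (g x * f (iter n F x))) = fun n =>
    4 * M * N * \int[P]_x (g' x * f' (iter n F x)) -
   (2 * M * N * \int[P]_x g' x + 2 * M * N * \int[P]_x f' x - M * N).
  apply/funext => n; rewrite -(Pintegral_iterF n bf') -e; last exact: bmf_iterF.
  by rewrite fE gE.
have lin (w : T -> R) c : bmf w -> \int[P]_x (2 * c * w x - c) = 2 * c * \int[P]_x w x - c.
  by move=> bw; rewrite PintegralB ?PintegralZ ?Pintegral_cst//; [exact: bmfZ|exact: bmf_cst].
have -> : \int[P]_x g x * \int[P]_x f x = 4 * M * N * (\int[P]_x g' x * \int[P]_x f' x) -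
   (2 * M * N * \int[P]_x g' x + 2 * M * N * \int[P]_x f' x - M * N).
  by rewrite fE gE !lin//; ring.
apply: cvgB; last exact: cvg_cst.
by apply: cvgMl_tmp; exact: (mixing_unit el l1).
Qed.

Lemma sawtooth_mixing : mixing P F.
Proof.
split; first exact: measure_preserving_F.
move=> B C mB mC.
have mBC n : measurable (B `&` iter n F @^-1` C).
  apply: measurableI => //; rewrite -[X in measurable X]setTI.
  exact: measurable_iterF.
have -> : (fun n => P (B `&` iter n F @^-1` C)) =
    fun n => (\int[P]_x (\1_B x * \1_C (iter n F x)))%:E.
  apply/funext => n; rewrite -[LHS]fineK ?fin_num_measure//; congr EFin.
  rewrite -(Rintegral_indic P (mBC n)); apply: eq_Rintegral => x _.
  by rewrite indicI.
have -> : (P B * P C)%E = (\int[P]_x \1_B x * \int[P]_x \1_C x)%:E.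
  by rewrite !Rintegral_indic// EFinM !fineK ?fin_num_measure.
apply: cvg_EFin; first exact: nearW.
by apply: mixing_bmf; exact: bmf_indic.
Qed.

Lemma sawtooth_ergodic : ergodic P F.
Proof.
have [mpF mixF] := sawtooth_mixing; split=> // B mB FB.
have it n : iter n F @^-1` B = B.
  by elim: n => // n IH; rewrite -[RHS]IH -[in RHS]FB; apply/seteqP; split.
have := mixF B B mB mB.
have -> : (fun n => P (B `&` iter n F @^-1` B)) = fun=> P B.
  by apply/funext => n; rewrite it setIid.
move=> h; have e : P B = (P B * P B)%E by apply: cvg_unique (cvg_cst _) h.
have : fine (P B) = fine (P B) * fine (P B) by rewrite -fineM ?fin_num_measure// -e.
move/eqP; rewrite -subr_eq0 -{1}[fine (P B)]mulr1 -mulrBr mulf_eq0 subr_eq0.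
move=> /orP[/eqP h0|/eqP h1]; [left|right].
  by rewrite -[LHS]fineK ?fin_num_measure// h0.
by rewrite -[LHS]fineK ?fin_num_measure// -h1.
Qed.

End mixing_consequences.

(** * Integrals over segments *)

Section interval_integral.
Variable R : realType.
Notation mu := (@lebesgue_measure R).
Implicit Types (h g : R -> R) (a b c : R).

Definition itg h a b := \int[mu]_(t in `[a, b]) h t.

Lemma lebesgue_itv_cc a b : a <= b -> (mu `[a, b] = (b - a)%:E)%E.
Proof.
move=> ab; rewrite lebesgue_measure_itv/= lte_fin; case: ifPn => [_|].
  by rewrite -EFinB.
by rewrite -leNgt => ba; rewrite (@le_anti _ _ a b) ?subrr// ab ba.
Qed.

Lemma lebesgue_itv_lty a b : (mu `[a, b] < +oo)%E.
Proof.
have [ab|ba] := leP a b; first by rewrite lebesgue_itv_cc// ltry.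
rewrite (_ : mu _ = 0%E) ?ltry// lebesgue_measure_itv/= lte_fin.
by rewrite ltNge (ltW ba).
Qed.

Lemma itg_integrable h a b : bmf h -> mu.-integrable `[a, b] (EFin \o h).
Proof. by move=> bh; apply: bmf_integrable => //; exact: lebesgue_itv_lty. Qed.

Lemma itgD h g a b : bmf h -> bmf g ->
  itg (fun t => h t + g t) a b = itg h a b + itg g a b.
Proof. by move=> bh bg; apply: bRintegralD => //; exact: lebesgue_itv_lty. Qed.

Lemma itgB h g a b : bmf h -> bmf g ->
  itg (fun t => h t - g t) a b = itg h a b - itg g a b.
Proof. by move=> bh bg; apply: bRintegralB => //; exact: lebesgue_itv_lty. Qed.

Lemma itgZ c h a b : bmf h -> itg (fun t => c * h t) a b = c * itg h a b.
Proof. by move=> bh; apply: bRintegralZ => //; exact: lebesgue_itv_lty. Qed.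

Lemma itg_cst c a b : a <= b -> itg (fun=> c) a b = c * (b - a).
Proof. by move=> ab; rewrite /itg Rintegral_cst//= lebesgue_itv_cc. Qed.

Lemma itg_open h a b : bmf h -> itg h a b = \int[mu]_(t in `]a, b[) h t.
Proof.
move=> bh; have i1 := itg_integrable a b bh.
rewrite Rintegral_itv_bndo_bndc; last first.
  by apply: integrableS i1 => //; exact: subset_itv_oo_cc.
rewrite Rintegral_itv_obnd_cbnd//.
by apply: integrableS i1 => //; exact: subset_itv_oc_cc.
Qed.

Lemma eq_itg h g a b : bmf h -> bmf g -> (forall t, a < t < b -> h t = g t) ->
  itg h a b = itg g a b.
Proof.
move=> bh bg hg; rewrite !itg_open//; apply: eq_Rintegral => t.
by rewrite inE /= in_itv/= => /hg.
Qed.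

Lemma itg_le_norm h a b c : bmf h -> a <= b -> (forall t, a < t < b -> `|h t| <= c) ->
  `|itg h a b| <= c * (b - a).
Proof.
move=> bh ab hc; have [e|ab'] := eqVneq a b.
  by rewrite e subrr mulr0 /itg set_itv1 Rintegral_set1 normr0.
have lt_ab : a < b by rewrite lt_neqAle ab'.
rewrite itg_open//; have mo : measurable (`]a, b[%classic : set R) by [].
have muo : (mu (`]a, b[%classic : set R) = (b - a)%:E)%E.
  by rewrite lebesgue_measure_itv/= lte_fin lt_ab -EFinB.
have muf : (mu (`]a, b[%classic : set R) < +oo)%E by rewrite muo ltry.
rewrite -[b - a]/(fine (b - a)%:E) -muo; apply: le_norm_bRintegral => //.
Qed.

Lemma itg_split h a b c : bmf h -> a <= b <= c ->
  itg h a c = itg h a b + itg h b c.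
Proof.
move=> bh /andP[ab bc].
have := Rintegral_itvB (itg_integrable a c bh) (x := b).
rewrite !bnd_simp => /(_ ab bc).
rewrite Rintegral_itv_obnd_cbnd; last first.
  by apply: integrableS (itg_integrable b c bh) => //; exact: subset_itv_oc_cc.
by move/eqP; rewrite subr_eq addrC => /eqP.
Qed.

Lemma itg_affine_ge0 h (m c : R) (A : set R) : m != 0 -> measurable A ->
  bmf h -> (forall t, 0 <= h t) ->
  \int[mu]_(t in (fun t => m * t + c) @^-1` A) h (m * t + c) =
  `|m|^-1 * \int[mu]_(t in A) h t.
Proof.
move=> m0 mA bh h0.
have nm0 : `|m| != 0 by rewrite normr_eq0.
have mf : measurable_fun [set: measurableTypeR R]
    ((fun x => m * x + c) : measurableTypeR R -> measurableTypeR R).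
  exact: measurable_affine.
have mh : measurable_fun [set: measurableTypeR R] (EFin \o h).
  by apply/measurable_EFinP; case: bh.
have mhA : measurable_fun (A : set (measurableTypeR R)) (EFin \o h).
  exact: measurable_funTS.
pose nu := (measure_function_pushforward__canonical__measure_function_Measure mu mf).
have e1 : (\int[mu]_(t in A) (h t)%:E = `|m|%:E * \int[nu]_(t in A) (h t)%:E)%E.
  transitivity (\int[mscale (NngNum (normr_ge0 m)) nu]_(t in A) (h t)%:E)%E.
    by apply: eq_measure_integral => B mB _; exact: lebesgue_measure_affine.
  rewrite ge0_integral_mscale//= => t _; by rewrite lee_fin.
have e2 : (\int[nu]_(t in A) (h t)%:E =
    \int[mu]_(t in (fun t => m * t + c)%R @^-1` A) (h (m * t + c)%R)%:E)%E.
  by rewrite (ge0_integral_pushforward mf)// => t _; rewrite lee_fin.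
rewrite /Rintegral e1 e2.
set I := (\int[mu]_(t in _ @^-1` _) _)%E.
have : (0 <= I)%E by apply: integral_ge0 => t _; rewrite lee_fin.
case: I => [r| |] //= _; first by rewrite mulKf.
by rewrite mulry gtr0_sg ?normr_gt0// mul1e/= mulr0.
Qed.

Lemma preimage_affine_itv (m c a b : R) : 0 < m ->
  (fun t => m * t + c) @^-1` `[m * a + c, m * b + c] = `[a, b]%classic.
Proof.
by move=> m0; apply/seteqP; split => t; rewrite /= !in_itv/= !lerD2r !ler_pM2l.
Qed.

Lemma preimage_affine_itvN (m c a b : R) : m < 0 ->
  (fun t => m * t + c) @^-1` `[m * b + c, m * a + c] = `[a, b]%classic.
Proof.
by move=> m0; apply/seteqP; split => t; rewrite /= !in_itv/= !lerD2r !ler_nM2l// andbC.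
Qed.

Lemma bmf_affine h (m c : R) : bmf h -> bmf (fun t => h (m * t + c)).
Proof. by move=> bh; apply: (bmf_comp bh); exact: measurable_affine. Qed.

Lemma itg_affine_aux h (m c a b a' b' : R) : m != 0 -> bmf h ->
  (fun t => m * t + c) @^-1` `[a', b'] = `[a, b]%classic ->
  itg (fun t => h (m * t + c)) a b = `|m|^-1 * itg h a' b'.
Proof.
move=> m0 bh pre; have [M M0 hM] := bmf_bound bh.
have ge0 h1 : bmf h1 -> (forall t, 0 <= h1 t) ->
    itg (fun t => h1 (m * t + c)) a b = `|m|^-1 * itg h1 a' b'.
  by move=> b1 h10; rewrite /itg -(itg_affine_ge0 c m0 _ b1 h10)// pre.
have bM : bmf (fun _ : R => M) by exact: bmf_cst.
have bhM : bmf (fun t => h t + M) by exact: bmfD.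
have hM0 t : 0 <= h t + M.
  by have := hM t; rewrite ler_norml => /andP[+ _]; rewrite -subr_ge0 opprK addrC.
have := ge0 _ bhM hM0; rewrite (itgD _ _ (bmf_affine m c bh) bM) (itgD _ _ bh bM).
rewrite mulrDr (ge0 _ bM); last by move=> _; exact: ltW.
exact: addIr.
Qed.

Lemma itg_affine h (m c : R) a b : 0 < m -> bmf h ->
  itg (fun t => h (m * t + c)) a b = m^-1 * itg h (m * a + c) (m * b + c).
Proof.
move=> m0 bh; rewrite (itg_affine_aux (a' := m * a + c) (b' := m * b + c)) ?gt_eqF//.
  by rewrite gtr0_norm.
exact: preimage_affine_itv.
Qed.

Lemma itg_affineN h (m c : R) a b : m < 0 -> bmf h ->
  itg (fun t => h (m * t + c)) a b = (- m)^-1 * itg h (m * b + c) (m * a + c).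
Proof.
move=> m0 bh; rewrite (itg_affine_aux (a' := m * b + c) (b' := m * a + c)) ?lt_eqF//.
  by rewrite ltr0_norm.
exact: preimage_affine_itvN.
Qed.

Lemma itg_shift h c a b : bmf h -> itg (fun t => h (t + c)) a b = itg h (a + c) (b + c).
Proof.
move=> bh; have := itg_affine c a b ltr01 bh.
rewrite invr1 !mul1r => <-; congr itg; apply/funext => t; by rewrite mul1r.
Qed.

End interval_integral.

(** * Summation over the pieces between cuts *)

Lemma clamp_le (R : realType) (x e a b : R) : 0 <= e -> a <= b ->
  Num.min (Num.max (x + e) a) b - Num.min (Num.max x a) b <= e.
Proof.
move=> e0 ab; case: (leP (x + e) a); case: (leP x a); rewrite ?(min_l ab) ?subrr// => h h'.
- by have := lt_le_trans h (le_trans (_ : x <= x + e) h'); rewrite lerDl ltxx => /(_ e0).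
- by case: (leP (x + e) b) => h3; lra.
- by case: (leP (x + e) b) => h3; case: (leP x b) => h4; lra.
Qed.

Lemma cut_sum_arith (R : realType) (s G0 G1 a a1 a2 b Bd : R) : 0 <= G1 -> a1 <= a2 ->
  G0 + G1 * (a1 - a) + (Bd + ((1 + s) * G0 + G1 * (b - a2) + s * Bd)) <=
  (2 + s) * G0 + G1 * (b - a) + (1 + s) * Bd.
Proof.
move=> G10 a12; have := ler_wpM2l G10 a12.
rewrite !mulrBr !mulrDl; lra.
Qed.

Section cut_sum.
Variable R : realType.
Variables (Phi : R -> R -> R) (a0 b0 e G0 G1 Bd : R).
Hypotheses (e0 : 0 <= e) (G00 : 0 <= G0) (G10 : 0 <= G1).
Hypothesis Phi0 : forall a, Phi a a <= 0.
Hypothesis Phi_split : forall a b c, a0 <= a -> a <= b -> b <= c -> c <= b0 ->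
  Phi a c <= Phi a b + Phi b c.
Hypothesis Phi_short : forall a b, a0 <= a -> a <= b -> b <= b0 -> b - a <= e ->
  Phi a b <= Bd.

(** Induction on the cuts: up to the first cut [x] the interval is free, [[x, x + e]] costs [Bd],
    and the rest has one cut less. At most one more free piece than cuts pays [G0], while the [G1]
    terms add up to at most the total length. *)
Lemma cut_sum_sorted (c : seq R) a : sorted <=%R c -> a0 <= a -> a <= b0 ->
  (forall a' b', a <= a' -> a' < b' -> b' <= b0 ->
     (forall x, x \in c -> b' <= x \/ x + e <= a') -> Phi a' b' <= G0 + G1 * (b' - a')) ->
  Phi a b0 <= (size c).+1%:R * G0 + G1 * (b0 - a) + (size c)%:R * Bd.
Proof.
elim: c a => [|x c IH] a sc aa ab free.
  rewrite mul1r mul0r addr0; have [e'|ab'] := eqVneq a b0.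
    rewrite -e' subrr mulr0 addr0; exact: le_trans (Phi0 _) G00.
  by apply: free => //; rewrite lt_neqAle ab'.
(* Clamping to [[a, b0]] handles cuts outside the interval and overlapping windows; pieces may
   become degenerate. *)
pose a1 := Num.min (Num.max x a) b0; pose a2 := Num.min (Num.max (x + e) a) b0.
have aa1 : a <= a1 by rewrite /a1 le_min le_max lexx orbT.
have a12 : a1 <= a2.
  by rewrite /a2 /a1 le_min ge_min ge_min lexx !orbT andbT ge_max !le_max lexx lerDl e0 orbT.
have a2b : a2 <= b0 by rewrite /a2 ge_min lexx orbT.
have a1b : a1 <= b0 := le_trans a12 a2b.
have aa2 : a <= a2 := le_trans aa1 a12.
have h1 : Phi a a1 <= G0 + G1 * (a1 - a).
  have [e'|aa1'] := eqVneq a a1.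
    by rewrite -e' subrr mulr0 addr0; exact: le_trans (Phi0 _) G00.
  have lt_aa1 : a < a1 by rewrite lt_neqAle aa1'.
  have a1x : a1 <= x.
    move: lt_aa1; rewrite /a1 lt_min lt_max ltxx orbF => /andP[ax _].
    by rewrite ge_min ge_max lexx (ltW ax).
  apply: free => // y; rewrite inE => /orP[/eqP -> |yc]; left => //.
  apply: le_trans a1x _; move: sc => /=; rewrite (path_sortedE le_trans).
  by move=> /andP[/allP /(_ _ yc)].
have h2 : Phi a1 a2 <= Bd.
  apply: Phi_short => //; first exact: le_trans aa aa1.
  exact: clamp_le.
have h3 : Phi a2 b0 <= (size c).+1%:R * G0 + G1 * (b0 - a2) + (size c)%:R * Bd.
  apply: IH => //; [exact: path_sorted sc|exact: le_trans aa aa2|].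
  move=> a' b' aa' ab' bb free'; apply: free => //; first exact: le_trans aa2 aa'.
  move=> y; rewrite inE => /orP[/eqP -> |]; last exact: free'.
  have : a2 < b0 by exact: le_lt_trans aa' (lt_le_trans ab' bb).
  rewrite /a2 gt_min ltxx orbF => h; right; apply: le_trans aa'.
  by rewrite /a2 le_min le_max lexx/= (ltW (le_lt_trans _ h))// le_max lexx.
have h4 : Phi a b0 <= Phi a a1 + (Phi a1 a2 + Phi a2 b0).
  apply: le_trans (Phi_split aa aa1 a1b (lexx _)) _; rewrite lerD2l.
  by apply: Phi_split => //; exact: le_trans aa aa1.
apply: le_trans h4 _; apply: le_trans (lerD h1 (lerD h2 h3)) _.
rewrite /= -[(size c).+2]add2n -[(size c).+1]add1n !natrD.
exact: cut_sum_arith.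
Qed.

Lemma cut_sum (c : seq R) : a0 <= b0 ->
  (forall a b, a0 <= a -> a < b -> b <= b0 ->
     (forall x, x \in c -> b <= x \/ x + e <= a) -> Phi a b <= G0 + G1 * (b - a)) ->
  Phi a0 b0 <= (size c).+1%:R * G0 + G1 * (b0 - a0) + (size c)%:R * Bd.
Proof.
move=> ab free; rewrite -(size_sort <=%R).
apply: cut_sum_sorted => //; first exact: sort_le_sorted.
by move=> a' b' aa ab' bb h; apply: free => // x xc; apply: h; rewrite mem_sort.
Qed.

End cut_sum.

Lemma box_arith (R : realType) (x y t d u v : R) :
  0 <= x -> x < 1 -> 0 <= y -> y < 1 -> 0 <= t -> 0 <= d ->
  - 2^-1 <= u <= 2^-1 -> - 2^-1 <= v <= 2^-1 -> d <= 2^-1 -> t <= 2^-1 ->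
  - 2 <= x + t + d <= 2 /\ - 2 <= y + u + v <= 2.
Proof. by move=> ? ? ? ? ? ? /andP[? ?] /andP[? ?] ? ?; split; apply/andP; split; lra. Qed.

(** * Unstable segments under iteration *)

Section lines.
Variables (R : realType) (Delta : R).
Notation T := (torus R).
Notation P := (leb_torus R).
Notation F := (Ftilde Delta).
Variable l : R.
Hypotheses (el : eigenvalue Delta l) (l1 : 1 < `|l|).
Implicit Types (f : T -> R) (p y : T) (a b d t s : R) (k n : nat).

Lemma evecD (x s t : R) : evec x (s + t) = evec x s + evec x t.
Proof. by rewrite /evec mulrDr. Qed.

Lemma evecN (x t : R) : evec x (- t) = - evec x t.
Proof. by rewrite /evec mulrN. Qed.

Lemma measurable_evec (x : R) : measurable_fun setT (evec x).
Proof. by apply: measurable_fun_pair => //; exact: measurable_funM. Qed.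

Lemma bmf_line2 f : bmf f -> bmf (fun z : T * R => f (translate (evec l z.2) z.1)).
Proof.
move=> bf; apply: (bmf_comp bf).
apply: (measurableT_comp (f := fun z : T * (R * R) => translate z.2 z.1)
  (g := fun z : T * R => (z.1, evec l z.2)) (@measurable_translate2 R)).
apply: measurable_fun_pair; first exact: measurable_fst.
exact: (measurableT_comp (@measurable_evec l) measurable_snd).
Qed.

Lemma bmf_line f p : bmf f -> bmf (fun t => f (translate (evec l t) p)).
Proof. by move=> bf; exact: (bmf_pair1 p (bmf_line2 bf)). Qed.

Definition lineint f p ell := itg (fun t => f (translate (evec l t) p)) 0 ell.

(** [v] relocates the starting point of the segment, which is the image of [b] instead of [a] when
    [x < 0]. *)
Lemma lineint_scale f (x a b : R) : bmf f -> x != 0 ->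
  exists v, forall y, itg (fun t => f (translate (evec l (x * t)) y)) a b =
    `|x|^-1 * lineint f (translate v y) (`|x| * (b - a)).
Proof.
move=> bf x0.
have [xp|xn|/eqP] := ltgtP 0 x; last by rewrite eq_sym (negbTE x0).
  exists (evec l (x * a)) => y; rewrite gtr0_norm//.
  have bh := bmf_line y bf; pose h t := f (translate (evec l t) y).
  have -> : lineint f (translate (evec l (x * a)) y) (x * (b - a)) =
      itg (fun t => h (t + x * a)) 0 (x * (b - a)).
    by congr itg; apply/funext => t; rewrite translateD -evecD.
  rewrite itg_shift// add0r mulrBr subrK.
  have := itg_affine 0 a b xp bh; rewrite !addr0 => <-.
  by congr itg; apply/funext => t; rewrite addr0.
exists (evec l (x * b)) => y; rewrite ltr0_norm//.
have bh := bmf_line y bf; pose h t := f (translate (evec l t) y).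
have -> : lineint f (translate (evec l (x * b)) y) (- x * (b - a)) =
    itg (fun t => h (t + x * b)) 0 (- x * (b - a)).
  by congr itg; apply/funext => t; rewrite translateD -evecD.
rewrite itg_shift// add0r mulrBr !mulNr opprK addrAC addNr add0r.
have := itg_affineN 0 a b xn bh; rewrite !addr0 => <-.
by congr itg; apply/funext => t; rewrite addr0.
Qed.

Lemma seq_gap (V : seq R) : exists2 g : R, 0 < g &
  forall v w, v \in V -> w \in V -> `|v - w| < g -> v = w.
Proof.
elim: V => [|x V [g g0 IH]]; first by exists 1.
have [h h0 hV] : exists2 h : R, 0 < h & forall v, v \in V -> `|x - v| < h -> x = v.
  elim: V {IH} => [|y V [h h0 IH]]; first by exists 1.
  exists (if x == y then h else Num.min h `|x - y|).
    by case: eqVneq => // xy; rewrite lt_min h0 normr_gt0 subr_eq0.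
  move=> v; rewrite inE => /orP[/eqP ->|vV].
    by case: eqVneq => // xy; rewrite lt_min ltxx andbF.
  by case: eqVneq => _; [exact: IH|rewrite lt_min => /andP[+ _]; exact: IH].
exists (Num.min g h); first by rewrite lt_min g0.
move=> v w; rewrite !inE lt_min => /orP[/eqP->|vV] /orP[/eqP->|wV] // /andP[vg vh].
- exact: hV.
- by apply/esym/hV => //; rewrite distrC.
- exact: IH.
Qed.

(** In use, [X] is the expansion, [w] the parameter relative to a crossing and [e] the contracted
    stable displacement: [|X * w|] exceeds [|e|], so the sign of [X] decides. *)
Lemma side_left (X w e d : R) : 1 <= `|X| -> `|e| <= d -> w < - d ->
  (X * w + e < 0) = (0 < X).
Proof.
move=> X1 ed wd; have d0 : 0 <= d := le_trans (normr_ge0 _) ed.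
move: ed; rewrite ler_norml => /andP[e1 e2].
have [Xp|Xn|X0] := ltgtP 0 X; last by move: X1; rewrite -X0 normr0 ler10.
- rewrite gtr0_norm// in X1.
  have h1 : X * w < X * (- d) by rewrite ltr_pM2l.
  have h2 : X * (- d) <= - d by rewrite mulrN lerN2 ler_peMl.
  have := le_lt_trans (lerD h2 e2) (_ : - d + d < 1); rewrite addNr ltr01 => /(_ isT) _.
  apply/idP; have := ltr_leD (lt_le_trans h1 h2) e2; by rewrite addNr.
- rewrite ltr0_norm// in X1; apply/negbTE; rewrite -leNgt.
  have h1 : X * (- d) < X * w by rewrite ltr_nM2l.
  have h2 : d <= X * (- d) by rewrite mulrN -mulNr ler_peMl.
  have := lerD (le_trans h2 (ltW h1)) e1; by rewrite subrr.
Qed.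

Lemma side_right (X w e d : R) : 1 <= `|X| -> `|e| <= d -> d < w ->
  (X * w + e < 0) = (X < 0).
Proof.
move=> X1 ed dw; rewrite -[X * w]mulrNN (@side_left _ _ _ d) ?oppr_gt0 ?normrN//.
by rewrite ltrN2.
Qed.

Lemma toTorusD (z w : R * R) : toTorus (z + w) = translate w (toTorus z).
Proof. by rewrite /toTorus /translate/= !toCircleD. Qed.

Lemma toTorus_rep p : toTorus (rep p.1, rep p.2) = p.
Proof. by case: p => x y; rewrite /toTorus/= !toCircle_rep. Qed.

Let m := l^-1.

Let m_le1 : `|m| <= 1.
Proof. by rewrite normfV invf_le1 ?(lt_trans _ l1)// ltW. Qed.

Let em : eigenvalue Delta m. Proof. exact: eigenvalueV. Qed.

Lemma box_evec (z : R * R) t d : 0 <= z.1 -> z.1 < 1 -> 0 <= z.2 -> z.2 < 1 ->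
  0 <= t -> t <= (2 * (1 + `|l|))^-1 -> 0 <= d -> d <= (2 * (1 + `|l|))^-1 ->
  box (z + evec l t + evec m d).
Proof.
move=> z1 z1' z2 z2' t0 td d0 dd.
have L2 : 2 <= 1 + `|l| by rewrite (_ : 2 = 1 + 1)// lerD2l ltW.
have L0 : 0 < 1 + `|l| by rewrite (lt_le_trans _ L2).
have q (x : R) : x <= (2 * (1 + `|l|))^-1 -> (1 + `|l|) * x <= 2^-1.
  by move=> h; rewrite -ler_pdivlMl// -invfM mulrC.
have q1 (x : R) : 0 <= x -> x <= (2 * (1 + `|l|))^-1 -> x <= 2^-1.
  move=> x0 /q; apply: le_trans; by rewrite ler_peMl// lerDl.
have n1 : `|1 - l| <= 1 + `|l| by rewrite (le_trans (ler_normB _ _))// normr1.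
have n2 : `|1 - m| <= 1 + `|l|.
  by rewrite (le_trans (ler_normB _ _))// normr1 lerD2l (le_trans m_le1)// ltW.
have b1 : `|(1 - l) * t| <= 2^-1.
  by rewrite normrM (ger0_norm t0); apply: le_trans (q _ td); exact: ler_wpM2r.
have b2 : `|(1 - m) * d| <= 2^-1.
  by rewrite normrM (ger0_norm d0); apply: le_trans (q _ dd); exact: ler_wpM2r.
have := q1 _ t0 td; have := q1 _ d0 dd.
move: b1 b2; rewrite /box /evec /= !ler_norml.
by move=> h1 h2; apply: box_arith.
Qed.

(* c lists the parameters at which the segment can cross the discontinuity, one
   per iterate, since a short segment meets at most one of the lifted cut
   lines; the margin 2 * d keeps the stably displaced segment on the same side. *)
Lemma line_cuts k : exists2 d0 : R, 0 < d0 & forall p d, 0 <= d -> d <= d0 ->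
  exists2 c : seq R, size c = k & forall a b, 0 <= a -> a < b -> b <= d0 ->
  (forall x, x \in c -> b <= x \/ x + 2 * d <= a) ->
  exists y, forall t, a < t < b ->
    iter k F (translate (evec l t) p) = translate (evec l (l ^+ k * t)) y /\
    iter k F (translate (evec l t) (translate (evec m d) p)) =
      translate (evec l (l ^+ k * t)) (translate (evec m (m ^+ k * d)) y).
Proof.
have [B [V hV]] := lift_const Delta k.
have [g g0 gV] := seq_gap V.
have l0 : 0 < `|l| by exact: lt_trans l1.
have ln0 : l != 0 by rewrite -normr_gt0.
have lX n : 1 <= `|l ^+ n| by rewrite normrX exprn_ege1// ltW.
pose L := `|l| ^+ k.
have L1 : 1 <= L by rewrite exprn_ege1// ltW.
have L0 : 0 < L by exact: lt_le_trans L1.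
(* The first bound keeps the segment and its displaced copy inside [box]. By the second, two
   recorded lines of the same time differ by at most [3 * d0 * L], less than the gap [g], and so
   coincide. *)
exists (Num.min (2 * (1 + `|l|))^-1 (g / (4 * L))).
  by rewrite lt_min invr_gt0 divr_gt0 ?mulr_gt0// ?addr_gt0.
set d0 := Num.min _ _ => p d dp dd.
have d0l : d0 <= (2 * (1 + `|l|))^-1 by rewrite /d0 ge_min lexx.
have d0g : d0 <= g / (4 * L) by rewrite /d0 ge_min lexx orbT.
pose z0 : R * R := (rep p.1, rep p.2).
pose al j := (iter j.+1 (linF Delta) z0).1.
pose ts j v := (v - al j) / l ^+ j.+1.
(* Lines met within [d] of the admissible parameters [[0, d0]]. If there is none, [head] below falls
   back on 0, a harmless extra cut that keeps the list at length [k]. *)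
pose hit j v := (- d <= ts j v) && (ts j v <= d0 + d).
pose vj j := head 0 [seq v <- V | hit j v].
exists (mkseq (fun j => ts j (vj j) - d) k); first by rewrite size_mkseq.
move=> a b a0 ab bd free.
have sep j v : (j < k)%N -> v \in V -> b <= ts j v - d \/ ts j v + d <= a.
  move=> jk vV; have [hv|] := boolP (hit j v); last first.
    rewrite negb_and -!ltNge => /orP[h|h]; [right|left].
      by apply: le_trans a0; rewrite -lerBrDr sub0r ltW.
    by apply: le_trans bd _; rewrite lerBrDr ltW.
  have vjin : vj j \in [seq v <- V | hit j v].
    have : v \in [seq v <- V | hit j v] by rewrite mem_filter hv.
    by rewrite /vj; case: [seq v <- V | _] => // x s _; rewrite mem_head.
  move: vjin; rewrite mem_filter => /andP[hvj vjV].
  have -> : v = vj j.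
    apply: gV => //.
    have -> : v - vj j = l ^+ j.+1 * (ts j v - ts j (vj j)).
      by rewrite /ts mulrBr !mulrA ![_ * (_ - al j)]mulrC !mulfK ?expf_neq0//; ring.
    move: hv hvj => /andP[h1 h2] /andP[h3 h4].
    have h5 : `|ts j v - ts j (vj j)| <= 3 * d0.
      by move: (ts j v) (ts j (vj j)) h1 h2 h3 h4 => x1 x2 h1 h2 h3 h4;
         rewrite ler_norml; clear -h1 h2 h3 h4 dd; apply/andP; split; lra.
    rewrite normrM; apply: (@le_lt_trans _ _ (L * (3 * d0))).
      apply: ler_pM => //; rewrite normrX /L.
      by apply: ler_weXn2l => //; exact: ltW.
    have h6 : L * d0 <= g / 4.
      by rewrite -ler_pdivlMl// mulrC -mulrA -invfM.
    rewrite mulrCA; clear -h6 g0; lra.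
  case: (free (ts j (vj j) - d)).
  - by apply/mapP; exists j => //; rewrite mem_iota.
  - by left.
  - by move=> h; right; apply: le_trans h; rewrite le_eqVlt; apply/orP; left; apply/eqP; ring.
(* The open segment and its displaced copy form one set, so that one affine branch of the iterate
   serves both. *)
pose S := [set z : R * R | exists t e, [/\ a < t < b, e = 0 \/ e = d &
  z = z0 + evec l t + evec m e]].
have S0 : S !=set0.
  exists (z0 + evec l ((a + b) / 2) + evec m 0); exists ((a + b) / 2), 0; split => //.
    by rewrite !midf_lt. by left.
have Sbox : S `<=` @box R.
  move=> _ [t [e [/andP[t1 t2] e' ->]]].
  have [e0 ed] : 0 <= e /\ e <= d by case: e' => ->.
  have td0 : t <= d0 by exact: ltW (lt_le_trans t2 bd).
  apply: box_evec; rewrite ?rep_ge0 ?rep_lt1//.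
  - exact: ltW (le_lt_trans a0 t1).
  - exact: le_trans td0 d0l.
  - exact: le_trans ed (le_trans dd d0l).
have coord j t e : (iter j.+1 (linF Delta) (z0 + evec l t + evec m e)).1 =
    al j + l ^+ j.+1 * t + m ^+ j.+1 * e.
  by rewrite !iter_linFD !iter_linF_evec.
have [j jk v vV z z' Sz Sz'|b1 _ hb] := hV S S0 Sbox.
  suff [s hs] : exists s : bool, forall z, S z -> ((iter j.+1 (linF Delta) z).1 < v) = s.
    by rewrite !hs.
  have vE : v = al j + l ^+ j.+1 * ts j v.
    by rewrite /ts mulrC divfK ?expf_neq0// addrC subrK.
  have small e : e = 0 \/ e = d -> `|m ^+ j.+1 * e| <= d.
    move=> e'; rewrite normrM normrX; have [e0 ed] : 0 <= e /\ e <= d by case: e' => ->.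
    rewrite (ger0_norm e0); apply: le_trans ed; rewrite ler_piMl// exprn_ile1//.
  have cmp t e : ((iter j.+1 (linF Delta) (z0 + evec l t + evec m e)).1 < v) =
      (l ^+ j.+1 * (t - ts j v) + m ^+ j.+1 * e < 0).
    by rewrite coord [in LHS]vE -subr_lt0; congr (_ < 0); ring.
  case: (sep j v jk vV) => h.
    exists (0 < l ^+ j.+1) => _ [t [e [/andP[t1 t2] e' ->]]]; rewrite cmp.
    apply: (@side_left _ _ _ d); rewrite ?small//.
    by rewrite ltrBlDr addrC (lt_le_trans t2).
  exists (l ^+ j.+1 < 0) => _ [t [e [/andP[t1 t2] e' ->]]]; rewrite cmp.
  apply: (@side_right _ _ _ d); rewrite ?small//.
  by rewrite ltrBrDr addrC (le_lt_trans h).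
exists (toTorus (iter k (linF Delta) z0 + b1)) => t tab.
have pz : p = toTorus z0 by rewrite toTorus_rep.
have e1 := hb (z0 + evec l t + evec m 0).
have e2 := hb (z0 + evec l t + evec m d).
have Sz0 : S (z0 + evec l t + evec m 0) by exists t, 0; split => //; left.
have Szd : S (z0 + evec l t + evec m d) by exists t, d; split => //; right.
move: (e1 Sz0) (e2 Szd); rewrite !iter_linFD !iter_linF_evec// => {}e1 {}e2.
have z00 (x : R) : evec x 0 = 0 by rewrite /evec mulr0.
split.
  rewrite pz -toTorusD -[z0 + evec l t]addr0 -(z00 m) e1 mulr0 z00 addr0 -toTorusD.
  by congr toTorus; rewrite -!addrA; congr (_ + _); rewrite addrC.
rewrite pz translateC -!toTorusD e2; congr toTorus.
rewrite [LHS]addrAC (addrAC _ _ b1); exact: addrAC.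
Qed.

End lines.

(** * Strong and weak norms *)

Lemma mul4_add3_le_sqr (x y : nat) : (y < x)%N -> (16 <= x)%N -> (y.+3 * 4 <= x * x)%N.
Proof. by move=> h2 h3; nia. Qed.

Section norms.
Variables (R : realType) (Delta : R).
Notation T := (torus R).
Notation P := (leb_torus R).
Notation F := (Ftilde Delta).
Variable l : R.
Hypotheses (el : eigenvalue Delta l) (l1 : 1 < `|l|).
Notation m := (l^-1).
Implicit Types (f : T -> R) (p y : T) (a b d t s : R) (k n : nat).

Lemma l_gt0 : 0 < `|l|. Proof. exact: lt_trans l1. Qed.

Lemma lX_ge1 k : 1 <= `|l| ^+ k. Proof. by rewrite exprn_ege1// ltW. Qed.

Lemma lX_gt0 k : 0 < `|l| ^+ k. Proof. exact: lt_le_trans (lX_ge1 k). Qed.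

Definition cuts k d0 := forall p d, 0 <= d -> d <= d0 ->
  exists2 c : seq R, size c = k & forall a b, 0 <= a -> a < b -> b <= d0 ->
  (forall x, x \in c -> b <= x \/ x + 2 * d <= a) ->
  exists y, forall t, a < t < b ->
    iter k F (translate (evec l t) p) = translate (evec l (l ^+ k * t)) y /\
    iter k F (translate (evec l t) (translate (evec m d) p)) =
      translate (evec l (l ^+ k * t)) (translate (evec m (m ^+ k * d)) y).

Lemma cuts_le k d0 d1 : d1 <= d0 -> cuts k d0 -> cuts k d1.
Proof.
move=> dd ck p d d_ge0 d_le; have [c sc hc] := ck p d d_ge0 (le_trans d_le dd).
by exists c => // a b a0 ab bd; apply: hc => //; exact: le_trans dd.
Qed.

Variables (g dl : R).
Hypotheses (g0 : 0 < g) (g2 : g <= 2^-1) (dl0 : 0 < dl) (dl1 : dl <= 1).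

Lemma one_powR : (1 : R) `^ g = 1. Proof. by rewrite powR1. Qed.

Definition strong_unstable f M := forall p ell, 0 <= ell -> ell <= dl ->
  `|lineint l f p ell| <= M * ell `^ g.

Definition strong_stable f M := forall p d ell, 0 <= d -> d <= dl -> 0 <= ell -> ell <= dl ->
  `|lineint l f (translate (evec m d) p) ell - lineint l f p ell| <= M * d `^ g.

(** Stretching makes segments long; a bound affine in the length is what results from dividing them
    into pieces of length at most [dl]. *)
Definition weak f w B := forall p ell, 0 <= ell -> `|lineint l f p ell| <= w + B * ell.

Lemma lineint_split f p a b : bmf f -> 0 <= a -> 0 <= b ->
  lineint l f p (a + b) = lineint l f p a + lineint l f (translate (evec l a) p) b.
Proof.
move=> bf a0 b0; rewrite /lineint (@itg_split _ _ 0 a); last 2 first.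
- exact: bmf_line.
- by rewrite a0 lerDl.
congr (_ + _).
transitivity (itg (fun t => f (translate (evec l (t + a)) p)) 0 b); last first.
  by congr itg; apply/funext => t; rewrite translateD -evecD.
by rewrite (itg_shift a 0 b (bmf_line l p bf)) add0r addrC.
Qed.

(** A segment of length [ell] splits into at most [ell / dl + 1] pieces of length at most [dl], each
    of which pays [c]. *)
Lemma extend_length (Phi : T -> R -> R) c B : 0 <= c ->
  (forall p a b, 0 <= a -> 0 <= b ->
    `|Phi p (a + b)| <= `|Phi p a| + `|Phi (translate (evec l a) p) b|) ->
  (forall p ell, 0 <= ell -> ell <= dl -> `|Phi p ell| <= c + B * ell) ->
  forall p ell, 0 <= ell -> `|Phi p ell| <= c + (B + c / dl) * ell.
Proof.
move=> c0 sub short p ell ell0.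
have [n] : exists n : nat, ell <= n.+1%:R * dl.
  exists (Num.truncn (ell / dl)); rewrite -ler_pdivrMr//.
  by rewrite ltW// truncnS_gt.
elim: n p ell ell0 => [|n IH] p ell ell0 hn.
  have := short p _ ell0; rewrite mul1r in hn => /(_ hn) h.
  apply: le_trans h _; rewrite lerD2l ler_wpM2r// lerDl divr_ge0// ltW//.
have [h|h] := leP ell dl.
  apply: le_trans (short _ _ ell0 h) _; rewrite lerD2l ler_wpM2r// lerDl divr_ge0// ltW//.
have e : ell = dl + (ell - dl) by rewrite addrCA subrr addr0.
have ed0 : 0 <= ell - dl by rewrite subr_ge0 ltW.
rewrite {1}e; apply: le_trans (sub _ _ _ (ltW dl0) ed0) _.
have h1 := short p _ (ltW dl0) (lexx _).
have h2 := IH (translate (evec l dl) p) _ ed0.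
apply: le_trans (lerD h1 (h2 _)) _.
  by rewrite lerBlDr -[X in _ + X]mul1r -mulrDl natr1.
have -> : c + (B + c / dl) * ell = c + B * dl + (c + (B + c / dl) * (ell - dl)) - (c - c / dl * dl) by ring.
by rewrite divfK ?gt_eqF// subrr subr0.
Qed.

Lemma weak_extend f c B : bmf f -> 0 <= c ->
  (forall p ell, 0 <= ell -> ell <= dl -> `|lineint l f p ell| <= c + B * ell) ->
  weak f c (B + c / dl).
Proof.
move=> bf c0 h p ell ell0; apply: (extend_length c0 _ h) => // q a b a0 b0.
by rewrite lineint_split//; exact: ler_normD.
Qed.

Lemma strong_stable_extend f M p d ell : bmf f -> 0 <= M -> strong_stable f M ->
  `|d| <= dl -> 0 <= ell ->
  `|lineint l f (translate (evec m d) p) ell - lineint l f p ell| <=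
    M * `|d| `^ g * (1 + ell / dl).
Proof.
move=> bf M0 sf.
wlog d0 : d p / 0 <= d => [hw|] dd ell0.
  have [d0|d0] := leP 0 d; first exact: hw.
  pose q := translate (evec m d) p.
  have pq : translate (evec m (- d)) q = p by rewrite evecN translateK.
  have := hw (- d) q; rewrite pq normrN distrC; apply => //.
  by rewrite oppr_ge0 ltW.
rewrite (ger0_norm d0) in dd *.
have h := @extend_length (fun p ell => lineint l f (translate (evec m d) p) ell - lineint l f p ell) (M * d `^ g) 0.
apply: le_trans (h _ _ _ p ell ell0) _.
- by rewrite mulr_ge0// powR_ge0.
- move=> q a b a0 b0; rewrite !lineint_split// opprD addrACA translateC.
  exact: ler_normD.
- by move=> q x x0 xd; rewrite mul0r addr0; exact: sf.
- by rewrite add0r mulrDr mulr1 mulrA (mulrAC _ ell).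
Qed.

Lemma itg_lineint f p a b : bmf f ->
  itg (fun t => f (translate (evec l t) p)) a b = lineint l f (translate (evec l a) p) (b - a).
Proof.
move=> bf; rewrite /lineint -[in LHS](add0r a) -[in LHS](subrK a b).
rewrite -(itg_shift a 0 (b - a) (bmf_line l p bf)); congr itg; apply/funext => t.
by rewrite translateD -evecD.
Qed.

Section one_step.
Variables (k : nat) (ck : cuts k dl) (f : T -> R).
Hypothesis bf : bmf f.
Let Lk := `|l| ^+ k.
Let r := Lk^-1 `^ g.
Let f' x := f (iter k F x).

Let Lk0 : 0 < Lk. Proof. exact: lX_gt0. Qed.
Let Lk1 : 1 <= Lk. Proof. exact: lX_ge1. Qed.
Let bf' : bmf f'. Proof. exact: bmf_iterF. Qed.
Let lk0 : l ^+ k != 0.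
Proof. by rewrite expf_neq0// -normr_gt0 l_gt0. Qed.

Lemma r_ge0 : 0 <= r. Proof. exact: powR_ge0. Qed.

Lemma Lk_inv_le_r : Lk^-1 <= r.
Proof.
apply: ger1_powR; last by apply: le_trans g2 _; rewrite invf_le1// ler1n.
by rewrite invr_gt0 Lk0 invf_le1.
Qed.

(** On an uncut piece the iterate is affine, so the integral becomes an average over a segment [Lk]
    times as long. [v] is chosen before [p] and [y]: comparing a segment with its stable translate
    needs the same [v] for both. *)
Lemma one_step_piece a b : a < b -> exists v, forall p y,
  (forall t, a < t < b ->
    iter k F (translate (evec l t) p) = translate (evec l (l ^+ k * t)) y) ->
  itg (fun t => f' (translate (evec l t) p)) a b =
    Lk^-1 * lineint l f (translate v y) (Lk * (b - a)).
Proof.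
move=> ab; have [v hv] := lineint_scale l a b bf lk0.
exists v => p y h; rewrite /Lk -normrX -hv; apply: eq_itg => [| |t tab].
- exact: bmf_line.
- have -> : (fun t => f (translate (evec l (l ^+ k * t)) y)) =
      (fun t => f (translate (evec l (l ^+ k * t + 0)) y)).
    by apply/funext => t; rewrite addr0.
  exact: (bmf_affine (l ^+ k) 0 (bmf_line l y bf)).
- by rewrite /f' h.
Qed.

Lemma cut_sum_norm (h : R -> R) (c : seq R) ell e G0 G1 Bd : bmf h ->
  0 <= e -> 0 <= G0 -> 0 <= G1 -> 0 <= ell ->
  (forall a b, 0 <= a -> a <= b -> b <= ell -> b - a <= e -> `|itg h a b| <= Bd) ->
  (forall a b, 0 <= a -> a < b -> b <= ell ->
     (forall x, x \in c -> b <= x \/ x + e <= a) -> `|itg h a b| <= G0 + G1 * (b - a)) ->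
  `|itg h 0 ell| <= (size c).+1%:R * G0 + G1 * ell + (size c)%:R * Bd.
Proof.
move=> bh e0 G00 G10 ell0 short free.
have := @cut_sum R (fun a b => `|itg h a b|) 0 ell e G0 G1 Bd e0 G00 G10.
rewrite subr0; apply => //.
- by move=> a; rewrite /itg set_itv1 Rintegral_set1 normr0.
- move=> a b c' a0 ab bc cl; rewrite (itg_split bh (b := b)) ?ab//.
  exact: ler_normD.
Qed.

(** At most [k + 1] pieces pay [w / Lk] each, while the terms proportional to length reproduce [B];
    extension to long segments adds [w / 4 / dl]. *)
Lemma one_step_weak w B : 0 <= w -> 0 <= B -> (k.+2)%:R * r <= 4^-1 -> weak f w B ->
  weak f' (w / 4) (B + w / 4 / dl).
Proof.
move=> w0 B0 rk wf; apply: weak_extend => // [|p ell ell0 elld]; first by rewrite divr_ge0.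
have [c sc hc] := ck p (lexx 0) (ltW dl0).
have := @cut_sum_norm _ c ell 0 (Lk^-1 * w) B 0 (bmf_line l p bf') (lexx _).
rewrite !mulr0 addr0 => h; apply: le_trans (h _ _ ell0 _ _) _ => //.
- by rewrite mulr_ge0// invr_ge0 ltW.
- move=> a b a0 ab bl ba; have -> : b = a by apply/eqP; rewrite eq_le ab andbT -subr_le0.
  by rewrite /itg set_itv1 Rintegral_set1 normr0.
- move=> a b a0 ab bl free.
  have [|y hy] := hc a b a0 ab (le_trans bl elld).
    by move=> x /free; rewrite mulr0.
  have [v hv] := one_step_piece ab; rewrite (hv p y); last by move=> t /hy[].
  rewrite normrM gtr0_norm ?invr_gt0//.
  have ba0 : 0 <= b - a by rewrite subr_ge0 ltW.
  apply: le_trans (ler_wpM2l _ (wf _ _ _)) _; first by rewrite invr_ge0 ltW.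
    by rewrite mulr_ge0// ltW.
  by rewrite mulrDr mulrCA mulKf ?gt_eqF.
- rewrite lerD2r mulrA mulrC ler_wpM2l// sc; apply: le_trans rk.
  apply: ler_pM => //; [by rewrite invr_ge0 ltW|by rewrite ler_nat|exact: Lk_inv_le_r].
Qed.

(** This is [g + g <= 1]. Combined with [powR_Lk_r], it shows that stretching a segment and
    averaging over it multiplies a Hoelder bound by at most [r]. *)
Lemma Lk_inv_le_r2 : Lk^-1 <= r * r.
Proof.
have i0 : 0 < Lk^-1 <= 1 by rewrite invr_gt0 Lk0 invf_le1.
have -> : r * r = Lk^-1 `^ (g + g).
  by rewrite powRD//; apply/implyP => _; rewrite invr_eq0 gt_eqF.
by apply: ger1_powR => //; rewrite [leRHS](splitr 1) mul1r lerD.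
Qed.

Lemma powR_Lk_r : Lk `^ g * r = 1.
Proof.
by rewrite /r -powRM ?invr_ge0 ?ltW// mulfV ?gt_eqF// powR1.
Qed.

Lemma le_powR_self (x : R) : 0 <= x -> x <= 1 -> x <= x `^ g.
Proof.
rewrite le_eqVlt => /orP[/eqP <- _|x0 x1]; first exact: powR_ge0.
by apply: ger1_powR; rewrite ?x0//; apply: le_trans g2 _; rewrite invf_le1// ler1n.
Qed.

Lemma le_powR_mono (x y : R) : 0 <= x -> x <= y -> x `^ g <= y `^ g.
Proof.
move=> x0 xy; apply: ge0_ler_powR => //; first exact: ltW.
by rewrite nnegrE (le_trans x0).
Qed.

(** A stretched image of length at most [dl] falls under the strong bound, contracted by [r]. For a
    longer one, [1 <= Lk * x / dl] makes the constant term of the weak bound proportional to [x]. *)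
Lemma piece_bound M w (x : R) q : 0 <= M -> 0 <= w -> strong_unstable f M ->
  weak f w (w / dl) -> 0 <= x ->
  `|Lk^-1 * lineint l f q (Lk * x)| <= M * r * x `^ g + 2 * w / dl * x.
Proof.
move=> M0 w0 sf wf x0; have L0 : 0 <= Lk * x by rewrite mulr_ge0// ltW.
have i0 : 0 <= Lk^-1 by rewrite invr_ge0 ltW.
rewrite normrM ger0_norm//; have [h|h] := leP (Lk * x) dl.
  apply: le_trans (ler_wpM2l i0 (sf _ _ L0 h)) _.
  rewrite powRM// ?(ltW Lk0)// -[leLHS]addr0 lerD//; last first.
    by rewrite !mulr_ge0// invr_ge0 ltW.
  rewrite mulrCA -mulrA; apply: ler_wpM2l => //; rewrite mulrA ler_wpM2r ?powR_ge0//.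
  apply: le_trans (ler_wpM2r (powR_ge0 _ _) Lk_inv_le_r2) _.
  by rewrite -mulrA [r * Lk `^ g]mulrC powR_Lk_r mulr1.
apply: le_trans (ler_wpM2l i0 (wf _ _ L0)) _.
apply: (@le_trans _ _ (Lk^-1 * (2 * w / dl * (Lk * x)))); last first.
  rewrite mulrCA mulKf ?gt_eqF// lerDr !mulr_ge0 ?r_ge0 ?powR_ge0//.
apply: ler_wpM2l => //.
have -> : 2 * w / dl * (Lk * x) = w / dl * (Lk * x) + w / dl * (Lk * x) by ring.
by rewrite lerD2r -mulrA ler_peMr// mulrC ler_pdivlMr// mul1r ltW.
Qed.

Lemma one_step_unstable M w : 0 <= M -> 0 <= w -> strong_unstable f M ->
  weak f w (w / dl) -> strong_unstable f' (k.+1%:R * r * M + 2 * w / dl).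
Proof.
move=> M0 w0 sf wf p ell ell0 elld.
have [c sc hc] := ck p (lexx 0) (ltW dl0).
have := @cut_sum_norm _ c ell 0 (M * r * ell `^ g) (2 * w / dl) 0 (bmf_line l p bf') (lexx _).
rewrite mulr0 addr0 => h; apply: le_trans (h _ _ ell0 _ _) _ => //.
- by rewrite !mulr_ge0 ?r_ge0 ?powR_ge0.
- by rewrite !mulr_ge0// invr_ge0 ltW.
- move=> a b a0 ab bl ba; have -> : b = a by apply/eqP; rewrite eq_le ab andbT -subr_le0.
  by rewrite /itg set_itv1 Rintegral_set1 normr0.
- move=> a b a0 ab bl free.
  have [|y hy] := hc a b a0 ab (le_trans bl elld).
    by move=> x /free; rewrite mulr0.
  have [v hv] := one_step_piece ab; rewrite (hv p y); last by move=> t /hy[].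
  have ba0 : 0 <= b - a by rewrite subr_ge0 ltW.
  apply: le_trans (piece_bound _ M0 w0 sf wf ba0) _.
  rewrite lerD2r ler_wpM2l ?mulr_ge0 ?r_ge0//; apply: le_powR_mono => //.
  by apply: le_trans bl; rewrite lerBlDr lerDl.
- rewrite sc [leRHS]mulrDl; apply: lerD.
    by rewrite le_eqVlt; apply/orP; left; apply/eqP; ring.
  rewrite ler_wpM2l//; first by rewrite !mulr_ge0// invr_ge0 ltW.
  by apply: le_powR_self => //; exact: le_trans elld dl1.
Qed.

(** Pieces that avoid the [k] windows are mapped to segments at stable distance [d / Lk], whence the
    factor [r] on [D]. In a window of length [2 * d] nothing cancels, and the unstable bound of [f']
    is applied to each of the two segments. Of the [k + 2] copies of [r * D], [k + 1] count free
    pieces and one comes from the total length. *)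
Lemma one_step_stable D M' : 0 <= D -> 0 <= M' -> strong_stable f D ->
  strong_unstable f' M' -> strong_stable f' (k.+2%:R * r * D + 4 * k%:R * M').
Proof.
move=> D0 M0 sf sf' p d ell d0 dd ell0 elld.
have [c sc hc] := ck p d0 dd.
pose p1 := translate (evec m d) p.
have b1 := bmf_line l p1 bf'; have b2 := bmf_line l p bf'.
pose h t := f' (translate (evec l t) p1) - f' (translate (evec l t) p).
have bh : bmf h by exact: bmfB.
have hE a b : itg h a b = itg (fun t => f' (translate (evec l t) p1)) a b -
   itg (fun t => f' (translate (evec l t) p)) a b by exact: itgB.
have -> : lineint l f' p1 ell - lineint l f' p ell = itg h 0 ell by rewrite hE.
have d20 : 0 <= 2 * d by rewrite mulr_ge0.
have dg0 : 0 <= d `^ g by exact: powR_ge0.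
have G00 : 0 <= D * r * d `^ g by rewrite !mulr_ge0 ?r_ge0.
have G10 : 0 <= D * r * d `^ g / dl by rewrite divr_ge0// ltW.
apply: le_trans (@cut_sum_norm h c ell (2 * d) (D * r * d `^ g) (D * r * d `^ g / dl)
  (4 * M' * d `^ g) bh d20 G00 G10 ell0 _ _) _.
- move=> a b a0 ab bl ba; rewrite hE; apply: le_trans (ler_normB _ _) _.
  have ba0 : 0 <= b - a by rewrite subr_ge0.
  have bad : b - a <= dl by apply: le_trans elld; apply: le_trans bl; rewrite lerBlDr lerDl.
  have q p' : `|itg (fun t => f' (translate (evec l t) p')) a b| <= 2 * M' * d `^ g.
    rewrite itg_lineint//; apply: le_trans (sf' _ _ ba0 bad) _.
    rewrite mulrAC mulrC ler_wpM2r//; apply: le_trans (le_powR_mono ba0 ba) _.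
    rewrite powRM// ler_wpM2r// ler1_powR// ?ler1n//.
    by apply: le_trans g2 _; rewrite invf_le1// ler1n.
  apply: le_trans (lerD (q _) (q _)) _.
  by rewrite le_eqVlt; apply/orP; left; apply/eqP; ring.
- move=> a b a0 ab bl free.
  have [y hy] := hc a b a0 ab (le_trans bl elld) free.
  have [v hv] := one_step_piece ab; rewrite hE.
  rewrite (hv p y); last by move=> t /hy[].
  rewrite (hv p1 (translate (evec m (m ^+ k * d)) y)); last by move=> t /hy[].
  rewrite -mulrBr normrM gtr0_norm ?invr_gt0// translateC.
  have ba0 : 0 <= b - a by rewrite subr_ge0 ltW.
  have nd : `|m ^+ k * d| = Lk^-1 * d by rewrite normrM normrX normfV -exprVn ger0_norm.
  have i1 : Lk^-1 <= 1 by rewrite invf_le1.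
  have i0 : 0 <= Lk^-1 by rewrite invr_ge0 ltW.
  apply: le_trans (ler_wpM2l i0 (strong_stable_extend _ bf D0 sf _ _)) _.
  + by rewrite nd; apply: le_trans dd; rewrite ler_piMl.
  + by rewrite mulr_ge0// ltW.
  rewrite nd powRM// -/r.
  have -> : Lk^-1 * (D * (r * d `^ g) * (1 + Lk * (b - a) / dl)) =
    Lk^-1 * (D * r * d `^ g) + (Lk^-1 * Lk) * (D * r * d `^ g / dl * (b - a)) by ring.
  by rewrite mulVf ?gt_eqF// mul1r lerD2r ler_piMl.
- rewrite sc.
  have : D * r * d `^ g / dl * ell <= D * r * d `^ g.
    by rewrite -mulrA ler_piMr// mulrC ler_pdivrMr// mul1r.
  rewrite -[k.+2%:R]natr1; move: (D * r * d `^ g / dl * ell) => z hz.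
  have -> : ((k.+1%:R + 1) * r * D + 4 * k%:R * M') * d `^ g =
    k.+1%:R * (D * r * d `^ g) + D * r * d `^ g + k%:R * (4 * M' * d `^ g) by ring.
  by rewrite lerD2r lerD2l.
Qed.

End one_step.

Lemma powR_pow (x : R) n : 0 <= x -> (x ^+ n) `^ g = (x `^ g) ^+ n.
Proof.
move=> x0; elim: n => [|n IH]; first by rewrite !expr0 powR1.
by rewrite !exprS powRM ?exprn_ge0// IH.
Qed.

Lemma contraction_time : exists2 k, (0 < k)%N & k.+2%:R * (`|l| ^+ k)^-1 `^ g <= 4^-1.
Proof.
pose rho := `|l|^-1 `^ g.
have rho0 : 0 <= rho by exact: powR_ge0.
have rho1 : rho < 1.
  rewrite -[ltRHS]one_powR gt0_ltr_powR ?nnegrE ?invr_ge0//.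
  by rewrite invf_lt1// l_gt0.
have [N hN] : exists N, rho ^+ N <= 16^-1.
  have c : rho ^+ n @[n --> \oo] --> 0 by apply: cvg_expr; rewrite ger0_norm.
  have [N _ hN] := @cvgr_dist_lt _ R _ _ _ _ _ c 16^-1 ltac:(by rewrite invr_gt0).
  exists N; have := hN N (leqnn _); rewrite /= sub0r normrN ger0_norm ?exprn_ge0//.
  exact: ltW.
(* With [rho ^+ N <= 1 / 16] and [k = N * j + 1], the linear factor [k + 2 = N * j + 3] must be
   absorbed by [16 ^ j]; [N < j] gives [N * j < j * j < 4 ^ j]. *)
pose j := N.+2; exists (N * j).+1 => //.
set k := (N * j).+1.
have -> : (`|l| ^+ k)^-1 `^ g = rho ^+ k by rewrite -exprVn powR_pow// invr_ge0.
have h1 : rho ^+ k <= 16^-1 ^+ j.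
  apply: (@le_trans _ _ (rho ^+ (N * j))).
    by rewrite /k exprS ler_piMl ?exprn_ge0// ltW.
  by rewrite exprM lerXn2r// nnegrE ?exprn_ge0// invr_ge0.
apply: le_trans (ler_wpM2l (ler0n _ _) h1) _.
rewrite exprVn ler_pdivrMr ?exprn_gt0// mulrC ler_pdivlMr// -natrX -natrM ler_nat.
have jj : (j < 2 ^ j)%N by exact: ltn_expl.
have h2 : (N * j < 4 ^ j)%N.
  rewrite (_ : 4 = 2 * 2)%N// expnMn; apply: leq_ltn_trans (_ : j * j < _)%N.
    by rewrite leq_mul2r /j -addn2 leq_addr orbT.
  by apply: ltn_mul.
have h3 : (16 <= 4 ^ j)%N by rewrite (_ : 16 = 4 ^ 2)%N// leq_exp2l.
rewrite /k (_ : 16 = 4 * 4)%N// expnMn.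
exact: mul4_add3_le_sqr h2 h3.
Qed.

(** * The Lasota-Yorke inequality and its iteration *)

Section lasota_yorke.
Variables (k : nat) (k0 : (0 < k)%N) (ck : cuts k dl).
Hypothesis rk : k.+2%:R * (`|l| ^+ k)^-1 `^ g <= 4^-1.

(** [4 * k] is the coefficient with which [one_step_stable] feeds the unstable bound into the stable
    one. With this weight a single constant [M] controls both halves and contracts in both. *)
Definition strong f M := strong_unstable f M /\ strong_stable f (4 * k%:R * M).

Lemma strong_unstable_le f M M' : M <= M' -> strong_unstable f M -> strong_unstable f M'.
Proof.
move=> MM h p ell e0 ed; apply: le_trans (h p ell e0 ed) _.
by rewrite ler_wpM2r// powR_ge0.
Qed.

Lemma strong_stable_le f M M' : M <= M' -> strong_stable f M -> strong_stable f M'.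
Proof.
move=> MM h p d ell d0 dd e0 ed; apply: le_trans (h p d ell d0 dd e0 ed) _.
by rewrite ler_wpM2r// powR_ge0.
Qed.

Lemma strong_weak f M : bmf f -> 0 <= M -> strong_unstable f M -> weak f M (M / dl).
Proof.
move=> bf M0 sf; rewrite -[M / dl]add0r; apply: weak_extend => // p ell e0 ed.
apply: le_trans (sf p ell e0 ed) _; rewrite mul0r addr0 ler_piMr//.
rewrite -one_powR; apply: le_powR_mono => //; exact: le_trans ed dl1.
Qed.

Lemma lasota_yorke f M w : bmf f -> 0 <= M -> 0 <= w -> strong f M ->
  weak f w (w / dl) -> strong (fun x => f (iter k F x)) (M / 2 + 2 * w / dl).
Proof.
move=> bf M0 w0 [su ss] wf.
have su' := one_step_unstable ck bf M0 w0 su wf.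
have rk' := rk; set r := _ `^ g in rk' su'; have r0 : 0 <= r by exact: powR_ge0.
have w'0 : 0 <= 2 * w / dl by rewrite !mulr_ge0// invr_ge0 ltW.
have h1 : k.+1%:R * r <= 4^-1.
  by apply: le_trans rk'; rewrite ler_wpM2r// ler_nat.
have su2 : strong_unstable (fun x => f (iter k F x)) (M / 4 + 2 * w / dl).
  apply: strong_unstable_le su'; rewrite lerD2r (mulrC M) ler_wpM2r//.
have M'0 : 0 <= M / 4 + 2 * w / dl by rewrite addr_ge0// divr_ge0.
have kM0 : 0 <= 4 * k%:R * M by rewrite !mulr_ge0.
have ss2 := one_step_stable ck bf kM0 M'0 ss su2.
split.
  apply: strong_unstable_le su2; rewrite lerD2r ler_wpM2l// lef_pV2 ?posrE//.
  by rewrite ler_nat.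
apply: strong_stable_le ss2; rewrite -/r.
apply: (@le_trans _ _ (4^-1 * (4 * k%:R * M) + 4 * k%:R * (M / 4 + 2 * w / dl))).
  by rewrite lerD2r ler_wpM2r.
by rewrite le_eqVlt; apply/orP; left; apply/eqP; field; rewrite gt_eqF.
Qed.

(** No contraction here: the purpose is to keep iterates between two multiples of the contraction
    time in the strong class. *)
Lemma strong_step_finite n f M : cuts n dl -> bmf f -> 0 <= M -> strong f M ->
  exists2 M', 0 <= M' & strong (fun x => f (iter n F x)) M'.
Proof.
move=> cn bf M0 [su ss]; have wf := strong_weak bf M0 su.
have su' := one_step_unstable cn bf M0 M0 su wf.
set M1 := (X in strong_unstable _ X) in su'.
have M10 : 0 <= M1.
  by rewrite addr_ge0 ?mulr_ge0 ?powR_ge0// invr_ge0 ltW.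
have kM0 : 0 <= 4 * k%:R * M by rewrite !mulr_ge0.
have ss' := one_step_stable cn bf kM0 M10 ss su'.
set M2 := (X in strong_stable _ X) in ss'.
have M20 : 0 <= M2 by rewrite addr_ge0 ?mulr_ge0 ?powR_ge0.
exists (M1 + M2); first by rewrite addr_ge0.
split; first by apply: strong_unstable_le su'; rewrite lerDl.
apply: strong_stable_le ss'; rewrite mulrDr -[leLHS]add0r.
apply: lerD; first by rewrite !mulr_ge0.
rewrite ler_peMl// -natrM ler1n muln_gt0 k0//.
Qed.

Lemma weak_le f w B w' B' : w <= w' -> B <= B' -> weak f w B -> weak f w' B'.
Proof.
move=> ww BB h p ell e0; apply: le_trans (h p ell e0) _.
by apply: lerD => //; exact: ler_wpM2r.
Qed.

(** Each step adds [w / 4 / dl] to the slope and replaces [w] by [w / 4], so the increments form a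
    geometric series below [w / dl]. *)
Lemma weak_iter_aux n f w B : bmf f -> 0 <= w -> 0 <= B -> weak f w B ->
  weak (fun x => f (iter (k * n) F x)) w (B + w / dl).
Proof.
elim: n f w B => [|n IH] f w B bf w0 B0 wf.
  rewrite muln0; apply: weak_le wf => //.
  by rewrite lerDl divr_ge0// ltW.
have wf1 := one_step_weak ck bf w0 B0 rk wf.
have d4 : 0 <= w / 4 by rewrite divr_ge0.
have := IH _ _ _ (bmf_iterF Delta k bf) d4 _ wf1.
rewrite mulnS; under [fun x => f (iter (k + _) F x)]eq_fun do rewrite iterD.
move=> h; apply: weak_le (h _); last by rewrite addr_ge0// divr_ge0// ltW.
  by rewrite ler_pdivrMr// ler_peMr// ler1n.
rewrite -addrA lerD2l -mulrDl ler_wpM2r ?invr_ge0 ?(ltW dl0)//.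
by rewrite -mulrDr ler_piMr//; lra.
Qed.

Lemma weak_iter n f w : bmf f -> 0 <= w -> weak f w (w / dl) ->
  weak (fun x => f (iter (k * n) F x)) (2 * w) (2 * w / dl).
Proof.
move=> bf w0 wf; have wd : 0 <= w / dl by rewrite divr_ge0// ltW.
have := weak_iter_aux n bf w0 wd wf; apply: weak_le.
  by rewrite ler_peMl// ler1n.
by rewrite le_eqVlt; apply/orP; left; apply/eqP; ring.
Qed.

(** [8 * w / dl] is the fixed point of [x / 2 + 4 * w / dl], the Lasota-Yorke step with the weak
    bound [2 * w] that holds for all the iterates. *)
Lemma strong_iter n f M w : bmf f -> 0 <= M -> 0 <= w -> strong f M ->
  weak f w (w / dl) ->
  strong (fun x => f (iter (k * n) F x)) (M / 2 ^+ n + 8 * w / dl).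
Proof.
move=> bf M0 w0 sf wf; have wd : 0 <= 8 * w / dl by rewrite !mulr_ge0// invr_ge0 ltW.
elim: n => [|n IH].
  rewrite muln0 expr0 divr1; case: sf => su ss; split.
    by apply: strong_unstable_le su; rewrite lerDl.
  by apply: strong_stable_le ss; rewrite ler_wpM2l ?mulr_ge0// lerDl.
have w20 : 0 <= 2 * w by rewrite mulr_ge0.
have M'0 : 0 <= M / 2 ^+ n + 8 * w / dl by rewrite addr_ge0// divr_ge0// exprn_ge0.
have := lasota_yorke (bmf_iterF Delta (k * n) bf) M'0 w20 IH (weak_iter n bf w0 wf).
rewrite mulnSr; under [fun x => f (iter (_ + k) F x)]eq_fun do rewrite iterD.
congr strong; rewrite exprS; field.
by rewrite gt_eqF// expf_neq0.
Qed.

End lasota_yorke.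

End norms.

(** * Compactness *)

Section compactness.
Variables (R : realType) (Delta : R).
Notation T := (torus R).
Notation P := (leb_torus R).
Notation F := (Ftilde Delta).
Variable l : R.
Hypotheses (el : eigenvalue Delta l) (l1 : 1 < `|l|).
Notation m := (l^-1).
Implicit Types (f h : T -> R) (p y : T) (a b d t s ell : R) (n N : nat).
Variables (g dl : R).
Hypotheses (g0 : 0 < g) (g2 : g <= 2^-1) (dl0 : 0 < dl) (dl1 : dl <= 1).
Variables (k : nat) (k0 : (0 < k)%N) (ck : cuts Delta l k dl).
Hypothesis rk : k.+2%:R * (`|l| ^+ k)^-1 `^ g <= 4^-1.
Notation weak := (weak l).
Notation strong := (strong l g dl k).

Lemma lineintB f h p ell : bmf f -> bmf h ->
  lineint l (fun x => f x - h x) p ell = lineint l f p ell - lineint l h p ell.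
Proof. by move=> bf bh; apply: itgB; exact: bmf_line. Qed.

Lemma lineintZ c f p ell : bmf f ->
  lineint l (fun x => c * f x) p ell = c * lineint l f p ell.
Proof. by move=> bf; apply: itgZ; exact: bmf_line. Qed.

Lemma strongB f h M M' : bmf f -> bmf h -> strong f M -> strong h M' ->
  strong (fun x => f x - h x) (M + M').
Proof.
move=> bf bh [fu fs] [hu hs]; split.
  move=> p ell e0 ed; rewrite lineintB// mulrDl; apply: le_trans (ler_normB _ _) _.
  by apply: lerD; [exact: fu|exact: hu].
move=> p d ell d0 dd e0 ed; rewrite !lineintB// mulrDr mulrDl.
rewrite opprD addrACA; apply: le_trans (ler_normD _ _) _.
apply: lerD; first exact: fs.
by rewrite -opprD normrN; exact: hs.
Qed.

Lemma strongZ c f M : bmf f -> strong f M -> strong (fun x => c * f x) (`|c| * M).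
Proof.
move=> bf [fu fs]; split.
  by move=> p ell e0 ed; rewrite lineintZ// normrM -mulrA ler_wpM2l//; exact: fu.
move=> p d ell d0 dd e0 ed; rewrite !lineintZ// -mulrBr normrM mulrCA -mulrA.
by rewrite ler_wpM2l//; exact: fs.
Qed.

(** Sliding a segment along itself exchanges a piece of length [|s|] at one end for one at the
    other; the unstable bound controls both. *)
Lemma lineint_shift f M p s ell : bmf f -> 0 <= M -> strong_unstable l g dl f M ->
  `|s| <= dl -> 0 <= ell ->
  `|lineint l f (translate (evec l s) p) ell - lineint l f p ell| <= 2 * M * `|s| `^ g.
Proof.
move=> bf M0 su.
wlog s0 : s p / 0 <= s => [hw|] sd ell0.
  have [s0|s0] := leP 0 s; first exact: hw.
  pose q := translate (evec l s) p.
  have pq : translate (evec l (- s)) q = p by rewrite evecN translateK.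
  have := hw (- s) q; rewrite pq normrN distrC; apply => //.
  by rewrite oppr_ge0 ltW.
rewrite (ger0_norm s0) in sd *.
have e1 := lineint_split l p bf s0 ell0.
have e2 := lineint_split l p bf ell0 s0.
have -> : lineint l f (translate (evec l s) p) ell - lineint l f p ell =
    lineint l f (translate (evec l ell) p) s - lineint l f p s.
  rewrite -[lineint l f (translate (evec l s) p) ell](addKr (lineint l f p s)) -e1.
  by rewrite addrC [s + _]addrC e2; ring.
apply: le_trans (ler_normB _ _) _; rewrite -mulrA mulr2n mulrDl mul1r.
by apply: lerD; exact: su.
Qed.

Lemma lineint_near f M p s d eta ell : bmf f -> 0 <= M -> strong f M ->
  `|s| <= eta -> `|d| <= eta -> eta <= dl -> 0 <= ell -> ell <= dl ->
  `|lineint l f (translate (evec l s) (translate (evec m d) p)) ell - lineint l f p ell| <=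
  (2 + 8 * k%:R) * M * eta `^ g.
Proof.
move=> bf M0 [su ss] se de ed ell0 elld.
apply: le_trans (ler_distD (lineint l f (translate (evec m d) p) ell) _ _) _.
have mono x : `|x| <= eta -> `|x| `^ g <= eta `^ g by exact: le_powR_mono.
rewrite -mulrA [leRHS]mulrDl; apply: lerD.
  apply: le_trans (lineint_shift _ bf M0 su (le_trans se ed) ell0) _.
  by rewrite -mulrA ler_wpM2l// ler_wpM2l// mono.
have kM0 : 0 <= 4 * k%:R * M by rewrite !mulr_ge0.
apply: le_trans (strong_stable_extend dl0 _ bf kM0 ss (le_trans de ed) ell0) _.
have -> : 8 * k%:R * (M * eta `^ g) = 4 * k%:R * M * eta `^ g * 2 by ring.
apply: ler_pM => //.
- by rewrite mulr_ge0// powR_ge0.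
- by rewrite addr_ge0// divr_ge0// ltW.
- by rewrite ler_wpM2l// mono.
- by rewrite (_ : 2 = 1 + 1)// lerD2l ler_pdivrMr// mul1r.
Qed.

Lemma l_neq_m : l - m != 0.
Proof.
rewrite subr_eq0; apply: contraTneq l1 => h.
rewrite -leNgt h normfV invf_le1; first exact: ltW.
exact: l_gt0.
Qed.

Lemma evec_decomp : exists2 C : R, 0 < C & forall eta (u v : R), `|u| <= eta -> `|v| <= eta ->
  exists s d, [/\ `|s| <= C * eta, `|d| <= C * eta & (u, v) = evec l s + evec m d].
Proof.
have lm := l_neq_m; have lm0 : 0 < `|l - m| by rewrite normr_gt0.
have l0 : l != 0 by rewrite -normr_gt0; exact: l_gt0.
exists ((3 + `|l|) / `|l - m|); first by rewrite divr_gt0// ltr_wpDr.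
move=> eta u v ue ve; have eta0 : 0 <= eta := le_trans (normr_ge0 u) ue.
have bnd x : `|x| <= 1 + `|l| -> `|(u - v - x * u) / (l - m)| <= (3 + `|l|) / `|l - m| * eta.
  move=> xl; rewrite normf_div mulrAC ler_wpM2r ?invr_ge0//.
  apply: le_trans (ler_normB _ _) _; rewrite normrM.
  have h1 : `|u - v| <= 2 * eta.
    by rewrite mulr2n mulrDl mul1r; apply: le_trans (ler_normB _ _) _; exact: lerD.
  have h2 : `|x| * `|u| <= (1 + `|l|) * eta by exact: ler_pM.
  apply: le_trans (lerD h1 h2) _; rewrite -mulrDl ler_wpM2r// addrA lerD2r.
  by rewrite -(natrD _ 2 1).
exists ((u - v - m * u) / (l - m)), (- ((u - v - l * u) / (l - m))); split.
- apply: bnd; rewrite normfV ler_wpDr// invf_le1; first exact: ltW.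
  exact: l_gt0.
- by rewrite normrN; apply: bnd; rewrite ler_wpDl.
- have lm2 : l * l - 1 != 0 by apply: contra lm => /eqP h; rewrite -(mulfK l0 (l - m)) mulrBl mulVf// h mul0r.
  by rewrite /evec; congr pair => /=; field; rewrite l0 lm2.
Qed.

Definition cell N i j : set T :=
  (@rep R @^-1` `[i%:R / N.+1%:R, i.+1%:R / N.+1%:R[) `*`
  (@rep R @^-1` `[j%:R / N.+1%:R, j.+1%:R / N.+1%:R[).

Lemma measurable_cell N i j : measurable (cell N i j).
Proof. by apply: measurableX; exact: measurable_preimage_rep. Qed.

Lemma leb_cell N i j : (i < N.+1)%N -> (j < N.+1)%N ->
  P (cell N i j) = ((N.+1%:R^-1) ^+ 2)%:E.
Proof.
move=> iN jN; rewrite leb_torus_rect//.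
have h n : (n < N.+1)%N ->
    lebesgue_measure (`[n%:R / N.+1%:R, n.+1%:R / N.+1%:R[ `&` `[(0 : R), 1[) = (N.+1%:R^-1 : R)%:E.
  move=> nN; rewrite (_ : _ `&` _ = `[n%:R / N.+1%:R, n.+1%:R / N.+1%:R[%classic).
    rewrite lebesgue_measure_itv/= lte_fin ltr_pM2r ?invr_gt0// ltr_nat ltnSn.
    by rewrite -EFinB -mulrBl -natrB// subSnn mul1r.
  apply/seteqP; split => x /=; rewrite !in_itv/=; first by case.
  move=> /andP[x1 x2]; rewrite x1 x2; split => //; apply/andP; split.
    by apply: le_trans x1; rewrite divr_ge0.
  by apply: lt_le_trans x2 _; rewrite ler_pdivrMr// mul1r ler_nat.
by rewrite !h// -EFinM expr2.
Qed.

Lemma in_cell N p : exists i j, [/\ (i < N.+1)%N, (j < N.+1)%N & cell N i j p].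
Proof.
have h (x : R) : 0 <= x -> x < 1 ->
    exists2 i, (i < N.+1)%N & i%:R / N.+1%:R <= x < i.+1%:R / N.+1%:R.
  move=> x0 x1; have xN : 0 <= x * N.+1%:R by rewrite mulr_ge0.
  exists (Num.truncn (x * N.+1%:R)).
    rewrite -(ltr_nat R); apply: le_lt_trans (_ : x * N.+1%:R < _).
      by rewrite truncn_le.
    by rewrite -[ltRHS]mul1r ltr_pM2r.
  by rewrite ler_pdivrMr// ltr_pdivlMr// truncnS_gt andbT truncn_le.
have [i iN hi] := h _ (rep_ge0 p.1) (rep_lt1 p.1).
have [j jN hj] := h _ (rep_ge0 p.2) (rep_lt1 p.2).
by exists i, j; split => //; split; rewrite /= in_itv.
Qed.

Lemma cell_near N i j p p' : cell N i j p -> cell N i j p' ->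
  exists u v, [/\ `|u| <= N.+1%:R^-1, `|v| <= N.+1%:R^-1 & p' = translate (u, v) p].
Proof.
rewrite /cell /= !in_itv/= => -[/andP[a1 a2] /andP[b1 b2]] [/andP[c1 c2] /andP[d1 d2]].
have h n (x y : R) : n%:R / N.+1%:R <= x -> x < n.+1%:R / N.+1%:R ->
    n%:R / N.+1%:R <= y -> y < n.+1%:R / N.+1%:R -> `|y - x| <= N.+1%:R^-1.
  rewrite -[n.+1%:R]natr1 mulrDl mul1r; move: (n%:R / N.+1%:R : R) (N.+1%:R^-1 : R) => z e.
  by move=> ? ? ? ?; rewrite ler_norml; apply/andP; split; lra.
exists (rep p'.1 - rep p.1), (rep p'.2 - rep p.2); split; [exact: h a1 a2 c1 c2|exact: h b1 b2 d1 d2|].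
have -> : translate (rep p'.1 - rep p.1, rep p'.2 - rep p.2) p = toTorus (rep p'.1, rep p'.2).
  rewrite -[in LHS](toTorus_rep p) -toTorusD /toTorus/= !toCircle_rep.
  by congr pair; rewrite toCircleD toCircleB !toCircle_rep addrC subrK.
by rewrite toTorus_rep.
Qed.

(** The indicator of [Q] spread along unstable segments. By Fubini, testing [f] against it
    integrates the segment integrals of [f] over [Q]. *)
Definition line_kernel (Q : set T) ell y :=
  itg (fun t => \1_Q (translate (- evec l t) y)) 0 ell.

Lemma bmf_line_kernel_integrand (Q : set T) : measurable Q ->
  bmf (fun z : T * R => \1_Q (translate (- evec l z.2) z.1) : R).
Proof.
move=> mQ; have bQ : bmf (\1_Q : T -> R) by exact: bmf_indic.
have := @bmf_comp _ _ _ _ R (fun z : T * R => \1_Q (translate (evec l z.2) z.1) : R)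
  (fun z : T * R => (z.1, - z.2)) (bmf_line2 l bQ).
under [fun z : T * R => \1_Q (translate (- _) _) : R]eq_fun do rewrite -evecN.
apply; apply: measurable_fun_pair; first exact: measurable_fst.
apply: measurable_funN; exact: measurable_snd.
Qed.

Lemma bmf_itg (h : T * R -> R) ell : bmf h -> bmf (fun x => itg (fun t => h (x, t)) 0 ell).
Proof.
exact: (@bmf_section_integral _ _ T (measurableTypeR R) R (@lebesgue_measure R)
  `[0, ell]%classic (measurable_itv `[0, ell]) (lebesgue_itv_lty 0 ell)).
Qed.

Lemma itg_Fubini (h : T * R -> R) ell : bmf h ->
  \int[P]_x itg (fun t => h (x, t)) 0 ell = itg (fun t => \int[P]_x h (x, t)) 0 ell.
Proof.
exact: (@bmf_Fubini _ _ T (measurableTypeR R) R P (@lebesgue_measure R)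
  `[0, ell]%classic (probability_setT_lty P) (measurable_itv `[0, ell]) (lebesgue_itv_lty 0 ell)).
Qed.

Lemma bmf_line_kernel (Q : set T) ell : measurable Q -> bmf (line_kernel Q ell).
Proof. by move=> mQ; exact: (bmf_itg ell (bmf_line_kernel_integrand mQ)). Qed.

Lemma bmf_lineint f ell : bmf f -> bmf (fun p => lineint l f p ell).
Proof. by move=> bf; exact: (bmf_itg ell (bmf_line2 l bf)). Qed.

Lemma cell_average f (Q : set T) ell : measurable Q -> bmf f ->
  \int[P]_p (\1_Q p * lineint l f p ell) = \int[P]_y (f y * line_kernel Q ell y).
Proof.
move=> mQ bf; have bQ : bmf (\1_Q : T -> R) by exact: bmf_indic.
have b1 : bmf (fun z : T * R => \1_Q z.1 * f (translate (evec l z.2) z.1)).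
  apply: bmfM; last exact: bmf_line2.
  exact: (bmf_comp bQ measurable_fst).
have b2 : bmf (fun z : T * R => f z.1 * \1_Q (translate (- evec l z.2) z.1)).
  apply: bmfM; last exact: bmf_line_kernel_integrand.
  exact: (bmf_comp bf measurable_fst).
have e1 : \int[P]_p (\1_Q p * lineint l f p ell) =
    \int[P]_p itg (fun t => \1_Q p * f (translate (evec l t) p)) 0 ell.
  by apply: eq_Rintegral => p _; rewrite itgZ//; exact: bmf_line.
have e2 : \int[P]_p (f p * line_kernel Q ell p) =
    \int[P]_p itg (fun t => f p * \1_Q (translate (- evec l t) p)) 0 ell.
  apply: eq_Rintegral => p _; rewrite itgZ//.
  exact: (bmf_pair1 p (bmf_line_kernel_integrand mQ)).
rewrite e1 e2 (itg_Fubini ell b1) (itg_Fubini ell b2).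
apply: eq_Rintegral => t _; have h := Pintegral_translate_mul (evec l t) bQ bf.
apply: (etrans h); apply: eq_Rintegral => x _; exact: mulrC.
Qed.

Lemma average_close (h : T -> R) (Q : set T) a e : bmf h -> measurable Q ->
  (forall p, Q p -> `|h p - a| <= e) ->
  `|\int[P]_p (\1_Q p * h p) - a * fine (P Q)| <= e * fine (P Q).
Proof.
move=> bh mQ hQ; have bQ : bmf (\1_Q : T -> R) by exact: bmf_indic.
have ba : bmf (fun _ : T => a) by exact: bmf_cst.
have PQ c : \int[P]_p (c * \1_Q p) = c * fine (P Q).
  by rewrite PintegralZ// Rintegral_indic// setIT.
have bhQ := bmfM bQ bh; have baQ := bmfM ba bQ.
rewrite -!PQ -PintegralB//.
apply: le_trans (le_norm_Pintegral _ (bmfB bhQ baQ)) _.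
apply: le_Pintegral.
- exact: bmf_norm (bmfB bhQ baQ).
- by apply: bmfM => //; exact: bmf_cst.
move=> p; rewrite [a * _]mulrC -mulrBr normrM mulrC; rewrite indicE.
have [pQ|pQ] := boolP (p \in Q); last by rewrite normr0 !mulr0.
by rewrite normr1 !mulr1; apply: hQ; rewrite inE in pQ.
Qed.

Lemma scale_exists (A eta : R) : 0 < A -> 0 < eta -> exists2 h : R, 0 < h & A * h `^ g <= eta.
Proof.
move=> A0 eta0; exists ((eta / A) `^ g^-1); first by rewrite powR_gt0// divr_gt0.
have An : A != 0 by rewrite gt_eqF.
have h0 : 0 <= eta / A by rewrite ltW// divr_gt0.
by rewrite -powRrM mulVf ?gt_eqF// powRr1// mulrC divfK.
Qed.

Lemma truncn_grid (x w : R) : 0 < w -> 0 <= x ->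
  (Num.truncn (x / w))%:R * w <= x <= (Num.truncn (x / w))%:R * w + w.
Proof.
move=> w0 x0; have xw0 : 0 <= x / w by rewrite divr_ge0// ltW.
rewrite -ler_pdivlMr// truncn_le// -[X in _ <= _ * w + X]mul1r -mulrDl natr1.
by rewrite xw0 -ler_pdivrMr// ltW// truncnS_gt.
Qed.

(** On the strong unit ball segment integrals are equicontinuous in position and length, so finitely
    many determine all of them up to [eta]. They are averaged over cells because mixing controls
    integrals against fixed functions, not values at points. *)
Lemma finite_net eta : 0 < eta -> exists (I : finType) (rho : I -> T -> R),
  (forall i, bmf (rho i)) /\ forall f, bmf f -> strong f 1 ->
  (forall i, `|\int[P]_y (f y * rho i y)| <= 1) /\
  ((forall i, `|\int[P]_y (f y * rho i y)| <= eta) ->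
   forall p ell, 0 <= ell -> ell <= dl -> `|lineint l f p ell| <= 2 * eta).
Proof.
move=> eta0; have [C C0 hC] := evec_decomp.
(* [2 + 8 * k] comes from moving the segment within a cell by [lineint_near], and 1 from rounding
   its length. *)
have [h h0 hh] := @scale_exists (3 + 8 * k%:R) eta ltac:(by rewrite ltr_wpDr) eta0.
pose C1 := C + 1.
have C10 : 0 < C1 by rewrite addr_gt0.
have [N hN] : exists N, C1 / N.+1%:R <= Num.min h dl.
  have mn0 : 0 < Num.min h dl by rewrite lt_min h0.
  exists (Num.truncn (C1 / Num.min h dl)); rewrite ler_pdivrMr// mulrC -ler_pdivrMr//.
  by rewrite ltW// truncnS_gt.
set e := C1 / N.+1%:R in hN; move: hN; rewrite le_min => /andP[eh ed].
have e0 : 0 <= e by rewrite divr_ge0// ltW.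
have Ni0 : 0 <= N.+1%:R^-1 :> R by rewrite invr_ge0.
have eC : C * N.+1%:R^-1 <= e by rewrite /e ler_wpM2r// lerDl.
have e1 : N.+1%:R^-1 <= e by rewrite /e -[leLHS]mul1r ler_wpM2r// lerDr ltW.
pose I : finType := ('I_N.+1 * 'I_N.+1 * 'I_N.+2)%type.
pose Q (i : I) := cell N i.1.1 i.1.2.
pose len (i : I) := i.2%:R * (dl / N.+1%:R).
pose q : R := (N.+1%:R^-1) ^+ 2.
have q0 : 0 < q by rewrite exprn_gt0// invr_gt0.
have mQ i : measurable (Q i) by exact: measurable_cell.
have PQ i : fine (P (Q i)) = q by rewrite leb_cell.
have len0 i : 0 <= len i by rewrite mulr_ge0// divr_ge0// ltW.
have lend i : len i <= dl.
  rewrite /len mulrCA ler_piMr ?(ltW dl0)// ler_pdivrMr// mul1r ler_nat.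
  by rewrite -ltnS ltn_ord.
pose rho (i : I) y := q^-1 * line_kernel (Q i) (len i) y.
exists I, rho; split; first by move=> i; apply: bmfZ; exact: bmf_line_kernel.
move=> f bf sf; have [su ss] := sf.
have avg i : \int[P]_y (f y * rho i y) = q^-1 * \int[P]_p (\1_(Q i) p * lineint l f p (len i)).
  rewrite cell_average// -PintegralZ; last by apply: bmfM => //; exact: bmf_line_kernel.
  by apply: eq_Rintegral => y _; rewrite /rho mulrCA.
have close i a r : (forall p, Q i p -> `|lineint l f p (len i) - a| <= r) ->
    `|\int[P]_y (f y * rho i y) - a| <= r.
  move=> H; have := average_close (bmf_lineint (len i) bf) (mQ i) H.
  rewrite PQ avg; move: (\int[P]_p _) => X hX.
  have -> : q^-1 * X - a = q^-1 * (X - a * q) by field; rewrite gt_eqF.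
  by rewrite normrM gtr0_norm ?invr_gt0// mulrC ler_pdivrMr.
split.
  move=> i; rewrite -[X in `|X|]subr0; apply: close => p _; rewrite subr0.
  apply: le_trans (su _ _ (len0 i) (lend i)) _; rewrite mul1r -[leRHS](one_powR g).
  by apply: le_powR_mono => //; exact: le_trans (lend i) dl1.
move=> small p ell ell0 elld.
have [i [j [iN jN pQ]]] := in_cell N p.
have [n nN /andP[n1 n2]] : exists2 n, (n < N.+2)%N &
    n%:R * (dl / N.+1%:R) <= ell <= n%:R * (dl / N.+1%:R) + dl / N.+1%:R.
  have dN : 0 < dl / N.+1%:R by rewrite divr_gt0.
  have x0 : 0 <= ell / (dl / N.+1%:R) by rewrite divr_ge0// ltW.
  exists (Num.truncn (ell / (dl / N.+1%:R))).
    rewrite ltnS -(ler_nat R); apply: le_trans (_ : ell / (dl / N.+1%:R) <= _).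
      by rewrite truncn_le.
    by rewrite ler_pdivrMr// mulrC divfK// gt_eqF.
  exact: truncn_grid.
pose c : I := (Ordinal iN, Ordinal jN, Ordinal nN).
have lc : len c <= ell by [].
have r0 : 0 <= ell - len c by rewrite subr_ge0.
have re : ell - len c <= e.
  apply: le_trans e1; apply: (@le_trans _ _ (dl / N.+1%:R)).
    by rewrite lerBlDl.
  by rewrite ler_piMl.
have A : `|lineint l f p ell - lineint l f p (len c)| <= e `^ g.
  have -> : lineint l f p ell = lineint l f p (len c + (ell - len c)) by rewrite addrC subrK.
  rewrite lineint_split// addrC addKr.
  apply: le_trans (su _ _ r0 (le_trans re ed)) _; rewrite mul1r.
  exact: le_powR_mono.
have B : `|\int[P]_y (f y * rho c y) - lineint l f p (len c)| <= (2 + 8 * k%:R) * 1 * e `^ g.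
  apply: close => p' p'Q; have [u [v [ue ve ->]]] := cell_near pQ p'Q.
  have [s [d [se de ->]]] := hC _ _ _ ue ve.
  rewrite -translateD.
  by apply: lineint_near => //; [exact: le_trans se eC|exact: le_trans de eC].
have eg : e `^ g <= h `^ g by exact: le_powR_mono.
have hB := small c; move: A B hB.
move: (lineint l f p ell) (lineint l f p (len c)) (\int[P]_y _) => a b X hA hB hX.
have k8 : 0 <= 2 + 8 * k%:R :> R by rewrite addr_ge0.
have k9 : 0 <= 3 + 8 * k%:R :> R by rewrite addr_ge0.
have hE : (3 + 8 * k%:R) * e `^ g <= eta by apply: le_trans hh; exact: ler_wpM2l.
have -> : a = (a - b) - (X - b) + X by ring.
apply: le_trans (ler_normD _ _) _; rewrite mulr2n [leRHS]mulrDl mul1r; apply: lerD => //.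
apply: le_trans (ler_normB _ _) _; apply: le_trans hE.
apply: le_trans (lerD hA hB) _.
by rewrite le_eqVlt; apply/orP; left; apply/eqP; ring.
Qed.

(** Strong bound for the iterates under [F^k] of the unit ball: [strong_iter] with [M = w = 1]. *)
Let rate := 1 + 8 * 1 / dl.

Let rate1 : 1 <= rate.
Proof. by rewrite lerDl mulr1 divr_ge0// ltW. Qed.

Lemma strong_le f M M' : M <= M' -> strong f M -> strong f M'.
Proof.
move=> MM [su ss]; split; first exact: strong_unstable_le su.
by apply: strong_stable_le ss; rewrite ler_wpM2l// mulr_ge0.
Qed.

Lemma strong_iter1 f n : bmf f -> strong f 1 -> strong (fun x => f (iter (k * n) F x)) rate.
Proof.
move=> bf sf.
have wf : weak f 1 (1 / dl) by apply: (strong_weak g0 dl0 dl1 bf ler01); case: sf.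
have := strong_iter l1 g0 g2 dl0 dl1 ck rk n bf ler01 ler01 sf wf.
by apply: strong_le; rewrite lerD2r ler_pdivrMr ?exprn_gt0// mul1r exprn_ege1// ler1n.
Qed.

Lemma strong0 : strong (fun=> 0) 1.
Proof.
have z p ell : lineint l (fun=> 0) p ell = 0 by rewrite /lineint /itg Rintegral_cst//= mul0r.
split => [p ell e0 ed|p d ell d0 dd e0 ed]; rewrite !z ?subrr normr0 ?mul1r ?powR_ge0//.
by rewrite !mulr_ge0// powR_ge0.
Qed.

Section classes.
Variables (I : finType) (rho : I -> T -> R) (eta : R).
Hypotheses (brho : forall i, bmf (rho i)) (eta0 : 0 < eta).
Hypothesis net : forall f, bmf f -> strong f 1 ->
  (forall i, `|\int[P]_y (f y * rho i y)| <= 1) /\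
  ((forall i, `|\int[P]_y (f y * rho i y)| <= eta) ->
   forall p ell, 0 <= ell -> ell <= dl -> `|lineint l f p ell| <= 2 * eta).

Let coord f i := \int[P]_y (f y * rho i y).
Let bound := Num.truncn (2 / eta).

(** Coordinates rounded to mesh [eta]. On the strong unit ball they lie in [[-1, 1]]; adding 1 makes
    them nonnegative, and [bound] is then large enough for [inord] to be faithful. *)
Definition net_class f : {ffun I -> 'I_bound.+1} :=
  [ffun i => inord (Num.truncn ((coord f i + 1) / eta))].

Lemma net_class_close f h : bmf f -> bmf h -> strong f 1 -> strong h 1 ->
  net_class f = net_class h -> forall p ell, 0 <= ell -> ell <= dl ->
  `|lineint l (fun x => f x - h x) p ell| <= 4 * eta.
Proof.
move=> bf bh sf sh cfh p ell e0 ed.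
have grid u : bmf u -> strong u 1 -> forall i,
    (net_class u i)%:R * eta <= coord u i + 1 <= (net_class u i)%:R * eta + eta.
  move=> bu su i; have [/(_ i) ub _] := net bu su.
  move: ub; rewrite ler_norml => /andP[u1 u2].
  have x0 : 0 <= coord u i + 1 by rewrite -lerBlDr sub0r.
  rewrite ffunE inordK; first exact: truncn_grid.
  rewrite ltnS; apply: le_truncn; apply: ler_wpM2r; first by rewrite invr_ge0 ltW.
  by rewrite (_ : 2 = 1 + 1)// lerD2r.
have bfh := bmfB bf bh.
(* Halving brings the difference back into the strong unit ball, where [net] applies. *)
have sfh : strong (fun x => 2^-1 * (f x - h x)) 1.
  have := strongZ 2^-1 bfh (strongB bf bh sf sh).
  by rewrite gtr0_norm ?invr_gt0// -(natrD _ 1 1) mulVf.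
have [_ H] := net (bmfZ 2^-1 bfh) sfh.
have small i : `|\int[P]_y (2^-1 * (f y - h y) * rho i y)| <= eta.
  have -> : \int[P]_y (2^-1 * (f y - h y) * rho i y) = 2^-1 * (coord f i - coord h i).
    rewrite /coord -PintegralB; [|exact: bmfM..].
    rewrite -PintegralZ; last by apply: bmfB; exact: bmfM.
    by apply: eq_Rintegral => y _; ring.
  have := grid f bf sf i; have := grid h bh sh i; rewrite cfh.
  move: (coord f i) (coord h i) (_ * eta) => x y z /andP[? ?] /andP[? ?].
  by rewrite ler_norml; apply/andP; split; lra.
have := H small p ell e0 ed; rewrite lineintZ// normrM gtr0_norm ?invr_gt0//.
by rewrite ler_pdivrMl// => /le_trans; apply; rewrite le_eqVlt; apply/orP; left; apply/eqP; ring.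
Qed.

Let good f := [/\ bmf f, strong f 1 & \int[P]_x f x = 0].

(** A class without admissible member receives the zero function, so that mixing can be applied to a
    mean-zero function for each of finitely many classes. *)
Lemma class_representatives : exists r : {ffun I -> 'I_bound.+1} -> T -> R,
  forall c, good (r c) /\ forall f, good f -> net_class f = c -> net_class (r c) = c.
Proof.
have H (c : {ffun I -> 'I_bound.+1}) : exists r : T -> R,
    good r /\ forall f, good f -> net_class f = c -> net_class r = c.
  have [[f [gf cf]]|nf] := pselect (exists f, good f /\ net_class f = c).
    by exists f.
  exists (fun=> 0); split; last by move=> f gf cf; exfalso; apply: nf; exists f.
  by split; [exact: bmf_cst|exact: strong0|rewrite Rintegral_cst//= mul0r].
have [r hr] := choice H; by exists r.
Qed.

(** [f] is within [4 * eta] of its representative on short segments, and iteration at most doubles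
    this. Iterates of the representative, divided by [rate], lie in the unit ball and by mixing have
    small coordinates, which yields [2 * rate * eta]. *)
Lemma uniform_decay : exists n, forall f, good f ->
  weak (fun x => f (iter (k * n) F x)) ((8 + 2 * rate) * eta) ((8 + 2 * rate) * eta / dl).
Proof.
have [r hr] := class_representatives.
have mix (ci : {ffun I -> 'I_bound.+1} * I) : exists N, forall n, (N <= n)%N ->
    `|\int[P]_y (r ci.1 (iter n F y) * rho ci.2 y)| <= eta.
  have [[br _ zr] _] := hr ci.1.
  have := mixing_bmf el l1 br (brho ci.2); rewrite zr mulr0 => c.
  have [N _ hN] := @cvgr_dist_le _ R _ _ _ _ _ c eta eta0.
  exists N => n Nn; have := hN n Nn; rewrite /= sub0r normrN.
  by under eq_Rintegral do rewrite mulrC.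
have [NN hNN] := choice mix.
pose n := (\max_ci NN ci)%N; exists n => f gf; have [bf sf zf] := gf.
pose c := net_class f; have [[br sr zr] /(_ f gf erefl) cr] := hr c.
have rate0 : 0 < rate := lt_le_trans ltr01 rate1.
have kn ci : (NN ci <= k * n)%N.
  by apply: leq_trans (leq_bigmax ci) _; rewrite leq_pmull.
have b1 := bmf_iterF Delta (k * n) (bmfB bf br).
have b2 := bmf_iterF Delta (k * n) br.
have W1 : weak (fun x => f (iter (k * n) F x) - r c (iter (k * n) F x)) (2 * (4 * eta)) (2 * (4 * eta) / dl).
  have e40 : 0 <= 4 * eta by rewrite mulr_ge0// ltW.
  apply: (weak_iter l1 g2 dl0 ck rk n (bmfB bf br) e40).
  rewrite -[4 * eta / dl]add0r; apply: weak_extend => //; first exact: bmfB.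
  move=> p ell e0 ed; rewrite mul0r addr0; apply: net_class_close => //; exact/esym.
have W2 : weak (fun x => r c (iter (k * n) F x)) (2 * rate * eta) (2 * rate * eta / dl).
  rewrite -[2 * rate * eta / dl]add0r; apply: weak_extend => //.
    by rewrite !mulr_ge0// ltW.
  move=> p ell e0 ed; rewrite mul0r addr0.
  have sr1 := strongZ rate^-1 b2 (strong_iter1 n br sr).
  rewrite ger0_norm ?invr_ge0 ?ltW// mulVf ?gt_eqF// in sr1.
  have [_ H] := net (bmfZ rate^-1 b2) sr1.
  have small i : `|\int[P]_y (rate^-1 * r c (iter (k * n) F y) * rho i y)| <= eta.
    have -> : \int[P]_y (rate^-1 * r c (iter (k * n) F y) * rho i y) =
        rate^-1 * \int[P]_y (r c (iter (k * n) F y) * rho i y).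
      rewrite -PintegralZ; last exact: bmfM.
      by apply: eq_Rintegral => y _; rewrite mulrA.
    rewrite normrM gtr0_norm ?invr_gt0// ler_pdivrMl//.
    apply: le_trans (hNN (c, i) _ (kn _)) _; rewrite ler_peMl// ltW//.
  have := H small p ell e0 ed; rewrite lineintZ// normrM gtr0_norm ?invr_gt0//.
  by rewrite ler_pdivrMl// => /le_trans; apply; rewrite le_eqVlt; apply/orP; left; apply/eqP; ring.
move=> p ell e0.
have -> : lineint l (fun x => f (iter (k * n) F x)) p ell =
   lineint l (fun x => f (iter (k * n) F x) - r c (iter (k * n) F x)) p ell +
   lineint l (fun x => r c (iter (k * n) F x)) p ell.
  by rewrite lineintB ?subrK//; exact: bmf_iterF.
apply: le_trans (ler_normD _ _) _; apply: le_trans (lerD (W1 p ell e0) (W2 p ell e0)) _.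
by rewrite le_eqVlt; apply/orP; left; apply/eqP; ring.
Qed.

End classes.

Lemma contraction : exists2 K, (0 < K)%N & forall f M, 0 < M -> bmf f -> strong f M ->
  \int[P]_x f x = 0 -> strong (fun x => f (iter K F x)) (M / 2).
Proof.
have rate0 : 0 < rate := lt_le_trans ltr01 rate1.
pose A := 8 + 2 * rate; have A0 : 0 < A by rewrite addr_gt0// mulr_gt0.
(* After [k * n1] steps the weak bound is [dl / 32], so the term [8 * w / dl] of [strong_iter]
   equals [1 / 4]; [n2] makes the other term at most [1 / 4]. *)
pose eta := dl / 32 / A.
have eta0 : 0 < eta by rewrite !divr_gt0.
have [I [rho [brho net]]] := finite_net eta0.
have [n1 hn1] := uniform_decay brho eta0 net.
have [n2 n20 hn2] : exists2 n2, (0 < n2)%N & rate / 2 ^+ n2 <= 4^-1.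
  exists (Num.truncn (4 * rate)).+1 => //; rewrite ler_pdivrMr ?exprn_gt0//.
  rewrite ler_pdivlMl//; apply: le_trans (ltW (truncnS_gt _)) _.
  by rewrite -natrX ler_nat ltnW// ltn_expl.
exists (k * n1 + k * n2)%N => [|f M M0 bf sf zf].
  by rewrite addn_gt0 !muln_gt0 k0 n20 orbT.
pose h x := M^-1 * f x.
have bh : bmf h by exact: bmfZ.
have sh : strong h 1.
  by have := strongZ M^-1 bf sf; rewrite gtr0_norm ?invr_gt0// mulVf// gt_eqF.
have zh : \int[P]_x h x = 0 by rewrite PintegralZ// zf mulr0.
pose h1 x := h (iter (k * n1) F x).
have bh1 : bmf h1 by exact: bmf_iterF.
have wh1 : weak h1 (dl / 32) (dl / 32 / dl).
  by have := hn1 h (And3 bh sh zh); rewrite -/A mulrC divfK// gt_eqF.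
have d32 : 0 <= dl / 32 by rewrite divr_ge0// ltW.
have sh2 := strong_iter l1 g0 g2 dl0 dl1 ck rk n2 bh1 (ltW rate0) d32 (strong_iter1 n1 bh sh) wh1.
have sh3 : strong (fun x => h1 (iter (k * n2) F x)) 2^-1.
  apply: strong_le sh2; have -> : 8 * (dl / 32) / dl = 4^-1 by field; rewrite gt_eqF.
  by move: (rate / _) hn2 => x hx; lra.
have := strongZ M (bmf_iterF Delta (k * n2) bh1) sh3; rewrite gtr0_norm//.
congr (strong _ _); apply/funext => x.
by rewrite /h1 /h -iterD mulVKf// gt_eqF.
Qed.

End compactness.

(** * Decay of correlations *)

Section holder_functions.
Variable R : realType.
Notation T := (torus R).
Notation P := (leb_torus R).
Implicit Types (f phi psi : T -> R) (p q : T) (u v d L alpha : R).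

Lemma circle_dist_toCircle (x : circle R) u : circle_dist (x + toCircle u) x <= `|u|.
Proof.
rewrite /circle_dist addrAC subrr add0r rep_toCircle ge_min.
have [u0|u0] := leP 0 u.
  by rewrite ger0_norm// gerBl ler0z floor_ge0 u0.
apply/orP; right; rewrite ltr0_norm// opprB addrA lerBlDr addNr.
have : Num.floor u < 0 by rewrite floor_lt0.
by move=> h; rewrite -(intrD _ 1) lerz0 addrC lezD1.
Qed.

Lemma circle_dist_ge0 (x y : circle R) : 0 <= circle_dist x y.
Proof. by rewrite /circle_dist le_min rep_ge0 subr_ge0 ltW// rep_lt1. Qed.

Lemma torus_dist_ge0 p q : 0 <= torus_dist p q.
Proof. by rewrite /torus_dist le_max circle_dist_ge0. Qed.

Lemma torus_dist_le1 p q : torus_dist p q <= 1.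
Proof.
have h (x y : circle R) : circle_dist x y <= 1.
  by rewrite /circle_dist ge_min ltW// rep_lt1.
by rewrite /torus_dist ge_max !h.
Qed.

Lemma torus_dist_translate (w : R * R) p : torus_dist (translate w p) p <= Num.max `|w.1| `|w.2|.
Proof.
rewrite /torus_dist /translate/= ge_max !le_max !circle_dist_toCircle.
by rewrite orbT.
Qed.

Lemma holder_translate alpha phi : 0 < alpha -> holder alpha phi ->
  exists2 L, 0 <= L & forall (w : R * R) p d, `|w.1| <= d -> `|w.2| <= d ->
    `|phi (translate w p) - phi p| <= L * d `^ alpha.
Proof.
move=> a0 [L hL]; exists `|L| => // w p d d1 d2.
apply: le_trans (hL _ _) _.
apply: le_trans (ler_wpM2r (powR_ge0 _ _) (ler_norm L)) _; apply: ler_wpM2l => //.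
apply: ge0_ler_powR; rewrite ?nnegrE ?torus_dist_ge0//; first exact: ltW.
  exact: le_trans (normr_ge0 _) d1.
by apply: le_trans (torus_dist_translate _ _) _; rewrite ge_max d1.
Qed.

Lemma holder_bounded alpha phi : 0 < alpha -> holder alpha phi ->
  exists M : R, forall p, `|phi p| <= M.
Proof.
move=> a0 [L hL]; pose o : T := toTorus (0, 0); exists (`|phi o| + `|L|) => p.
rewrite -[phi p](subrK (phi o)) addrC; apply: le_trans (ler_normD _ _) _; rewrite lerD2l.
apply: le_trans (hL _ _) _; apply: le_trans (ler_wpM2r (powR_ge0 _ _) (ler_norm L)) _.
rewrite ler_piMr//; apply: (@le_trans _ _ (1 `^ alpha)); last by rewrite powR1.
by apply: ge0_ler_powR; rewrite ?nnegrE ?torus_dist_ge0 ?torus_dist_le1//; exact: ltW.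
Qed.

(** A superlevel set is the union of the grid cells that it contains, over all mesh sizes: a
    countable union. *)
Lemma holder_measurable alpha phi : 0 < alpha -> holder alpha phi -> measurable_fun setT phi.
Proof.
move=> a0 hphi; have [L L0 hL] := holder_translate a0 hphi.
apply: (measurability _ (RGenOInfty.measurableE R)) => // _ [_ [a ->] <-].
have -> : setT `&` phi @^-1` `]a, +oo[ = \bigcup_N \bigcup_i \bigcup_(j in
    [set j | cell N i j `<=` [set p : T | a < phi p]]) cell N i j.
  rewrite setTI.
  apply/seteqP; split => [p|p]; last first.
    by move=> [N _ [i _ [j /= sub pQ]]]; rewrite /= in_itv/= andbT; exact: sub.
  rewrite /= in_itv/= andbT => ap.
  have [h h0 hh] := @scale_exists R alpha a0 (L + 1) ((phi p - a) / 2)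
    ltac:(by rewrite ltr_wpDl) ltac:(by rewrite divr_gt0// subr_gt0).
  have [N hN] : exists N : nat, N.+1%:R^-1 <= h.
    exists (Num.truncn h^-1); rewrite invf_ple ?posrE//.
    by rewrite ltW// truncnS_gt.
  have [i [j [iN jN pQ]]] := in_cell N p.
  exists N => //; exists i => //; exists j => //= p' p'Q.
  have [u [v [ue ve ->]]] := cell_near pQ p'Q.
  have := hL (u, v) p _ (le_trans ue hN) (le_trans ve hN).
  have h1 : L * h `^ alpha <= (phi p - a) / 2.
    by apply: le_trans hh; rewrite ler_wpM2r ?powR_ge0// lerDl.
  move=> /le_trans /(_ h1); rewrite ler_norml => /andP[+ _].
  move: ap; rewrite /=; move: (phi p) (phi _) => x y; lra.
apply: bigcupT_measurable => N; apply: bigcupT_measurable => i.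
by apply: bigcup_measurable => j _; exact: measurable_cell.
Qed.

Lemma holder_bmf alpha phi : 0 < alpha -> holder alpha phi -> bmf phi.
Proof. by move=> a0 h; split; [exact: holder_measurable h|exact: holder_bounded h]. Qed.

Lemma holderB_cst alpha phi (c : R) : holder alpha phi -> holder alpha (fun p => phi p - c).
Proof. by move=> [L hL]; exists L => p q; rewrite opprB addrA subrK. Qed.

End holder_functions.

Section correlations.
Variables (R : realType) (Delta : R).
Notation T := (torus R).
Notation P := (leb_torus R).
Notation F := (Ftilde Delta).
Variable l : R.
Hypotheses (el : eigenvalue Delta l) (l1 : 1 < `|l|).
Notation m := (l^-1).
Implicit Types (f phi psi : T -> R) (p y : T) (a b d t s ell : R) (n N : nat).

Let m_le1 : `|m| <= 1.
Proof. by rewrite normfV invf_le1 ?(lt_trans _ l1)// ltW. Qed.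

Lemma strong_of_holder alpha g dl k psi : 0 < g -> g <= 2^-1 -> g <= alpha -> alpha <= 1 ->
  0 < dl -> dl <= 1 -> (0 < k)%N -> holder alpha psi ->
  exists2 M : R, 0 < M & strong l g dl k psi M.
Proof.
move=> g0 g2 ga alpha1 dl0 dl1 k0 hpsi.
have a0 : 0 < alpha by exact: lt_le_trans ga.
have bpsi := holder_bmf a0 hpsi.
have [S S0 hS] := bmf_bound bpsi.
have [L L0 hL] := holder_translate a0 hpsi.
exists (S + 2 * L); first by rewrite ltr_wpDr// mulr_ge0.
have g1 : g <= 1 := le_trans ga alpha1.
split => [p ell e0 ed|p d ell d0 dd e0 ed].
  apply: le_trans (itg_le_norm (c := S) (bmf_line l p bpsi) e0 _) _ => //.
  rewrite subr0; apply: ler_pM => //; first exact: ltW.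
    by rewrite lerDl mulr_ge0.
  by apply: le_powR_self => //; exact: le_trans ed dl1.
have b1 := bmf_line l p bpsi; have b2 := bmf_line l (translate (evec m d) p) bpsi.
rewrite /lineint -itgB//.
apply: le_trans (itg_le_norm (c := 2 * L * d `^ g) (bmfB b2 b1) e0 _) _.
  move=> t _; rewrite translateC.
  have h1 : `|(evec m d).1| <= 2 * d by rewrite /= ger0_norm// ler_peMl// ler1n.
  have h2 : `|(evec m d).2| <= 2 * d.
    rewrite /= normrM (ger0_norm d0) ler_wpM2r//; apply: le_trans (ler_normB _ _) _.
    by rewrite normr1 (_ : 2 = 1 + 1)// lerD2l.
  apply: le_trans (hL _ _ _ h1 h2) _; rewrite powRM//.
  rewrite [2 * L]mulrC -mulrA; apply: ler_wpM2l => //.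
  apply: ler_pM; rewrite ?powR_ge0//; first by apply: ler1_powR => //; rewrite ler1n.
  have [->|dn] := eqVneq d 0; first by rewrite powR0 ?powR_ge0// gt_eqF.
  by apply: ger_powR => //; rewrite lt_neqAle eq_sym dn d0 (le_trans dd).
rewrite subr0 -mulrA; apply: (@le_trans _ _ (2 * L * d `^ g)).
  by rewrite mulrA ler_piMr ?mulr_ge0 ?powR_ge0//; exact: le_trans ed dl1.
rewrite ler_wpM2r ?powR_ge0//; apply: (@le_trans _ _ (S + 2 * L)).
  by rewrite lerDr ltW.
rewrite ler_peMl ?addr_ge0 ?mulr_ge0//; first exact: ltW.
by rewrite -natrM ler1n muln_gt0 k0.
Qed.

(** By invariance of the measure both factors may be translated along an unstable segment. Averaging
    over length [ell] freezes [phi] up to its Hoelder error and leaves the segment integral of [f]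
    divided by [ell]. *)
Lemma line_average phi f L Phi S alpha ell W : bmf phi -> bmf f -> 0 < ell -> 0 <= L -> 0 <= S ->
  0 < alpha ->
  (forall (w : R * R) p d, `|w.1| <= d -> `|w.2| <= d ->
    `|phi (translate w p) - phi p| <= L * d `^ alpha) ->
  (forall p, `|phi p| <= Phi) -> (forall p, `|f p| <= S) ->
  (forall p, `|lineint l f p ell| <= W) ->
  `|\int[P]_p (phi p * f p)| <= L * ((1 + `|l|) * ell) `^ alpha * S + Phi * W / ell.
Proof.
move=> bphi bf ell0 L0 S0 a0 hphi hPhi hS hW.
have Phi0 : 0 <= Phi := le_trans (normr_ge0 _) (hPhi (toTorus (0, 0))).
set A := \int[P]_p _; set c := L * _ * S.
pose B t := \int[P]_p (phi p * f (translate (evec l t) p)).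
have b1 : bmf (fun z : T * R => phi z.1 * f (translate (evec l z.2) z.1)).
  apply: bmfM; last exact: bmf_line2.
  exact: (bmf_comp bphi measurable_fst).
have bB : bmf B.
  exact: (@bmf_section_integral1 _ _ T (measurableTypeR R) R P (probability_setT_lty P) _ b1).
have eB : itg B 0 ell = \int[P]_p (phi p * lineint l f p ell).
  rewrite -(itg_Fubini ell b1); apply: eq_Rintegral => p _ /=.
  by rewrite itgZ//; exact: bmf_line.
have hB : `|itg B 0 ell| <= Phi * W.
  rewrite eB; have bl := bmf_lineint l ell bf.
  apply: norm_Pintegral_le; first exact: bmfM.
  by move=> p; rewrite normrM; apply: ler_pM.
have AB t : 0 < t < ell -> `|A - B t| <= c.
  move=> /andP[t0 te].
  have -> : A = \int[P]_p (phi (translate (evec l t) p) * f (translate (evec l t) p)).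
    by rewrite (Pintegral_translate (evec l t) (bmfM bphi bf)).
  rewrite /B -PintegralB; [|by apply: bmfM; [exact: bmf_translate|exact: bmf_translate]|
    by apply: bmfM => //; exact: bmf_translate].
  apply: norm_Pintegral_le => [|p].
    apply: bmfB; apply: bmfM; try exact: bmf_translate.
    exact: bphi.
  rewrite -mulrBl normrM; apply: ler_pM => //.
  apply: hphi => /=.
    rewrite gtr0_norm//; apply: le_trans (ltW te) _.
    by rewrite ler_peMl ?(ltW ell0)// lerDl.
  rewrite normrM (gtr0_norm t0); apply: ler_pM => //; [exact: ltW| |exact: ltW].
  by apply: le_trans (ler_normB _ _) _; rewrite normr1.
have cA : bmf (fun _ : R => A) by exact: bmf_cst.
have h1 : `|A * ell - itg B 0 ell| <= c * ell.
  have := itg_le_norm (bmfB cA bB) (ltW ell0) AB.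
  by rewrite itgB// itg_cst ?subr0// ltW.
rewrite -(ler_pM2r ell0) mulrDl divfK ?gt_eqF//.
rewrite -[X in `|A| * X](gtr0_norm ell0) -normrM.
rewrite -[A * ell](subrK (itg B 0 ell)).
by apply: le_trans (ler_normD _ _) _; exact: lerD.
Qed.

Lemma strong_iter_finite g dl k n f M : 0 < g -> g <= 2^-1 -> 0 < dl -> dl <= 1 ->
  (0 < k)%N -> cuts Delta l 1 dl -> bmf f -> 0 <= M -> strong l g dl k f M ->
  exists2 M', 0 <= M' & strong l g dl k (fun x => f (iter n F x)) M'.
Proof.
move=> g0 g2 dl0 dl1 k0 c1 bf M0 sf; elim: n => [|n [M' M'0 sM']]; first by exists M.
have [M'' M''0 s2] := strong_step_finite l1 g0 g2 dl0 dl1 k0 c1 (bmf_iterF Delta n bf) M'0 sM'.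
exists M'' => //; move: s2; congr (strong _ _ _ _ _ _); apply/funext => x.
by rewrite -iterD addn1.
Qed.

Lemma exp_decay : exp_decay_of_correlations (Ftilde Delta).
Proof.
(* Since [alpha <= 1], this gives [g <= 1 / 2], which the contraction requires; [g <= alpha] puts
   Hoelder functions into the strong class. *)
move=> alpha /andP[a0 alpha1]; pose g := alpha / 2.
have g0 : 0 < g by rewrite divr_gt0.
have g2 : g <= 2^-1 by rewrite ler_piMl.
have ga : g <= alpha by rewrite ler_pdivrMr// ler_peMr ?ltW// ltr1n.
have [k k0 rk] := contraction_time l1 g0.
have [dk dk0 ck] := line_cuts el l1 k.
have [d1 d10 c1] := line_cuts el l1 1.
pose dl := Num.min 1 (Num.min dk d1).
have dl0 : 0 < dl by rewrite !lt_min ltr01 dk0 d10.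
have dl1 : dl <= 1 by rewrite ge_min lexx.
have {}ck : cuts Delta l k dl by apply: cuts_le ck; rewrite /dl !ge_min lexx orbT.
have {}c1 : cuts Delta l 1 dl by apply: cuts_le c1; rewrite /dl !ge_min lexx !orbT.
have [K K0 hK] := contraction el l1 g0 g2 dl0 dl1 k0 ck rk.
(* [kappa] is the gain per block of [K] steps and [theta] its [K]-th root; both are fixed before the
   observables appear. *)
pose kappa : R := 2^-1 `^ g.
have kappa0 : 0 < kappa by rewrite powR_gt0// invr_gt0.
have kappa1 : kappa < 1.
  by rewrite -[ltRHS](one_powR g) gt0_ltr_powR ?nnegrE ?invr_ge0// invf_lt1// ltr1n.
pose theta := kappa `^ K%:R^-1.
have Kr0 : 0 < K%:R :> R by rewrite ltr0n.
have theta0 : 0 < theta by rewrite powR_gt0.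
have theta1 : theta < 1.
  by rewrite -[ltRHS](one_powR K%:R^-1) gt0_ltr_powR ?invr_gt0// nnegrE// ltW.
have thetaK : theta ^+ K = kappa.
  by rewrite -powR_mulrn ?ltW// -powRrM mulVf ?gt_eqF// powRr1// ltW.
exists theta; split; first by rewrite theta0.
move=> phi psi hphi hpsi.
have bphi := holder_bmf a0 hphi.
have [Phi Phi0 hPhi] := bmf_bound bphi.
have [L L0 hL] := holder_translate a0 hphi.
pose c := \int[P]_p psi p; pose psi0 p := psi p - c.
have hpsi0 : holder alpha psi0 by exact: holderB_cst.
have bpsi := holder_bmf a0 hpsi.
have bpsi0 : bmf psi0 by exact: (holder_bmf a0 hpsi0).
have [S S0 hS] := bmf_bound bpsi0.
have zpsi0 : \int[P]_p psi0 p = 0.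
  by rewrite PintegralB//; [rewrite Pintegral_cst subrr|exact: bmf_cst].
have [M0 M00 sM0] := strong_of_holder g0 g2 ga alpha1 dl0 dl1 k0 hpsi0.
have fin r : exists M, 0 <= M /\ strong l g dl k (fun x => psi0 (iter r F x)) M.
  have [M' ? ?] := strong_iter_finite r g0 g2 dl0 dl1 k0 c1 bpsi0 (ltW M00) sM0.
  by exists M'.
have [Ms hMs] := choice fin.
pose M := 1 + \sum_(r < K) Ms r.
have M_gt0 : 0 < M by rewrite ltr_wpDr// sumr_ge0// => r _; have [] := hMs r.
have sM r : (r < K)%N -> strong l g dl k (fun x => psi0 (iter r F x)) M.
  move=> rK; have [_] := hMs r; apply: strong_le; rewrite /M (bigD1 (Ordinal rK))//=.
  by rewrite addrCA lerDl addr_ge0// sumr_ge0// => i _; have [] := hMs i.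
have decay r q : (r < K)%N ->
    strong l g dl k (fun x => psi0 (iter (r + K * q) F x)) (M / 2 ^+ q).
  move=> rK; elim: q => [|q IH]; first by rewrite muln0 addn0 expr0 divr1; exact: sM.
  have Mq : 0 < M / 2 ^+ q by rewrite divr_gt0// exprn_gt0.
  have z : \int[P]_x psi0 (iter (r + K * q) F x) = 0 by rewrite Pintegral_iterF.
  have := hK _ _ Mq (bmf_iterF Delta (r + K * q) bpsi0) IH z.
  rewrite exprSr invfM mulrA; congr (strong _ _ _ _ _ _); apply/funext => x.
  by rewrite -iterD mulnSr addnA.
pose A := L * (1 + `|l|) `^ alpha * S + Phi * M / dl.
have A0 : 0 <= A.
  by rewrite addr_ge0// ?divr_ge0 ?mulr_ge0 ?powR_ge0// ltW.
exists (A / kappa + 1); split; first by rewrite ltr_wpDl// divr_ge0// ltW.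
move=> n.
have -> : \int[P]_p (phi p * psi (iter n F p)) - \int[P]_p phi p * \int[P]_p psi p =
    \int[P]_p (phi p * psi0 (iter n F p)).
  have b1 := bmfM bphi (bmf_iterF Delta n bpsi).
  have b2 : bmf (fun p => c * phi p) by exact: bmfZ.
  rewrite mulrC -/c -PintegralZ// -PintegralB//.
  by apply: eq_Rintegral => p _; rewrite /psi0 mulrBr [c * _]mulrC.
pose q := (n %/ K)%N; pose r := (n %% K)%N.
have rK : (r < K)%N by rewrite ltn_mod.
have nE : n = (r + K * q)%N by rewrite addnC mulnC -divn_eq.
have sf := decay r q rK; rewrite -nE in sf.
(* At this length the strong bound [M / 2 ^+ q] exactly cancels the division by [ell], and both
   error terms are of order [ell ^ g], at most [kappa ^+ q]. *)
pose ell := dl / 2 ^+ q.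
have tq0 : 0 < 2 ^+ q :> R by rewrite exprn_gt0.
have ell0 : 0 < ell by rewrite divr_gt0.
have elld : ell <= dl by rewrite ler_pdivrMr// ler_peMr ?(ltW dl0)// exprn_ege1// ler1n.
have ellk : ell `^ g <= kappa ^+ q.
  rewrite -powR_pow ?invr_ge0//; apply: le_powR_mono => //; first exact: ltW.
  by rewrite exprVn /ell ler_piMl// invr_ge0 ltW.
have [su _] := sf.
have hW p := su p ell (ltW ell0) elld.
have bf := bmf_iterF Delta n bpsi0.
have hS' p : `|psi0 (iter n F p)| <= S by exact: hS.
have := line_average bphi bf ell0 L0 (ltW S0) a0 hL hPhi hS' hW.
(* The incomplete block of [r < K] steps costs at most one factor [kappa], whence [A / kappa] in the
   constant. *)
have kq : kappa ^+ q <= kappa^-1 * theta ^+ n.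
  have h : 1 <= kappa^-1 * theta ^+ r.
    rewrite ler_pdivlMl// mulr1 -thetaK.
    by apply: ler_wiXn2l; [exact: ltW|exact: ltW|exact: ltnW].
  rewrite nE exprD exprM thetaK mulrA ler_peMl//.
  by rewrite exprn_ge0// ltW.
have l0 : 0 <= 1 + `|l| by rewrite addr_ge0.
move=> /le_trans; apply; apply: (@le_trans _ _ (A * kappa ^+ q)); last first.
  apply: (@le_trans _ _ (A * (kappa^-1 * theta ^+ n))); first exact: ler_wpM2l.
  by rewrite mulrA ler_wpM2r ?exprn_ge0 ?ltW// ltrDl.
rewrite /A [leRHS]mulrDl; apply: lerD.
  rewrite powRM// ?(ltW ell0)// mulrA mulrAC; apply: ler_wpM2l.
    by rewrite !mulr_ge0 ?powR_ge0// ltW.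
  apply: le_trans ellk; apply: ger_powR => //.
  by rewrite ell0 (le_trans elld).
have -> : Phi * (M / 2 ^+ q * ell `^ g) / ell = Phi * M / dl * ell `^ g.
  by rewrite /ell; field; rewrite !gt_eqF.
by apply: ler_wpM2l ellk; rewrite divr_ge0 ?mulr_ge0// ltW.
Qed.

End correlations.

(** Of the two real roots [(t + e * s) / 2], the one where [e] has the sign of [t] is at least
    [|t| / 2] in absolute value, hence beyond 1. *)
Lemma eigenvalue_exists (R : realType) (Delta : R) : 2 < `|2 - Delta| ->
  exists2 l : R, eigenvalue Delta l & 1 < `|l|.
Proof.
set t := 2 - Delta => t2.
pose s := Num.sqrt (t ^+ 2 - 4).
have s0 : 0 < t ^+ 2 - 4.
  rewrite subr_gt0 -(real_normK (num_real t)) (_ : 4 = 2 ^+ 2); last by rewrite -natrX.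
  by rewrite ltrXn2r.
have ss : s ^+ 2 = t ^+ 2 - 4 by rewrite sqr_sqrtr// ltW.
have sp : 0 < s by rewrite sqrtr_gt0.
have root (e : R) : e ^+ 2 = 1 -> eigenvalue Delta ((t + e * s) / 2).
  move=> e1; rewrite /eigenvalue -/t.
  have -> : ((t + e * s) / 2) ^+ 2 - t * ((t + e * s) / 2) + 1 =
      (e ^+ 2 * s ^+ 2 - t ^+ 2 + 4) / 4 by field.
  by rewrite e1 ss mul1r opprD !addrA; field.
have [tp|tn] := leP 0 t.
  exists ((t + 1 * s) / 2); first by apply: root; rewrite expr1n.
  rewrite ger0_norm// in t2; rewrite ger0_norm; last by rewrite divr_ge0// addr_ge0 ?mulr_ge0// ltW.
  by rewrite mul1r ltr_pdivlMr// mul1r ltr_wpDr// ltW.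
exists ((t + (-1) * s) / 2); first by apply: root; rewrite sqrrN expr1n.
rewrite ltr0_norm// in t2; rewrite ltr0_norm.
  by rewrite -mulNr opprD mulN1r opprK ltr_pdivlMr// mul1r ltr_wpDr// ltW.
by rewrite ltr_pdivrMr// mul0r mulN1r subr_lt0 (lt_trans tn).
Qed.

Theorem theorem2 (R : realType) (Delta : R) (A : 'M[R]_2)
    (A_dF : is_dFtilde Delta A) (A_hyp : 2 < `|\tr A|) :
  [/\ ergodic (leb_torus R) (Ftilde Delta),
      mixing (leb_torus R) (Ftilde Delta) &
      exp_decay_of_correlations (Ftilde Delta)].
Proof.
move: A_hyp; rewrite (is_dFtilde_unique A_dF) mxtrace_dFtilde.
move=> /eigenvalue_exists[l el l1]; split.
- exact: sawtooth_ergodic el l1.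
- exact: sawtooth_mixing el l1.
- exact: exp_decay el l1.
Qed.
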